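(* The map $\mathbf f\mapsto L(\mathbf f)$ defines a bijection between the set $\mathcal R$ of rational $\ell$-weights and the set of isomorphism classes of simple objects of the category $\hat{\mathcal O}$ of $U_q(\widehat{\mathfrak g})$-modules.
   Context: Algebra. $\mathfrak g$ is a complex simple Lie algebra of rank $N$ with Cartan subalgebra $\mathfrak h$; $I=\{1,\dots,N\}$ indexes its simple roots $\alpha_i$ and fundamental weights $\omega_i$; $Q^+=\bigoplus_i\mathbb Z_{\ge 0}\alpha_i$; $C$ is the Cartan matrix and $r_i$ are the relatively prime positive integers making $B_{ij}=r_iC_{ij}$ symmetric. $q\in\mathbb C^\times$ is a fixed transcendental number, $q^\mu$ ($\mu\in\mathbb C$) is defined via a fixed logarithm of $q$, $q_i=q^{r_i}$, $[n]_q=(q^n-q^{-n})/(q-q^{-1})$. $U_q(\widehat{\mathfrak g})$ is the untwisted quantum affine algebra in Drinfeld's presentation: generators $x^\pm_{i,n}$ ($i\in I,n\in\mathbb Z$), $k_i^{\pm1}$, $h_{i,n}$ ($n\neq 0$), central $c^{\pm1/2}$; relations: the $k_i$ commute with each other and with all $h_{j,n}$; $k_ix^\pm_{j,n}k_i^{-1}=q^{\pm B_{ij}}x^\pm_{j,n}$; $[h_{i,n},x^\pm_{j,m}]=\pm\frac1n[nB_{ij}]_q c^{\mp|n|/2}x^\pm_{j,n+m}$; $x^\pm_{i,n+1}x^\pm_{j,m}-q^{\pm B_{ij}}x^\pm_{j,m}x^\pm_{i,n+1}=q^{\pm B_{ij}}x^\pm_{i,n}x^\pm_{j,m+1}-x^\pm_{j,m+1}x^\pm_{i,n}$;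 $[h_{i,n},h_{j,m}]=\delta_{n,-m}\frac1n[nB_{ij}]_q\frac{c^n-c^{-n}}{q-q^{-1}}$; $[x^+_{i,n},x^-_{j,m}]=\delta_{ij}\frac{c^{(n-m)/2}\phi^+_{i,n+m}-c^{-(n-m)/2}\phi^-_{i,n+m}}{q_i-q_i^{-1}}$; and the usual quantum Serre relations. Here $\phi_i^\pm(u)=\sum_{n\ge0}\phi^\pm_{i,\pm n}u^{\pm n}=k_i^{\pm1}\exp\big(\pm(q-q^{-1})\sum_{m\ge1}h_{i,\pm m}u^{\pm m}\big)$ and $\phi^+_{i,-n}=\phi^-_{i,n}=0$ for $n>0$. The elements $x_i^\pm=x_{i,0}^\pm$, $k_i^{\pm1}$ ($i\in I$) generate a copy of $U_q(\mathfrak g)$. Weights and categories. For $\lambda=\sum_i\lambda_i\omega_i\in\mathfrak h^*$ put $\overline\lambda=(q_i^{\lambda_i})_{i\in I}\in(\mathbb C^\times)^N$; weights are elements of $(\mathbb C^\times)^N$ (with componentwise multiplication), and $\overline{Q^+}$ is the image of $Q^+$. A $U_q(\mathfrak g)$-module $V$ is in category $\mathcal O$ if $V=\bigoplus_\varrho V_\varrho$, $V_\varrho=\{v:k_iv=\varrho_iv\ \forall i\}$, all $V_\varrho$ are finite-dimensional, and there are finitely many weights $\varrho_1,\dots,\varrho_k$ such that every weight of $V$ lies in $\bigcup_j\{\varrho_jx^{-1}:x\in\overline{Q^+}\}$. A $U_q(\widehat{\mathfrak g})$-module is in category $\hat{\mathcal O}$ if its restriction to $U_q(\mathfrak g)$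 is in $\mathcal O$ and $c^{1/2}$ acts as the identity. Rational $\ell$-weights. An $\ell$-weight is a tuple $(f^\pm_{i,\pm r})_{i\in I,r\ge0}$ of complex numbers with $f^+_{i,0}f^-_{i,0}=1$. It is rational if there are rational functions $f_i(u)$, $i\in I$, regular at $0$ and $\infty$, with $f_i(0)f_i(\infty)=1$ and $\sum_{r\ge0}f^+_{i,r}u^r=f_i(u)=\sum_{r\ge0}f^-_{i,-r}u^{-r}$ as Laurent expansions at $0$ and $\infty$. $\mathcal R$ is the set of rational $\ell$-weights. For $\mathbf f\in\mathcal R$, $L(\mathbf f)$ is the irreducible $U_q(\widehat{\mathfrak g})$-module (unique up to isomorphism, with $c^{1/2}$ acting as the identity) generated by a nonzero vector $v$ with $x^+_{i,r}v=0$ for all $i\in I,r\in\mathbb Z$ and $\phi^\pm_{i,\pm r}v=f^\pm_{i,\pm r}v$ for all $i\in I,r\ge0$. *)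

(* Defs.v *)
From HB Require Import structures.
From mathcomp Require Import all_boot all_order all_algebra.
From mathcomp Require Import fingroup perm ring_quotient generic_quotient.
From mathcomp Require Import finmap monalg complex.
From mathcomp Require Import boolp classical_sets functions cardinality.
From mathcomp Require Import fsbigop reals.

Set Implicit Arguments.
Unset Strict Implicit.
Unset Printing Implicit Defensive.

Import Order.TTheory GRing.Theory Num.Theory.

Local Open Scope classical_set_scope.
Local Open Scope ring_scope.

(* The complex simple Lie algebra g enters only through its Cartan matrix
   C i j = alpha_j(alpha_i^vee): by the Cartan-Killing classification the
   Cartan matrices of complex simple Lie algebras of rank N are exactly the
   indecomposable N x N Cartan matrices of finite type. *)
Section CartanDatum.
Variables (R : realType) (N : nat) (C : 'M[int]_N) (r : 'I_N -> nat).

Definition symmetrized_cartan : 'M[int]_N :=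
  \matrix_(i, j) ((r i)%:Z * C i j).

Definition cartan_matrix : Prop :=
  [/\ forall i, C i i = 2,
      forall i j, i != j -> C i j <= 0 &
      forall i j, C i j = 0 -> C j i = 0].

Definition indecomposable_matrix : Prop :=
  forall S : {set 'I_N}, S != finset.set0 -> S != [set: 'I_N]%SET ->
  exists i j, [/\ i \in S, j \notin S & C i j != 0].

Definition positive_definite (B : 'M[R]_N) : Prop :=
  forall x : 'cV[R]_N, x != 0 -> 0 < (x^T *m B *m x) 0 0.

Definition simple_cartan_datum : Prop :=
  [/\ (0 < N)%N, cartan_matrix /\ indecomposable_matrix,
      (forall i, (0 < r i)%N) /\ \big[gcdn/0%N]_i r i = 1%N,
      symmetrized_cartan^T = symmetrized_cartan &
      positive_definite (map_mx intr symmetrized_cartan)].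

End CartanDatum.

Section QuantumNumbers.
Variables (K : fieldType).

Definition qint (q : K) (n : int) : K := (q ^ n - q ^ (- n)) / (q - q^-1).

Definition qfact (q : K) (n : nat) : K := \prod_(1 <= j < n.+1) qint q j.

Definition qbinom (q : K) (n k : nat) : K :=
  qfact q n / (qfact q k * qfact q (n - k)).

End QuantumNumbers.

(* A sign is a boolean: true stands for +, false for -. *)
Definition sgi (s : bool) : int := if s then 1 else -1.

(* GenX s i n = x^s_{i,n}, GenK s i = k_i^{s1}, GenC s = c^{s1/2};
   GenH s i m = h_{i, s(m+1)}, so that h_{i,0} is not a generator. *)
Inductive drinfeld_gen (N : nat) :=
| GenX of bool & 'I_N & int
| GenK of bool & 'I_N
| GenH of bool & 'I_N & nat
| GenC of bool.

HB.instance Definition _ N := gen_eqMixin (drinfeld_gen N).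
HB.instance Definition _ N := gen_choiceMixin (drinfeld_gen N).

Lemma malg_scalerAr (K : comNzRingType) (M : monomType) (a : K)
  (x y : {malg K[M]}) : a *: (x * y) = x * (a *: y).
Proof.
apply/malgP => m; rewrite mcoeffZ.
rewrite (mcoeffMlw m (fsubset_refl (msupp x)) (fsubset_refl (msupp y))).
rewrite (mcoeffMlw m (fsubset_refl (msupp x)) (msuppZ_le a y)) mulr_sumr.
apply: eq_bigr => k1 _; rewrite mulr_sumr; apply: eq_bigr => k2 _.
by rewrite mulrnAr mcoeffZ mulrCA.
Qed.

(* The free associative K-algebra on I: the monoid algebra of the free monoid.
   Its operations are those of the monoid algebra; products and scalings are
   locked for the sake of unification. *)
Definition free_alg (K : comNzRingType) (I : choiceType) : Type :=
  {malg K[{fmonom I}]}.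

HB.lock Definition free_gen (K : comNzRingType) (I : choiceType) (x : I) :
  free_alg K I := << fmu x >>.

HB.lock Definition free_mul (K : comNzRingType) (I : choiceType)
  (x y : free_alg K I) : free_alg K I := (x : {malg K[{fmonom I}]}) * y.

HB.lock Definition free_scale (K : comNzRingType) (I : choiceType) (a : K)
  (x : free_alg K I) : free_alg K I := a *: (x : {malg K[{fmonom I}]}).

Section FreeAlgebra.
Variables (K : comNzRingType) (I : choiceType).
Local Notation FA := (free_alg K I).
Local Notation MA := {malg K[{fmonom I}]}.

HB.instance Definition _ := GRing.Zmodule.copy FA MA.

Lemma free_mulE (x y : FA) : free_mul x y = (x : MA) * y.
Proof. by rewrite unlock. Qed.

Lemma free_mulA : associative (@free_mul K I).
Proof. by move=> x y z; rewrite !free_mulE mulrA. Qed.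

Lemma free_mul1x : left_id (1 : MA) (@free_mul K I).
Proof. by move=> x; rewrite free_mulE mul1r. Qed.

Lemma free_mulx1 : right_id (1 : MA) (@free_mul K I).
Proof. by move=> x; rewrite free_mulE mulr1. Qed.

Lemma free_mulDl : left_distributive (@free_mul K I) +%R.
Proof. by move=> x y z; rewrite !free_mulE; exact: mulrDl. Qed.

Lemma free_mulDr : right_distributive (@free_mul K I) +%R.
Proof. by move=> x y z; rewrite !free_mulE; exact: mulrDr. Qed.

Lemma free_one_neq0 : (1 : MA) != 0 :> FA.
Proof. exact: (oner_neq0 MA). Qed.

HB.instance Definition _ := GRing.Zmodule_isNzRing.Build FA
  free_mulA free_mul1x free_mulx1 free_mulDl free_mulDr free_one_neq0.

Lemma free_scaleE a (x : FA) : free_scale a x = a *: (x : MA).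
Proof. by rewrite unlock. Qed.

Lemma free_scaleA a b (x : FA) :
  free_scale a (free_scale b x) = free_scale (a * b) x.
Proof. by rewrite !free_scaleE scalerA. Qed.

Lemma free_scale1 : left_id 1 (@free_scale K I).
Proof. by move=> x; rewrite free_scaleE scale1r. Qed.

Lemma free_scaleDr : right_distributive (@free_scale K I) +%R.
Proof. by move=> a x y; rewrite !free_scaleE; exact: scalerDr. Qed.

Lemma free_scaleDl (x : FA) : {morph (@free_scale K I)^~ x : a b / a + b}.
Proof. by move=> a b; rewrite !free_scaleE; exact: scalerDl. Qed.

HB.instance Definition _ := GRing.Zmodule_isLmodule.Build K FA
  free_scaleA free_scale1 free_scaleDr free_scaleDl.

Lemma free_scalerAl (a : K) (x y : FA) :
  a *: (x * y : FA) = (a *: x : FA) * y.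
Proof. rewrite /GRing.mul /GRing.scale /= !free_mulE !free_scaleE.
exact: (@scalerAl K MA). Qed.

HB.instance Definition _ := GRing.Lmodule_isLalgebra.Build K FA free_scalerAl.

Lemma free_scalerAr (a : K) (x y : FA) :
  a *: (x * y : FA) = x * (a *: y : FA).
Proof. rewrite /GRing.mul /GRing.scale /= !free_mulE !free_scaleE.
exact: malg_scalerAr. Qed.

HB.instance Definition _ := GRing.Lalgebra_isAlgebra.Build K FA free_scalerAr.

End FreeAlgebra.

Section FreeAlgebraEval.
Variables (K : comNzRingType) (I : choiceType) (e : I -> K).

Definition free_mon_eval (m : {fmonom I}) : K := \prod_(x <- (m : seq I)) e x.

Lemma free_mon_eval_mmorphism : mmorphism free_mon_eval.
Proof.
split=> [x y|]; first by rewrite /free_mon_eval fmM big_cat.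
by rewrite /free_mon_eval fm1 big_nil.
Qed.

HB.instance Definition _ :=
  isMultiplicative.Build _ _ free_mon_eval free_mon_eval_mmorphism.

Local Notation ev :=
  (mmap idfun free_mon_eval : {malg K[{fmonom I}]} -> K).

Definition free_eval (x : free_alg K I) : K := ev x.

Lemma free_eval_zmod : zmod_morphism free_eval.
Proof. by move=> x y; exact: (rmorphB ev). Qed.

Lemma free_eval_monoid : monoid_morphism free_eval.
Proof.
split=> [|x y]; first exact: (rmorph1 ev).
by rewrite /GRing.mul /= free_mulE; exact: (rmorphM ev).
Qed.

Lemma free_eval_scalable : scalable_for *%R free_eval.
Proof. by move=> a x; rewrite {1}/GRing.scale /= free_scaleE; exact: mmapZ. Qed.

HB.instance Definition _ :=
  GRing.isZmodMorphism.Build (free_alg K I) K free_eval free_eval_zmod.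
HB.instance Definition _ :=
  GRing.isMonoidMorphism.Build (free_alg K I) K free_eval free_eval_monoid.
HB.instance Definition _ :=
  GRing.isScalable.Build K (free_alg K I) K *%R free_eval free_eval_scalable.

Lemma free_eval_gen x : free_eval (free_gen K x) = e x.
Proof.
by rewrite unlock /free_eval mmapU mul1r /= /free_mon_eval fmU big_seq1.
Qed.

End FreeAlgebraEval.

Section QuantumAffine.
Variables (R : realType) (N : nat) (C : 'M[int]_N) (r : 'I_N -> nat).
Variable q : R[i].

Local Notation FA := (free_alg R[i] (drinfeld_gen N)).
Local Notation g := (@free_gen R[i] (drinfeld_gen N)).
Local Notation B := (symmetrized_cartan C r).

Definition qi (i : 'I_N) : R[i] := q ^+ r i.

Definition fx (s : bool) (i : 'I_N) (n : int) : FA := g (GenX s i n).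
Definition fk (s : bool) (i : 'I_N) : FA := g (GenK s i).
Definition fh (i : 'I_N) (n : int) : FA :=
  match n with
  | Posz 0 => 0
  | Posz m.+1 => g (GenH true i m)
  | Negz m => g (GenH false i m)
  end.

(* c^{m/2} *)
Definition fc (m : int) : FA :=
  match m with
  | Posz n => g (GenC N true) ^+ n
  | Negz n => g (GenC N false) ^+ n.+1
  end.

(* The terms of degree at most n of
   s (q - q^-1) \sum_(m >= 1) h_{i, sm} u^{sm}, as a polynomial in u^s. *)
Definition fh_series (s : bool) (i : 'I_N) (n : nat) : {poly FA} :=
  \sum_(1 <= m < n.+1)
    (((sgi s)%:~R * (q - q^-1)) *: fh i (sgi s * m%:Z))%:P * 'X^m.

(* phi^s_{i, sn}, n >= 0: the coefficient of u^{sn} in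
   k_i^s exp(s (q - q^-1) \sum_(m >= 1) h_{i, sm} u^{sm}); as the series in
   the exponential has no constant term, its powers beyond the n-th do not
   contribute. *)
Definition fphi (s : bool) (i : 'I_N) (n : nat) : FA :=
  fk s i * \sum_(l < n.+1) (l`!%:R^-1 : R[i]) *: (fh_series s i n ^+ l)`_n.

(* phi^s_{i, n} for all n : int *)
Definition fphiz (s : bool) (i : 'I_N) (n : int) : FA :=
  if 0 <= sgi s * n then fphi s i `|n|%N else 0.

(* The two sides of the defining relations. *)
Inductive drinfeld_rel : FA -> FA -> Prop :=
| rel_cc s : drinfeld_rel (g (GenC N s) * g (GenC N (~~ s))) 1
| rel_c_central s y :
    drinfeld_rel (g (GenC N s) * g y) (g y * g (GenC N s))
| rel_kk s i : drinfeld_rel (fk s i * fk (~~ s) i) 1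
| rel_k_comm i j :
    drinfeld_rel (fk true i * fk true j) (fk true j * fk true i)
| rel_kh i j (n : int) : n != 0 ->
    drinfeld_rel (fk true i * fh j n) (fh j n * fk true i)
| rel_kx s i j n :
    drinfeld_rel (fk true i * fx s j n * fk false i)
                 (q ^ (sgi s * B i j) *: fx s j n)
| rel_hx s i j (n m : int) : n != 0 ->
    drinfeld_rel (fh i n * fx s j m - fx s j m * fh i n)
                 (((sgi s)%:~R * (n%:~R^-1 * qint q (n * B i j))) *:
                    (fc (- (sgi s * `|n|)) * fx s j (n + m)))
| rel_xx s i j (n m : int) :
    drinfeld_rel (fx s i (n + 1) * fx s j m
                    - q ^ (sgi s * B i j) *: (fx s j m * fx s i (n + 1)))
                 (q ^ (sgi s * B i j) *: (fx s i n * fx s j (m + 1))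
                    - fx s j (m + 1) * fx s i n)
| rel_hh i j (n m : int) : n != 0 -> m != 0 ->
    drinfeld_rel (fh i n * fh j m - fh j m * fh i n)
                 (if n == - m then
                    (n%:~R^-1 * qint q (n * B i j) / (q - q^-1)) *:
                      (fc (2 * n) - fc (- (2 * n)))
                  else 0)
| rel_x_x i j n m :
    drinfeld_rel (fx true i n * fx false j m - fx false j m * fx true i n)
                 (if i == j then
                    (qi i - (qi i)^-1)^-1 *:
                      (fc (n - m) * fphiz true i (n + m)
                        - fc (- (n - m)) * fphiz false i (n + m))
                  else 0)
| rel_serre s (i j : 'I_N) (d : nat) (n : 'I_d -> int) m :
    i != j -> d%:Z = 1 - C i j ->
    drinfeld_rel
      (\sum_(p : 'S_d) \sum_(l < d.+1)
         ((-1) ^+ l * qbinom (qi i) d l) *: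
           (\prod_(a < d | (a < l)%N) fx s i (n (p a)) * fx s j m
             * \prod_(a < d | (l <= a)%N) fx s i (n (p a)))) 0.

Inductive drinfeld_ideal : FA -> Prop :=
| ideal_gen x y : drinfeld_rel x y -> drinfeld_ideal (x - y)
| ideal_0 : drinfeld_ideal 0
| ideal_add x y :
    drinfeld_ideal x -> drinfeld_ideal y -> drinfeld_ideal (x + y)
| ideal_mul a x b : drinfeld_ideal x -> drinfeld_ideal (a * x * b).

Lemma drinfeld_ideal_mull a x : drinfeld_ideal x -> drinfeld_ideal (a * x).
Proof. by move=> /(ideal_mul a 1); rewrite mulr1. Qed.

Lemma drinfeld_ideal_mulr x b : drinfeld_ideal x -> drinfeld_ideal (x * b).
Proof. by move=> /(ideal_mul 1 b); rewrite mul1r. Qed.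

Definition drinfeld_ideal_pred : {pred FA} :=
  [pred x | `[< drinfeld_ideal x >]].

Lemma drinfeld_ideal_zmod_closed : zmod_closed drinfeld_ideal_pred.
Proof.
split=> [|x y]; first exact/asboolP/ideal_0.
move=> /asboolP Ix /asboolP Iy; apply/asboolP/ideal_add => //.
by rewrite -mulN1r; exact: drinfeld_ideal_mull.
Qed.

HB.instance Definition _ :=
  GRing.isZmodClosed.Build FA drinfeld_ideal_pred drinfeld_ideal_zmod_closed.

(* The counit x |-> 0, h |-> 0, k |-> 1, c |-> 1 kills the relations, so the
   quotient is nontrivial. *)
Definition counit_gen (y : drinfeld_gen N) : R[i] :=
  match y with
  | GenX _ _ _ | GenH _ _ _ => 0
  | GenK _ _ | GenC _ => 1
  end.

Definition counit : FA -> R[i] := free_eval counit_gen.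
HB.instance Definition _ := GRing.LRMorphism.on counit.

Lemma counit_g y : counit (g y) = counit_gen y.
Proof. exact: free_eval_gen. Qed.

Lemma counit_fh i n : counit (fh i n) = 0.
Proof. by case: n => [[|n]|n] /=; rewrite ?rmorph0 ?counit_g. Qed.

Lemma counit_fc m : counit (fc m) = 1.
Proof. by case: m => n /=; rewrite rmorphXn /= counit_g expr1n. Qed.

Lemma counit_fphi s i n : counit (fphi s i n) = (n == 0%N)%:R.
Proof.
have hs0 : map_poly counit (fh_series s i n) = 0.
  rewrite rmorph_sum big1 // => m _.
  by rewrite rmorphM /= map_polyC /= linearZ /= counit_fh mulr0 mul0r.
rewrite rmorphM /= counit_g mul1r raddf_sum big_ord_recl /= big1 ?addr0.
  by rewrite fact0 invr1 scale1r expr0 coef1 rmorph_nat.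
move=> l _; rewrite linearZ /= -coef_map rmorphXn /= hs0.
by rewrite expr0n coef0 mulr0.
Qed.

Lemma counit_fphiz s i n : counit (fphiz s i n) = (n == 0)%:R.
Proof.
rewrite /fphiz; case: ifP => [_|sn]; first by rewrite counit_fphi absz_eq0.
by rewrite rmorph0; case: eqP sn => [->|//]; rewrite mulr0 lexx.
Qed.

Lemma counitM : {morph counit : x y / x * y}. Proof. exact: rmorphM. Qed.
Lemma counitB : {morph counit : x y / x - y}. Proof. exact: rmorphB. Qed.
Lemma counitZ (a : R[i]) x : counit (a *: x) = a * counit x.
Proof. exact: linearZ. Qed.
Lemma counit0 : counit 0 = 0. Proof. exact: rmorph0. Qed.
Lemma counit1 : counit 1 = 1. Proof. exact: rmorph1. Qed.
Lemma counit_sum (I : finType) (F : I -> FA) :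
  counit (\sum_i F i) = \sum_i counit (F i).
Proof. exact: rmorph_sum. Qed.

Lemma counit_fx s i n : counit (fx s i n) = 0. Proof. exact: counit_g. Qed.
Lemma counit_fk s i : counit (fk s i) = 1. Proof. exact: counit_g. Qed.
Lemma counit_c s : counit (g (GenC N s)) = 1. Proof. exact: counit_g. Qed.

Lemma counit_drinfeld_rel x y : drinfeld_rel x y -> counit x = counit y.
Proof.
case=> [s|s z|s i|i j|i j n _|s i j n|s i j n m _|s i j n m|i j n m _ _
       |i j n m|s i j d n m _ _].
- by rewrite counitM !counit_c counit1 mulr1.
- by rewrite counitM (counitM (g z)) mulrC.
- by rewrite counitM !counit_fk counit1 mulr1.
- by rewrite counitM (counitM (fk _ j)) mulrC.
- by rewrite counitM (counitM (fh _ _)) mulrC.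
- by rewrite counitZ counitM (counitM (fk _ _)) !counit_fx mulr0 mul0r mulr0.
- by rewrite counitZ counitB (counitM (fh _ _)) (counitM (fx _ _ _))
    (counitM (fc _)) !counit_fx !mulr0 mul0r subr0.
- by rewrite 2!counitB 2!counitZ (counitM (fx s i (n + 1))) (counitM (fx s j m))
    (counitM (fx s i n)) (counitM (fx s j (m + 1))) !counit_fx !mulr0.
- rewrite counitB (counitM (fh i n)) (counitM (fh j m)) !counit_fh mulr0 subr0.
  case: ifP => _; last by rewrite counit0.
  by rewrite counitZ counitB !counit_fc subrr mulr0.
- rewrite counitB (counitM (fx _ i n)) (counitM (fx _ j m)) !counit_fx mulr0.
  rewrite subr0.
  case: ifP => _; last by rewrite counit0.
  have := (counit_fc (n - m), counit_fc (- (n - m)),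
           counit_fphiz true i (n + m), counit_fphiz false i (n + m)).
  move: (fc (n - m)) (fc (- (n - m))) (fphiz true i (n + m))
    (fphiz false i (n + m)) => a b x' y' [[[ea eb] ex] ey].
  by rewrite counitZ counitB (counitM a) (counitM b) ea eb ex ey subrr mulr0.
- rewrite counit0 counit_sum big1 // => p _; rewrite counit_sum big1 // => l _.
  rewrite counitZ; set P := \prod_(a < d | _) _; set P' := \prod_(a < d | _) _.
  by rewrite counitM (counitM P) counit_fx mulr0 mul0r mulr0.
Qed.

Lemma counit_drinfeld_ideal x : drinfeld_ideal x -> counit x = 0.
Proof.
elim=> [y z /counit_drinfeld_rel yz||y z _ y0 _ z0|a y b _ y0].
- by rewrite counitB yz subrr.
- exact: counit0.
- by rewrite rmorphD /= y0 z0 addr0.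
- by rewrite !counitM y0 mulr0 mul0r.
Qed.

Lemma drinfeld_ideal_proper : ~ drinfeld_ideal 1.
Proof. by move=> /counit_drinfeld_ideal/eqP; rewrite counit1 oner_eq0. Qed.

Local Open Scope quotient_scope.

(* U_q(g^): the free algebra on the Drinfeld generators modulo the two-sided
   ideal generated by the relations. *)
Definition Uq := Quotient.quot drinfeld_ideal_pred.

HB.instance Definition _ := GRing.Zmodule.on Uq.
HB.instance Definition _ := EqQuotient.on Uq.

Lemma Uq_eqP (x y : FA) : reflect (drinfeld_ideal (x - y)) (x == y %[mod Uq]).
Proof. by rewrite -Quotient.idealrBE; exact: asboolP. Qed.

Definition Uq_one : Uq := \pi_Uq (1 : FA).
Definition Uq_mul (x y : Uq) : Uq := locked (\pi_Uq (repr x * repr y)).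
Definition Uq_scale (a : R[i]) (x : Uq) : Uq :=
  locked (\pi_Uq (a *: repr x)).

Lemma Uq_piD (x y : FA) : \pi_Uq (x + y) = \pi_Uq x + \pi_Uq y :> Uq.
Proof. by rewrite !piE. Qed.

Lemma Uq_repr_pi (x : FA) : drinfeld_ideal (repr (\pi_Uq x) - x).
Proof. by apply/Uq_eqP; rewrite reprK. Qed.

Lemma Uq_piM (x y : FA) : \pi_Uq (x * y) = Uq_mul (\pi_Uq x) (\pi_Uq y).
Proof.
rewrite /Uq_mul -lock; apply/esym/eqP/Uq_eqP.
set x' := repr _; set y' := repr _.
have -> : x' * y' - x * y = (x' - x) * y' + x * (y' - y).
  by rewrite mulrBl mulrBr addrA subrK.
by apply: ideal_add; [apply: drinfeld_ideal_mulr|apply: drinfeld_ideal_mull];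
  exact: Uq_repr_pi.
Qed.

Lemma Uq_piZ a (x : FA) : \pi_Uq (a *: x) = Uq_scale a (\pi_Uq x).
Proof.
rewrite /Uq_scale -lock; apply/esym/eqP/Uq_eqP.
rewrite -scalerBr -mulr_algl.
exact/drinfeld_ideal_mull/Uq_repr_pi.
Qed.

Lemma Uq_mulA : associative Uq_mul.
Proof.
by move=> x y z; rewrite -[x]reprK -[y]reprK -[z]reprK -!Uq_piM mulrA.
Qed.

Lemma Uq_mul1x : left_id Uq_one Uq_mul.
Proof. by move=> x; rewrite -[x]reprK -Uq_piM mul1r. Qed.

Lemma Uq_mulx1 : right_id Uq_one Uq_mul.
Proof. by move=> x; rewrite -[x]reprK -Uq_piM mulr1. Qed.

Lemma Uq_mulDl : left_distributive Uq_mul +%R.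
Proof.
move=> x y z; rewrite -[x]reprK -[y]reprK -[z]reprK.
by rewrite -Uq_piD -!Uq_piM mulrDl Uq_piD.
Qed.

Lemma Uq_mulDr : right_distributive Uq_mul +%R.
Proof.
move=> x y z; rewrite -[x]reprK -[y]reprK -[z]reprK.
by rewrite -Uq_piD -!Uq_piM mulrDr Uq_piD.
Qed.

Lemma Uq_one_neq0 : Uq_one != 0.
Proof.
have -> : 0 = \pi_Uq (0 : FA) :> Uq by rewrite piE.
by apply/Uq_eqP; rewrite subr0; exact: drinfeld_ideal_proper.
Qed.

HB.instance Definition _ := GRing.Zmodule_isNzRing.Build Uq
  Uq_mulA Uq_mul1x Uq_mulx1 Uq_mulDl Uq_mulDr Uq_one_neq0.

Lemma Uq_scaleA a b (x : Uq) :
  Uq_scale a (Uq_scale b x) = Uq_scale (a * b) x.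
Proof. by rewrite -[x]reprK -!Uq_piZ scalerA. Qed.

Lemma Uq_scale1 : left_id 1 Uq_scale.
Proof. by move=> x; rewrite -[x]reprK -!Uq_piZ scale1r. Qed.

Lemma Uq_scaleDr : right_distributive Uq_scale +%R.
Proof.
move=> a x y; rewrite -[x]reprK -[y]reprK.
by rewrite -Uq_piD -!Uq_piZ scalerDr Uq_piD.
Qed.

Lemma Uq_scaleDl (x : Uq) : {morph Uq_scale^~ x : a b / a + b}.
Proof. by move=> a b; rewrite -[x]reprK -!Uq_piZ scalerDl Uq_piD. Qed.

HB.instance Definition _ := GRing.Zmodule_isLmodule.Build R[i] Uq
  Uq_scaleA Uq_scale1 Uq_scaleDr Uq_scaleDl.

Lemma Uq_scalerAl (a : R[i]) (x y : Uq) : a *: (x * y) = a *: x * y.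
Proof.
rewrite -[x]reprK -[y]reprK /GRing.mul /GRing.scale /=.
by rewrite -!(Uq_piM, Uq_piZ) scalerAl.
Qed.

HB.instance Definition _ := GRing.Lmodule_isLalgebra.Build R[i] Uq Uq_scalerAl.

Lemma Uq_scalerAr (a : R[i]) (x y : Uq) : a *: (x * y) = x * (a *: y).
Proof.
rewrite -[x]reprK -[y]reprK /GRing.mul /GRing.scale /=.
by rewrite -!(Uq_piM, Uq_piZ) scalerAr.
Qed.

HB.instance Definition _ := GRing.Lalgebra_isAlgebra.Build R[i] Uq Uq_scalerAr.

Definition ux (s : bool) (i : 'I_N) (n : int) : Uq := \pi_Uq (fx s i n).
Definition uk (i : 'I_N) : Uq := \pi_Uq (fk true i).
Definition uphi (s : bool) (i : 'I_N) (n : nat) : Uq := \pi_Uq (fphi s i n).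
Definition uc_half : Uq := \pi_Uq (fc 1).

Local Close Scope quotient_scope.

(* Weights are the N-tuples of nonzero complex numbers. *)
Definition weights : set {ffun 'I_N -> R[i]} :=
  [set rho | forall i, rho i != 0].

(* \overline{lambda} for lambda = \sum_i lambda_i omega_i integral. *)
Definition bar (lambda : 'I_N -> int) : {ffun 'I_N -> R[i]} :=
  [ffun i => qi i ^ lambda i].

(* The image of Q^+; recall alpha_j = \sum_i C i j omega_i. *)
Definition Qplus_bar : set {ffun 'I_N -> R[i]} :=
  [set bar (fun i => \sum_j (a j)%:Z * C i j) | a in [set: 'I_N -> nat]].

Section Modules.
Implicit Types V W : lmodType Uq.

Definition weight_space V (rho : {ffun 'I_N -> R[i]}) : set V :=
  [set v | forall i, uk i *: v = (rho i)%:A *: v].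
Arguments weight_space V rho : clear implicits.

Definition is_weight V (rho : {ffun 'I_N -> R[i]}) : Prop :=
  weights rho /\ exists2 v, weight_space V rho v & v != 0.

Definition weight_decomposition V : Prop :=
  forall v : V, exists! w : {ffun 'I_N -> R[i]} -> V,
    [/\ forall rho, weights rho -> weight_space V rho (w rho),
        forall rho, ~ weights rho -> w rho = 0,
        finite_set [set rho | w rho != 0] &
        v = \sum_(rho \in weights) w rho].

Definition finite_dim V (S : set V) : Prop :=
  exists b : seq V, forall v, S v ->
    exists a : 'I_(size b) -> R[i], v = \sum_(k < size b) (a k)%:A *: b`_k.

(* The restriction to U_q(g) is in category O; this involves only the action
   of the k_i. *)
Definition restriction_in_O V : Prop :=
  [/\ weight_decomposition V,
      forall rho, weights rho -> finite_dim (weight_space V rho) &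
      exists s : seq {ffun 'I_N -> R[i]},
        (forall rho, rho \in s -> weights rho) /\
        forall rho, is_weight V rho ->
          exists rho0 x, [/\ rho0 \in s, Qplus_bar x &
            forall i, rho i = rho0 i * (x i)^-1]].

Definition c_acts_trivially V : Prop := forall v : V, uc_half *: v = v.

Definition in_Ohat V : Prop := restriction_in_O V /\ c_acts_trivially V.

Definition is_submodule V (S : set V) : Prop :=
  S 0 /\ forall (a : Uq) v w, S v -> S w -> S (a *: v + w).

Definition simple_module V : Prop :=
  (exists v : V, v != 0) /\
  forall S : set V, is_submodule S -> S = [set 0] \/ S = setT.

Definition module_iso V W : Prop :=
  exists F : {linear V -> W}, bijective F.

Definition iso_class V : lmodType Uq -> Prop := fun W => module_iso V W.

Definition simple_iso_classes (K : lmodType Uq -> Prop) : Prop :=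
  exists V, [/\ simple_module V, in_Ohat V & K = iso_class V].

End Modules.

End QuantumAffine.

(* f true i n = f^+_{i,n} and f false i n = f^-_{i,-n}, n >= 0. *)
Definition lfamily (R : realType) (N : nat) := bool -> 'I_N -> nat -> R[i].

Section LWeights.
Variables (R : realType) (N : nat).

Definition is_lweight (f : lfamily R N) : Prop :=
  forall i, f true i 0%N * f false i 0%N = 1.

(* F is regular at 0 and F(u) = \sum_(n >= 0) a_n u^n at 0. *)
Definition expansion_at0 (F : {fraction {poly R[i]}}) (a : nat -> R[i]) :
    Prop :=
  exists P Q : {poly R[i]},
    [/\ Q.[0] != 0, F = tofrac P / tofrac Q &
        forall n : nat, \sum_(k < n.+1) Q`_k * a (n - k)%N = P`_n].

Definition coefz (P : {poly R[i]}) (m : int) : R[i] :=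
  if m is Posz n then P`_n else 0.

(* F is regular at infinity and F(u) = \sum_(n >= 0) a_n u^{-n} at infinity:
   the coefficients of u^m in P(u) and Q(u) \sum_n a_n u^{-n} agree. *)
Definition expansion_at_infty (F : {fraction {poly R[i]}}) (a : nat -> R[i]) :
    Prop :=
  exists P Q : {poly R[i]},
    [/\ Q != 0, (size P <= size Q)%N, F = tofrac P / tofrac Q &
        forall m : int,
          \sum_(k < size Q | m <= k%:Z) Q`_k * a `|k%:Z - m|%N = coefz P m].

(* In the last condition the constant terms of the expansions are the values
   of F at 0 and at infinity. *)
Definition rational_lweights : set (lfamily R N) :=
  [set f | is_lweight f /\
     forall i, exists F : {fraction {poly R[i]}},
       [/\ expansion_at0 F (f true i), expansion_at_infty F (f false i) &
           f true i 0%N * f false i 0%N = 1]].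

End LWeights.

Section HighestLWeight.
Variables (R : realType) (N : nat) (C : 'M[int]_N) (r : 'I_N -> nat).
Variable q : R[i].
Local Notation Uq := (Uq C r q).

Definition highest_lweight_vector (f : lfamily R N) (V : lmodType Uq) (v : V) :
    Prop :=
  [/\ v != 0,
      forall w : V, exists a : Uq, w = a *: v,
      forall i n, ux C r q true i n *: v = 0 &
      forall s i n, uphi C r q s i n *: v = (f s i n)%:A *: v].

(* The isomorphism class of L(f). *)
Definition L (f : lfamily R N) (V : lmodType Uq) : Prop :=
  [/\ simple_module V, c_acts_trivially V &
      exists v : V, highest_lweight_vector f v].

End HighestLWeight.

Arguments L {R N} C r q f V.
Arguments simple_iso_classes {R N} C r q K.

(* This is set_bij for plain predicates; classes of modules do not fit in the
   universe of classical_sets.set. *)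
Definition bijection_between (X Y : Type) (A : X -> Prop) (B : Y -> Prop)
    (F : X -> Y) : Prop :=
  [/\ forall x, A x -> B (F x),
      forall x y, A x -> A y -> F x = F y -> x = y &
      forall y, B y -> exists2 x, A x & F x = y].

(* Main.v *)
(* L(f) is realized inside the full dual of a Verma-like module: functions xi on
   words in the letters (i, n), where x^+_{i, n} acts by xi |-> xi((i, n) :: -)
   and the other generators are forced by their commutation relations with the
   x^+_{i, n}.  All relations hold there except the quadratic and the Serre ones.
   Those among the x^+ hold on the functionals psi p attached to generic
   configurations p of coloured points (where the x^+ remove a point with a
   rational weight), hence on their closure, which is stable under all generators
   and contains the vacuum; those among the x^- follow by transposition.  A vector
   of the dual killed by all x^+_{i, n} is a multiple of the vacuum, so the
   submodule generated by the vacuum is simple.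

   Uniqueness of L(f) is seen in a product of two modules, the weights being
   separated by products of operators k_i - mu.  A series f_i is rational exactly
   when the differences f^+_{i, m} - f^-_{i, m}, m in Z, satisfy a linear
   recurrence, which is a linear relation among the vectors x^-_{i, m} v; the
   quadratic relations propagate the resulting finiteness to all weight spaces.
   Conversely, a maximal weight space of a simple object is finite-dimensional and
   contains a common eigenvector of the commuting h_{i, n}. *)
Require Import Defs.
From HB Require Import structures.
From mathcomp Require Import all_boot all_order all_algebra.
From mathcomp Require Import fingroup perm ring_quotient generic_quotient.
From mathcomp Require Import finmap monalg complex.
From mathcomp Require Import zify ring lra.
From mathcomp Require Import boolp classical_sets functions cardinality.
From mathcomp Require Import fsbigop reals.

Set Implicit Arguments.
Unset Strict Implicit.
Unset Printing Implicit Defensive.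
Import Order.TTheory GRing.Theory Num.Theory.
Local Open Scope quotient_scope.
Local Open Scope ring_scope.

(** Building L(f) as a quotient of an induced module requires knowing that the induced module is
    nonzero, that is, a triangular decomposition. In the dual the vacuum is nonzero by construction;
    the price is that each relation must be checked. Since the coordinates are free words, relations
    among the x^+ can only come from the points: [psi p] imitates a matrix coefficient of a product
    of currents, in which removing a point costs factors [zeta]. The quadratic relation becomes a
    two-point identity, the Serre relation an instance of the q-binomial theorem in a quantum plane.
    The delicate step is that the x^- preserve the closure. Let w be a word. The sequence in n of
    the values of x^-_{i,n} [psi p] at w, multiplied by a polynomial depending only on i and p,
    arises from the numerator of [psi ((i, z) :: p)] at w, a polynomial in z, by a linear map common
    to all words considered. So a combination of words killing every psi also kills x^-_{i,n}
    [psi p]. The multiplication is undone for phi^+ and phi^- separately: each gives sequences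
    vanishing on one side, where it is injective. *)

(** * Coefficients of powers and of formal exponentials *)

Section PowerCoefficients.
Variable A : nzRingType.
Implicit Types (p : {poly A}) (l n : nat).

Lemma coef_exp_eq p1 p2 l n : (forall j, (j <= n)%N -> p1`_j = p2`_j) ->
  (p1 ^+ l)`_n = (p2 ^+ l)`_n.
Proof.
elim: l n => [|l IHl] n eq12; first by rewrite !expr0.
rewrite !exprS !coefM; apply: eq_bigr => j _.
rewrite eq12 ?leq_ord // IHl // => k kn.
by apply: eq12; rewrite (leq_trans kn) ?leq_subr.
Qed.

Lemma coef_exp_lt p l n : p`_0 = 0 -> (n < l)%N -> (p ^+ l)`_n = 0.
Proof.
move=> p0; elim: l n => // l IHl n nl.
rewrite exprS coefM big_ord_recl p0 mul0r add0r big1 // => j _.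
by rewrite IHl ?mulr0 //= /bump leq0n; case: n nl j => [|n] nl [j jn] //=; lia.
Qed.

(** As the constant term is 0, the coefficient of degree n+1 of the base reaches degree n+1 of a
    power only when the exponent is 1. *)
Lemma coef_exp_top p1 p2 l n : p1`_0 = 0 -> p2`_n.+1 = 0 ->
  (forall j, (j <= n)%N -> p1`_j = p2`_j) ->
  (p1 ^+ l)`_n.+1 = (p2 ^+ l)`_n.+1 + p1`_n.+1 *+ (l == 1)%N.
Proof.
move=> p10 p2n eq12; case: l => [|l]; first by rewrite !expr0 mulr0n addr0.
rewrite !exprS !coefM big_ord_recr [X in _ = X + _]big_ord_recr /= subnn p2n.
rewrite mul0r addr0; congr (_ + _); last first.
  case: l => [|l]; first by rewrite expr0 coef1 mulr1 mulr1n.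
  by rewrite coef_exp_lt // mulr0.
apply: eq_bigr => -[[|j] jn] _ /=; first by rewrite -eq12 // p10 !mul0r.
rewrite eq12 //; congr (_ * _); apply: coef_exp_eq => k kn; apply: eq12; lia.
Qed.

End PowerCoefficients.

Section FormalExponential.
Variable K : numFieldType.
Implicit Types (e : nat -> K) (n m l : nat) (p : {poly K}).

Definition log_series e n : {poly K} := \sum_(1 <= m < n.+1) (e m)%:P * 'X^m.

(** The scalar counterpart of [fphi], truncated in the same way: powers beyond the n-th contribute
    nothing in degree n, and [e 0] is never read. *)
Definition exp_coef e n : K :=
  \sum_(l < n.+1) l`!%:R^-1 * (log_series e n ^+ l)`_n.

Lemma coef_log_series e n j :
  (log_series e n)`_j = if (0 < j <= n)%N then e j else 0.
Proof.
rewrite /log_series coef_sum.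
under eq_bigr do rewrite mul_polyC coefZ coefXn.
case: ifP => [|/negbT] jn.
  rewrite (bigD1_seq j) ?mem_index_iota ?iota_uniq //= eqxx mulr1.
  by rewrite big1 ?addr0 // => m /negPf mj; rewrite eq_sym mj mulr0.
rewrite big_nat big1 // => m m_n; case: eqP => [jm|_]; last by rewrite mulr0.
by rewrite jm -ltnS m_n in jn.
Qed.

Lemma exp_coefE e N M n : (n <= N)%N -> (n < M)%N ->
  exp_coef e n = \sum_(l < M) l`!%:R^-1 * (log_series e N ^+ l)`_n.
Proof.
move=> nN nM; rewrite -(subnKC nM) big_split_ord /= [X in _ + X]big1 ?addr0.
  apply: eq_bigr => l _; congr (_ * _); apply: coef_exp_eq => j jn.
  by rewrite !coef_log_series jn (leq_trans jn nN).
move=> l _; rewrite coef_exp_lt ?mulr0 ?ltn_addr //.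
by rewrite coef_log_series.
Qed.

Lemma exp_coef0 e : exp_coef e 0 = 1.
Proof. by rewrite /exp_coef big_ord1 expr0 coef1 invr1 mulr1. Qed.

(** Comparison of coefficients in E' = L' E for E = exp L. *)
Lemma exp_coefS e n : exp_coef e n.+1 *+ n.+1 =
  \sum_(m < n.+1) (e m.+1 *+ m.+1) * exp_coef e (n - m).
Proof.
rewrite (@exp_coefE e n.+1 n.+2) // big_ord_recl expr0 coef1 mulr0 add0r.
rewrite -sumrMnl.
rewrite (eq_bigr (fun l : 'I_n.+1 => l`!%:R^-1 *
    ((log_series e n.+1)^`() * log_series e n.+1 ^+ l)`_n)); last first.
  move=> l _; rewrite /= /bump leq0n add1n -mulrnAr -coef_deriv deriv_exp coefMn.
  rewrite factS natrM /=; set x := nth _ _ _.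
  rewrite -[x *+ _]mulr_natr; field.
  by rewrite addrC natr1 !pnatr_eq0 -lt0n fact_gt0.
rewrite [RHS](eq_bigr (fun m : 'I_n.+1 => \sum_(l < n.+1)
    (e m.+1 *+ m.+1) * (l`!%:R^-1 * (log_series e n.+1 ^+ l)`_(n - m)))); last first.
  by move=> m _; rewrite (@exp_coefE e n.+1 n.+1) -?mulr_sumr //; lia.
rewrite [RHS]exchange_big /=; apply: eq_bigr => l _.
rewrite coefM mulr_sumr; apply: eq_bigr => m _.
by rewrite coef_deriv coef_log_series ltn_ord mulrCA.
Qed.

(* Multiplying the series by 1 - a X subtracts \sum_m (a X)^m / m from its
   logarithm. *)
Lemma exp_coef_log1 e a n :
  exp_coef (fun m => e m - a ^+ m / m%:R) n.+1 =
  exp_coef e n.+1 - a * exp_coef e n.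
Proof.
set e' := fun m => _.
(* [y] is the coefficient sequence of (1 - a X) exp(e); it is shown to satisfy the recursion
   [exp_coefS], which determines the left side. *)
pose y n := exp_coef e n - (if n is n'.+1 then a * exp_coef e n' else 0).
suff: exp_coef e' n.+1 = y n.+1 by [].
elim/ltn_ind: n => n IHn.
have {IHn} IHn m : (m <= n)%N -> exp_coef e' m = y m.
  by case: m => [_|m /IHn //]; rewrite /y !exp_coef0 subr0.
apply: (@mulfI _ n.+1%:R); first by rewrite pnatr_eq0.
rewrite !mulr_natl exp_coefS.
rewrite (eq_bigr (fun m : 'I_n.+1 => (e m.+1 *+ m.+1) * y (n - m)%N
                     - a ^+ m.+1 * y (n - m)%N)); last first.
  move=> m _; rewrite IHn ?leq_subr // -mulrBl; congr (_ * _).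
  by rewrite /e' mulrnBl -[a ^+ _ / _ *+ _]mulr_natr divfK // pnatr_eq0.
rewrite sumrB.
have -> : \sum_(m < n.+1) a ^+ m.+1 * y (n - m)%N = a * exp_coef e n.
  elim: n {IHn} => [|n IHn]; first by rewrite big_ord1 /y expr1 subr0.
  rewrite big_ord_recl /= subn0.
  under eq_bigr => m _ do rewrite /bump leq0n exprS -mulrA subSS.
  rewrite -mulr_sumr IHn /y; ring.
have -> : \sum_(m < n.+1) (e m.+1 *+ m.+1) * y (n - m)%N =
    exp_coef e n.+1 *+ n.+1 - a * (exp_coef e n *+ n).
  under eq_bigr do rewrite mulrBr.
  rewrite sumrB -exp_coefS; congr (_ - _).
  case: n {IHn} => [|n]; first by rewrite big_ord1 /= mulr0n !mulr0.
  rewrite big_ord_recr /= subnn mulr0 addr0 exp_coefS mulr_sumr.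
  by apply: eq_bigr => m _; rewrite subSn ?leq_ord //; ring.
by rewrite /y mulrnBl; ring.
Qed.

Lemma exp_coef_eq e1 e2 n : (forall m, (0 < m <= n)%N -> e1 m = e2 m) ->
  exp_coef e1 n = exp_coef e2 n.
Proof.
move=> e12; rewrite /exp_coef (_ : log_series e1 n = log_series e2 n) //.
by rewrite /log_series big_nat [RHS]big_nat; apply: eq_bigr => m mn; rewrite e12.
Qed.

(** The recursion [exp_coefS] is triangular in e, so it can be solved for e(n+1) once e(1), ...,
    e(n) are known. *)
Lemma exp_coef_surj (F : nat -> K) : F 0%N = 1 ->
  exists e, forall n, exp_coef e n = F n.
Proof.
move=> F0.
(* The entry of index m of the list s is e(m+1), and [step s] is the value that comes next; e(0) is
   immaterial. *)
pose step (s : seq K) := (F (size s).+1 *+ (size s).+1 -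
  \sum_(m < size s) (s`_m *+ m.+1) * F (size s - m)%N) / (size s).+1%:R.
pose es n := iter n (fun s => rcons s (step s)) [::].
have size_es n : size (es n) = n by elim: n => //= n IHn; rewrite size_rcons IHn.
have esE n m : (m < n)%N -> (es n)`_m = step (es m).
  elim: n => // n IHn; rewrite ltnS leq_eqVlt nth_rcons size_es => /orP[/eqP->|mn].
    by rewrite ltnn eqxx.
  by rewrite mn IHn.
exists (fun m => step (es m.-1)) => n; elim/ltn_ind: n => -[_|n IHn].
  by rewrite exp_coef0 F0.
apply: (@mulfI _ n.+1%:R); first by rewrite pnatr_eq0.
rewrite !mulr_natl exp_coefS big_ord_recr /= subnn exp_coef0 mulr1.
rewrite [in X in _ + X]/step size_es -[_ / _ *+ _]mulr_natr divfK ?pnatr_eq0 //.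
apply/eqP; rewrite eq_sym -subr_eq; apply/eqP; rewrite opprB addrC subrK.
apply: eq_bigr => m _; rewrite esE // IHn //; lia.
Qed.

End FormalExponential.

(** * The q-binomial theorem *)

Section QBinomial.
Variables (K : fieldType) (v : K).
Hypothesis v0 : v != 0.
Hypothesis vn : forall n, qint v n.+1 != 0.

Lemma qfactS n : qfact v n.+1 = qfact v n * qint v n.+1.
Proof. by rewrite /qfact big_nat_recr. Qed.

Lemma qfact_neq0 n : qfact v n != 0.
Proof.
elim: n => [|n IHn]; first by rewrite /qfact big_nil oner_eq0.
by rewrite qfactS mulf_neq0.
Qed.

Lemma qbinom0 n : qbinom v n 0 = 1.
Proof. by rewrite /qbinom /qfact big_nil mul1r subn0 divff // qfact_neq0. Qed.

Lemma qbinomn n : qbinom v n n = 1.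
Proof. by rewrite /qbinom subnn {3}/qfact big_nil mulr1 divff // qfact_neq0. Qed.

Lemma qbinom_sub n l : (l <= n)%N -> qbinom v n (n - l) = qbinom v n l.
Proof. by move=> ln; rewrite /qbinom subKn // mulrC [in LHS](mulrC (qfact _ _)) mulrC. Qed.

Lemma qbinomS n l : (l < n)%N ->
  qbinom v n.+1 l.+1 = v ^+ l.+1 * qbinom v n l.+1 + v^-1 ^+ (n - l) * qbinom v n l.
Proof.
move=> ln; rewrite /qbinom subSS.
have e1 : qint v n.+1 = v ^+ l.+1 * qint v (n - l)%N + v^-1 ^+ (n - l) * qint v l.+1.
  rewrite /qint mulrA [RHS]addrC mulrA -mulrDl; congr (_ / _).
  have -> : n.+1 = (l.+1 + (n - l))%N by lia.
  set m := (n - l)%N; rewrite -!invr_expz -!exprnP exprD !exprVn; field.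
  by rewrite !expf_neq0.
have e2 : qfact v (n - l) = qfact v (n - l.+1) * qint v (n - l)%N.
  by rewrite (_ : (n - l)%N = (n - l.+1).+1) ?qfactS //; lia.
rewrite (qfactS n) e1 (qfactS l) e2.
have h1 := qfact_neq0 l; have h2 := qfact_neq0 (n - l.+1); have h3 := vn l.
have h4 : qint v (n - l)%N != 0 by rewrite (_ : (n - l)%N = (n - l).-1.+1) //; lia.
by field; rewrite h1 h2 h3 h4.
Qed.

(** The q-binomial theorem for symmetric q-numbers, so the exponents are centred: factor j carries
    v^(2j-d+1). The induction splits off the factor j = 0 and rescales y by v. *)
Lemma qbinom_sum d y : \sum_(l < d.+1) (-1) ^+ l * qbinom v d l * y ^+ l =
  \prod_(j < d) (1 - v ^+ (2 * j) * v^-1 ^+ d.-1 * y).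
Proof.
elim: d y => [|d IHd] y; first by rewrite big_ord1 big_ord0 qbinom0 !mulr1.
rewrite [RHS]big_ord_recl /=.
have -> : \prod_(j < d) (1 - v ^+ (2 * bump 0 j) * v^-1 ^+ d * y) =
   \prod_(j < d) (1 - v ^+ (2 * j) * v^-1 ^+ d.-1 * (v * y)).
  apply: eq_bigr => -[j jd] _ /=; rewrite /bump leq0n.
  case: d jd {IHd} => // d _; rewrite mulnDr exprD exprS; field.
  by rewrite v0.
rewrite -IHd muln0 expr0 mul1r mulrBl mul1r.
rewrite big_ord_recl big_ord_recr /=.
rewrite [in X in _ = X - _]big_ord_recl [in X in _ = _ - X]big_ord_recr /=.
rewrite /bump leq0n !qbinom0 !qbinomn !expr0 !mulr1.
rewrite (eq_bigr (fun l : 'I_d =>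
    (-1) ^+ l.+1 * qbinom v d l.+1 * (v * y) ^+ l.+1
    - v^-1 ^+ d * y * ((-1) ^+ l * qbinom v d l * (v * y) ^+ l))); last first.
  case=> l ld _ /=; rewrite !add1n qbinomS //.
  have -> : v^-1 ^+ d = v^-1 ^+ (d - l) * v^-1 ^+ l by rewrite -exprD subnK 1?ltnW.
  rewrite !exprMn !exprS !exprVn; field.
  by rewrite !expf_neq0.
rewrite sumrB -mulr_sumr.
under [in RHS]eq_bigr => l _ do rewrite leq0n add1n.
set S1 := \sum_(i < d) _; set S2 := \sum_(i < d) _.
rewrite add1n exprMn !exprS !exprVn; field.
by rewrite expf_neq0.
Qed.

(** At y = v^(2k-d+1) the factor j = d-1-k of the product in [qbinom_sum] is zero. *)
Lemma qbinom_alt_sum d k : (k < d)%N ->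
  \sum_(l < d.+1) (-1) ^+ l * qbinom v d l * (v^-1 ^+ d.-1 * v ^+ (2 * k)) ^+ l = 0.
Proof.
move=> kd; rewrite qbinom_sum; apply/eqP/prodf_eq0.
have jd : (d.-1 - k < d)%N by lia.
exists (Ordinal jd) => //=; rewrite subr_eq0; apply/eqP.
rewrite mulrCA mulrAC mulrA -!exprD exprVn.
have -> : (2 * (d.-1 - k) + 2 * k = d.-1 + d.-1)%N by lia.
by rewrite exprD; field; rewrite expf_neq0.
Qed.

End QBinomial.

(** * A Serre identity in the quantum plane *)

Lemma coef_comp_scaleX (K : comNzRingType) (p : {poly K}) t k :
  (p \Po (t%:P * 'X))`_k = p`_k * t ^+ k.
Proof.
rewrite comp_polyE coef_sum.
under eq_bigr do rewrite exprMn -polyC_exp mul_polyC !coefZ coefXn.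
case: (ltnP k (size p)) => kp; last first.
  rewrite nth_default // mul0r big1 // => i _.
  by case: eqP => [e|]; rewrite ?mulr0 //; move: (ltn_ord i); rewrite -e ltnNge kp.
rewrite (bigD1 (Ordinal kp)) //= eqxx mulr1 big1 ?addr0 // => i ik.
by case: eqP => [e|]; rewrite ?mulr0 //; move: ik; rewrite -val_eqE /= e eqxx.
Qed.

Lemma size_prod_linear (K : fieldType) n (c : nat -> K) :
  (size (\prod_(m < n) (1 - (c m)%:P * 'X)%R : {poly K})%R <= n.+1)%N.
Proof.
elim: n => [|n IHn]; first by rewrite big_ord0 size_poly1.
rewrite big_ord_recr /=; apply: leq_trans (size_polyMleq _ _) _.
have : (size (1 - (c n)%:P * 'X : {poly K})%R <= 2)%N.
  rewrite (leq_trans (size_polyD _ _)) // size_polyN geq_max size_poly1 /=.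
  by rewrite mul_polyC (leq_trans (size_scale_leq _ _)) // size_polyX.
move: (size _) (size _) IHn => s1 s2; lia.
Qed.

Section QuantumPlane.
Variables (K : fieldType) (W : lmodType K) (a b : {linear W -> W}) (Q : K).
Hypothesis Q0 : Q != 0.
Hypothesis abE : forall x, a (b x) = Q *: b (a x).

(* The normally ordered element attached to p; the powers of Q are chosen so
   that left multiplication by b - t a corresponds to multiplication by
   1 - t Q^k X. *)
Definition qplane (k : nat) (p : {poly K}) (x : W) : W :=
  \sum_(j < k.+1) (p`_j * Q^-1 ^+ 'C(j, 2)) *: iter (k - j) b (iter j a x).

Lemma qplane_mul k (p : {poly K}) t x : (size p <= k.+1)%N ->
  b (qplane k p x) - t *: a (qplane k p x) =
  qplane k.+1 ((1 - (t * Q ^+ k)%:P * 'X) * p) x.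
Proof.
move=> sp; rewrite mulrBl mul1r /qplane.
under [RHS]eq_bigr do rewrite coefB mulrBl scalerBl.
rewrite sumrB; congr (_ - _).
  rewrite [RHS]big_ord_recr /= (nth_default _ sp) mul0r scale0r addr0 linear_sum.
  apply: eq_bigr => j _; rewrite linearZ /=; congr (_ *: _).
  by rewrite subSn ?leq_ord.
rewrite [RHS]big_ord_recl /= -mulrA coefCM coefXM /= mulr0 mul0r scale0r add0r.
rewrite linear_sum scaler_sumr; apply: eq_bigr => j _.
rewrite linearZ /= /bump leq0n add1n subSS.
have iterab m y : a (iter m b y) = Q ^+ m *: iter m b (a y).
  elim: m => [|m IHm] /=; first by rewrite scale1r.
  by rewrite abE IHm linearZ /= scalerA -exprS.
rewrite iterab !scalerA; congr (_ *: _).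
rewrite -mulrA coefCM coefXM /= binS bin1 exprD.
have -> : Q ^+ k = Q ^+ (k - j) * Q ^+ j by rewrite -exprD subnK ?leq_ord.
rewrite !exprVn; field.
by rewrite !expf_neq0.
Qed.

Lemma iter_qplane e k (p : {poly K}) t x : (size p <= k.+1)%N ->
  iter e (fun y => b y - t *: a y) (qplane k p x) =
  qplane (e + k) (\prod_(m < e) (1 - (t * Q ^+ (k + m))%:P * 'X) * p) x.
Proof.
move=> sp; elim: e => [|e IHe] /=; first by rewrite big_ord0 mul1r.
rewrite IHe qplane_mul; first last.
  apply: leq_trans (size_polyMleq _ _) _.
  have := size_prod_linear e (fun m => t * Q ^+ (k + m)).
  move: (size _) (size _) sp => s1 s2; lia.
rewrite big_ord_recr /=; congr (qplane _ _ _); rewrite [in LHS]addnC.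
by rewrite mulrA [X in _ = X * _]mulrC.
Qed.

Lemma qplane_sum k (I : finType) (c : I -> K) (p : I -> {poly K}) x :
  \sum_i c i *: qplane k (p i) x = qplane k (\sum_i c i *: p i) x.
Proof.
rewrite /qplane; under eq_bigr do rewrite scaler_sumr.
rewrite exchange_big /=; apply: eq_bigr => j _.
rewrite coef_sum mulr_suml scaler_suml; apply: eq_bigr => i _.
by rewrite coefZ scalerA mulrA.
Qed.

End QuantumPlane.

Section QPlaneSerre.
Variables (K : fieldType) (W : lmodType K) (a b : {linear W -> W}) (v w : K).
Variable d : nat.
Hypothesis v0 : v != 0.
Hypothesis vn : forall n, qint v n.+1 != 0.
Hypothesis d0 : (0 < d)%N.
Hypothesis abE : forall x, a (b x) = v ^+ 2 *: b (a x).
Local Notation P := (v^-1 ^+ d.-1).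

(** In normally ordered form the l-th term is the signed binomial times P^l F_{d-1}(X) h(v^(2l) X),
    where h is a fixed polynomial of degree less than d. So F_{d-1} factors out, and each
    coefficient of what remains is a vanishing alternating q-binomial sum. *)
Lemma qplane_serre x :
  \sum_(l < d.+1) ((-1) ^+ l * qbinom v d l) *:
     iter (d - l) (fun y => b y - (P * w) *: a y)
       (iter l (fun y => P *: b y - w *: a y) x) = 0.
Proof.
have P0 : P != 0 by rewrite expf_neq0 ?invr_neq0.
have Q0 : v ^+ 2 != 0 by rewrite expf_neq0.
pose F m : {poly K} := 1 - (P * w * (v ^+ 2) ^+ m)%:P * 'X.
pose h : {poly K} := \prod_(m < d.-1) F m.
(* Here P b - w a = P (b - (w/P) a), and w/P = P w (v^2)^(d-1); hence the index d-1+m. *)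
have iterP l : iter l (fun y => P *: b y - w *: a y) x =
    P ^+ l *: qplane a b (v ^+ 2) l (\prod_(m < l) F (d.-1 + m)%N) x.
  have -> : iter l (fun y => P *: b y - w *: a y) x =
      P ^+ l *: iter l (fun y => b y - (w / P) *: a y) x.
    elim: l => [|l IHl] /=; first by rewrite scale1r.
    rewrite IHl [b _]linearZ [a _]linearZ /= scalerBr !scalerA -exprS.
    by congr (_ - _ *: _); rewrite exprSr -mulrA [w / _]mulrC mulVKf // mulrC.
  have {1}-> : x = qplane a b (v ^+ 2) 0 1 x.
    by rewrite /qplane big_ord1 /= coef1 bin0n mulr1 scale1r.
  rewrite iter_qplane ?size_poly1 // mulr1 addn0; congr (_ *: qplane _ _ _ _ _ _).
  apply: eq_bigr => m _; rewrite /F add0n; congr (1 - _%:P * _).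
  rewrite exprD [_ ^+ 2 ^+ d.-1]exprAC !exprVn invrK.
  have : v ^+ d.-1 != 0 by rewrite expf_neq0.
  by move: (v ^+ d.-1) (_ ^+ m) => c y c0; field.
rewrite (eq_bigr (fun l : 'I_d.+1 =>
    ((-1) ^+ l * qbinom v d l * P ^+ l) *: qplane a b (v ^+ 2) d
       (F d.-1 * (h \Po (((v ^+ 2) ^+ l)%:P * 'X))) x)); last first.
  move=> l _; rewrite iterP.
  have linY t y : b (P ^+ l *: y) - t *: a (P ^+ l *: y) = P ^+ l *: (b y - t *: a y).
    by rewrite [b _]linearZ [a _]linearZ /= scalerBr !scalerA [t * _]mulrC.
  have -> n y : iter n (fun y => b y - (P * w) *: a y) (P ^+ l *: y) =
      P ^+ l *: iter n (fun y => b y - (P * w) *: a y) y.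
    by elim: n => //= n ->; rewrite linY.
  rewrite iter_qplane //; last first.
    exact: (size_prod_linear l (fun m => P * w * (v ^+ 2) ^+ (d.-1 + m))).
  rewrite scalerA subnK ?leq_ord //; congr (_ *: qplane _ _ _ _ _ _).
  rewrite -(big_mkord xpredT (fun m => F (l + m)%N)).
  rewrite -(big_mkord xpredT (fun m => F (d.-1 + m)%N)).
  rewrite /h rmorph_prod /=.
  rewrite (eq_bigr (fun m : 'I_d.-1 => F (l + m)%N)); last first.
    move=> m _; rewrite /F rmorphB /= rmorph1 rmorphM /= comp_polyC comp_polyX.
    by rewrite mulrA -polyCM exprD [_ ^+ l * _]mulrC mulrA.
  rewrite -(big_mkord xpredT (fun m => F (l + m)%N)).
  (* The indices of the two products run over l, ..., d-1 and over d-1, ..., l+d-2. Apart from one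
     extra factor of index d-1 they fill the window l, ..., l+d-2 of h(v^(2l) X). *)
  have shift n k : \prod_(0 <= m < n) F (k + m)%N = \prod_(k <= m < n + k) F m.
    rewrite [RHS](_ : _ = \prod_(0 + k <= m < n + k) F m) // big_addn addnK.
    by apply: eq_bigr => m _; rewrite addnC.
  have ld := leq_ord l; rewrite !shift subnK //.
  case: (posnP l) => [->|l0].
    rewrite [X in _ * X]big_geq // mulr1 addn0.
    by rewrite -{1}(prednK d0) big_nat_recr //= mulrC.
  have dl : (d.-1 < l + d.-1)%N by lia.
  rewrite [X in _ * X](big_ltn dl) mulrCA; congr (_ * _).
  by rewrite prednK // -big_cat_nat //= addnC //; lia.
rewrite qplane_sum (_ : \sum_l _ = 0) ?/qplane.
  by rewrite big1 // => j _; rewrite coef0 mul0r scale0r.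
under eq_bigr do rewrite scalerAr.
rewrite -mulr_sumr (_ : \sum_l _ = 0) ?mulr0 //; apply/polyP => k.
rewrite coef0 coef_sum.
under eq_bigr do rewrite coefZ coef_comp_scaleX.
case: (ltnP k d) => [kd|dk]; last first.
  rewrite big1 // => l _; rewrite nth_default ?mul0r ?mulr0 //.
  apply: leq_trans dk; rewrite -[d in (_ <= d)%N](prednK d0).
  exact: (size_prod_linear d.-1 (fun m => P * w * (v ^+ 2) ^+ m)).
rewrite (eq_bigr (fun l : 'I_d.+1 => h`_k *
    ((-1) ^+ l * qbinom v d l * (P * v ^+ (2 * k)) ^+ l))); last first.
  move=> l _; have -> : (P * v ^+ (2 * k)) ^+ l = P ^+ l * ((v ^+ 2) ^+ l) ^+ k.
    by rewrite exprMn -!exprM; congr (_ * _ ^+ _); lia.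
  by rewrite mulrCA !mulrA.
by rewrite -mulr_sumr qbinom_alt_sum ?mulr0.
Qed.

End QPlaneSerre.

(** * Operators removing points from configurations of coloured points *)

Section Pointwise.
Variables (K : pzRingType) (T : Type) (W : lmodType K).
Implicit Types X Y : T -> W.

Lemma funD X Y t : (X + Y) t = X t + Y t. Proof. by []. Qed.
Lemma funN X t : (- X) t = - X t. Proof. by []. Qed.
Lemma funZ (k : K) X t : (k *: X) t = k *: X t. Proof. by []. Qed.

Lemma fun_sum (J : Type) (r : seq J) (P : pred J) (F : J -> T -> W) t :
  (\sum_(k <- r | P k) F k) t = \sum_(k <- r | P k) F k t.
Proof. by rewrite fct_sumE. Qed.

End Pointwise.

Section ColouredPoints.
Variables (K : numFieldType) (I : eqType) (B : I -> I -> int) (q : K).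
Hypothesis q0 : q != 0.
Hypothesis BC : forall i j, B i j = B j i.
Local Notation point := (I * K)%type.
Implicit Types (s t : point) (p : seq point) (i j : I).

(** Chosen so that [zeta s t / zeta t s] is (s - c t)/(c s - t) with c = q^B, the exchange factor of
    two currents in the quadratic relation. *)
Definition zeta s t : K := (s.2 - q ^ B s.1 t.1 * t.2) / (s.2 - t.2).

(** Not only the poles of [zeta] but also its zeros are excluded: the proof of the Serre relation
    divides by s - q^B t. *)
Definition separated s t : bool :=
  [&& s.2 != t.2, s.2 != q ^ B s.1 t.1 * t.2 & t.2 != q ^ B s.1 t.1 * s.2].

Definition generic p : bool := all (fun s => s.2 != 0) p && pairwise separated p.

Definition drop_point s p : seq point := [seq t <- p | t != s].

Lemma separated_sym s t : separated s t = separated t s.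
Proof. by rewrite /separated BC eq_sym; congr (_ && _); rewrite andbC. Qed.

Lemma generic_filter (a : pred point) p : generic p -> generic (filter a p).
Proof.
case/andP=> h1 h2; rewrite /generic all_filter pairwise_filter // andbT.
apply: sub_all h1 => s s0; apply/implyP => _; exact: s0.
Qed.

Lemma generic_drop_point s p : generic p -> generic (drop_point s p).
Proof. exact: generic_filter. Qed.

Lemma generic_uniq p : generic p -> uniq p.
Proof.
case/andP=> _; rewrite uniq_pairwise; apply: sub_pairwise => s t.
by case/and3P=> + _ _; apply: contraNneq => ->.
Qed.

Lemma generic_neq0 p s : generic p -> s \in p -> s.2 != 0.
Proof. by case/andP=> /allP h _ /h. Qed.

Lemma generic_separated p s t : generic p -> s \in p -> t \in p -> s != t ->
  separated s t.
Proof.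
case/andP=> _; elim: p => //= u p IHp /andP[/allP up pp].
rewrite !inE => /predU1P[->|sp] /predU1P[->|tp]; rewrite ?eqxx //; last exact: IHp.
  by move=> _; apply: up.
by move=> _; rewrite separated_sym; apply: up.
Qed.

Lemma drop_pointC s t p : drop_point t (drop_point s p) = drop_point s (drop_point t p).
Proof. by rewrite /drop_point -!filter_predI; apply: eq_filter => u /=; rewrite andbC. Qed.

Lemma prod_drop_point (F : point -> K) t p : uniq p -> t \in p ->
  \prod_(u <- p) F u = F t * \prod_(u <- drop_point t p) F u.
Proof. by move=> up tp; rewrite (bigD1_seq t) //= big_filter. Qed.

Lemma mem_drop_point s t p : (t \in drop_point s p) = (t != s) && (t \in p).
Proof. by rewrite mem_filter. Qed.

Section Removal.
Variable W : lmodType K.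
Implicit Types (X Y : seq point -> W) (f g : K -> K).

(** For f = z^n this is how x^+_{i,n} acts on the functionals attached to configurations.
    Non-generic configurations get the default value 0. *)
Definition remove i f X p : W :=
  if generic p then
    \sum_(s <- p | s.1 == i)
      (f s.2 * \prod_(t <- drop_point s p) zeta s t) *: X (drop_point s p)
  else 0.

Lemma remove_linear i f : linear (remove i f : (seq point -> W) -> (seq point -> W)).
Proof.
move=> k X Y; apply/funext => p; rewrite funD funZ /remove.
case: ifP => _; last by rewrite scaler0 addr0.
rewrite scaler_sumr -big_split /=; apply: eq_bigr => s _.
by rewrite funD funZ scalerDr !scalerA mulrC.
Qed.

HB.instance Definition _ i f :=
  GRing.isLinear.Build K (seq point -> W) (seq point -> W) _ (remove i f)
    (@remove_linear i f).

Lemma remove_comb (J : Type) (r : seq J) (c : J -> K) (F : J -> K -> K) i X p :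
  remove i (fun z => \sum_(k <- r) c k * F k z) X p =
  \sum_(k <- r) c k *: remove i (F k) X p.
Proof.
rewrite /remove; case: ifP => _; last by rewrite big1 // => k _; rewrite scaler0.
under [RHS]eq_bigr do rewrite scaler_sumr.
rewrite exchange_big /=; apply: eq_bigr => s _.
rewrite mulr_suml scaler_suml; apply: eq_bigr => k _.
by rewrite scalerA mulrA.
Qed.

Definition remove2 i j (f : K -> K -> K) X p : W :=
  \sum_(s <- p | s.1 == i) \sum_(t <- p | (t != s) && (t.1 == j))
    (f s.2 t.2 * zeta s t *
      \prod_(u <- drop_point t (drop_point s p)) (zeta s u * zeta t u)) *:
        X (drop_point t (drop_point s p)).

Lemma remove_remove i j f g X p : generic p ->
  remove i f (remove j g X) p = remove2 i j (fun z w => f z * g w) X p.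
Proof.
move=> gp; rewrite /remove gp; rewrite /remove2 [LHS]big_seq_cond [RHS]big_seq_cond.
apply: eq_bigr => s /andP[sp _].
rewrite generic_drop_point // scaler_sumr big_filter_cond.
rewrite [LHS]big_seq_cond [RHS]big_seq_cond; apply: eq_bigr => t /and3P[tp ts _].
have tsp : t \in drop_point s p by rewrite mem_drop_point ts.
rewrite (prod_drop_point _ _ tsp) ?generic_uniq ?generic_drop_point // scalerA.
set R := drop_point t _; have -> : \prod_(u <- R) (zeta s u * zeta t u) =
    (\prod_(u <- R) zeta s u) * \prod_(u <- R) zeta t u by exact: big_split.
move: (\prod_(u <- R) zeta s u) (\prod_(u <- R) zeta t u) (zeta s t) => a b c.
by congr (_ *: _); ring.
Qed.

Lemma remove2_comb (c : K) i j (f g : K -> K -> K) X p :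
  remove2 i j f X p + c *: remove2 i j g X p =
  remove2 i j (fun z w => f z w + c * g z w) X p.
Proof.
rewrite /remove2 scaler_sumr -big_split /=; apply: eq_bigr => s _.
rewrite scaler_sumr -big_split /=; apply: eq_bigr => t _.
by rewrite scalerA -scalerDl !mulrDl !mulrA.
Qed.

(** Both sums remove the same pairs of points, in the two orders. The factors towards the remaining
    points are symmetric in the pair, so only the two-point factor has to cancel. *)
Lemma remove2_swap i j (f g : K -> K -> K) X p : generic p ->
  (forall s t, s.1 = i -> t.1 = j -> separated s t -> s.2 != 0 -> t.2 != 0 ->
     f s.2 t.2 * zeta s t + g t.2 s.2 * zeta t s = 0) ->
  remove2 i j f X p + remove2 j i g X p = 0.
Proof.
move=> gp fg; rewrite {2}/remove2.
rewrite (exchange_big_dep (fun s => s.1 == i)) /=; last by move=> s t _ /andP[].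
rewrite -big_split /= big_seq_cond big1 // => s /andP[sp /eqP si].
rewrite [X in _ + X](eq_bigl (fun t => (t != s) && (t.1 == j))); last first.
  by move=> t /=; rewrite si eqxx andbT andbC eq_sym.
rewrite -big_split /= big_seq_cond big1 // => t /and3P[tp ts /eqP tj].
rewrite (drop_pointC t s) -scalerDl; set R := \prod_(_ <- _) _.
rewrite (_ : \prod_(_ <- _) _ = R); last by apply: eq_bigr => u _; rewrite mulrC.
rewrite -mulrDl fg ?mul0r ?scale0r ?(generic_neq0 gp) //.
by rewrite (generic_separated gp) // eq_sym.
Qed.

(** For equal colours the difference of the two sides changes sign when the two points are swapped,
    so it is its own negative. The removals weighted by f(z) and by f(z) z thus form a quantum
    plane. *)
Lemma remove_same i f Q X : Q = q ^ B i i ->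
  remove i f (remove i (fun z => f z * z) X) =
  Q *: remove i (fun z => f z * z) (remove i f X).
Proof.
move=> QE; apply/funext => p; rewrite funZ; case: (boolP (generic p)) => gp; last first.
  by rewrite /remove (negPf gp) scaler0.
rewrite !remove_remove //; apply/eqP; rewrite -subr_eq0 -scaleNr remove2_comb.
set R := remove2 _ _ _ _ _.
have : R + R = 0.
  apply: remove2_swap => // s t si tj /and3P[st _ _] _ _.
  rewrite /zeta si tj -QE; field.
  by rewrite !subr_eq0 eq_sym st.
by rewrite -mulr2n -scaler_nat => /eqP; rewrite scaler_eq0 pnatr_eq0.
Qed.

Lemma remove_exchange i j (n m : int) X p : generic p ->
  remove j (fun z => z ^ m) (remove i (fun z => z ^ (n + 1)) X) p
    - q ^ B i j *: remove i (fun z => z ^ (n + 1)) (remove j (fun z => z ^ m) X) p =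
  q ^ B i j *: remove j (fun z => z ^ (m + 1)) (remove i (fun z => z ^ n) X) p
    - remove i (fun z => z ^ n) (remove j (fun z => z ^ (m + 1)) X) p.
Proof.
move=> gp; rewrite !remove_remove //; apply/eqP; rewrite -subr_eq0; apply/eqP.
pose c := q ^ B i j.
pose f1 z w := z ^ m * w ^ (n + 1) + - c * (z ^ (m + 1) * w ^ n).
pose f2 z w := z ^ n * w ^ (m + 1) + - c * (z ^ (n + 1) * w ^ m).
transitivity (remove2 j i f1 X p + remove2 i j f2 X p).
  rewrite -!remove2_comb !scaleNr opprB !addrA.
  by rewrite [LHS]addrAC [X in X + _ = _]addrAC [LHS]addrAC.
apply: remove2_swap => // s t sj ti /and3P[st _ _] s0 t0.
rewrite /zeta sj ti (BC j i) -/c /f1 /f2 !expfzDr // !expr1z; field.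
by rewrite !subr_eq0 eq_sym st.
Qed.

(** Removals starting from p see f only at points of p and X only at subconfigurations. So f may be
    replaced by a function with a prescribed factorization at these points, and X by a sum over the
    points of p. *)
Lemma iter_remove_local i f g X Y e p : generic p ->
  (forall p', subseq p' p -> generic p' -> X p' = Y p') ->
  (forall s, s \in p -> s.1 = i -> f s.2 = g s.2) ->
  iter e (remove i f) X p = iter e (remove i g) Y p.
Proof.
elim: e p => [|e IHe] p gp XY fg /=; first exact: XY.
rewrite /remove gp [LHS]big_seq_cond [RHS]big_seq_cond; apply: eq_bigr => s /andP[sp /eqP si].
rewrite fg // (IHe (drop_point s p)) ?generic_drop_point //.
  by move=> p' /subseq_trans p'p; apply: XY; apply: p'p; apply: filter_subseq.
by move=> t; rewrite mem_drop_point => /andP[_]; apply: fg.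
Qed.

Definition remove_at s X p : W :=
  if generic p && (s \in p) then
    (\prod_(t <- drop_point s p) zeta s t) *: X (drop_point s p)
  else 0.

Lemma remove_at_linear s :
  linear (remove_at s : (seq point -> W) -> (seq point -> W)).
Proof.
move=> k X Y; apply/funext => p; rewrite funD funZ /remove_at.
case: ifP => _; last by rewrite scaler0 addr0.
by rewrite funD funZ scalerDr !scalerA mulrC.
Qed.

HB.instance Definition _ s :=
  GRing.isLinear.Build K (seq point -> W) (seq point -> W) _ (remove_at s)
    (@remove_at_linear s).

Lemma remove_sum_at j f X p p' : generic p -> subseq p' p -> generic p' ->
  remove j f X p' = \sum_(s <- p | s.1 == j) f s.2 *: remove_at s X p'.
Proof.
move=> gp p'p gp'; rewrite /remove /remove_at gp' /=.
rewrite {1}(elimT (subseq_uniqP (generic_uniq gp)) p'p).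
rewrite big_filter_cond big_mkcondl; apply: eq_bigr => s _.
by case: ifP => _; rewrite ?scaler0 // scalerA.
Qed.

(** Removing t before s instead of after it replaces [zeta s t] by [zeta t s]; the linear factors
    next to f compensate for this, up to the sign coming from s - t. *)
Lemma remove_remove_at i s (f : K -> K) X : s.1 != i ->
  remove i (fun z => f z * (s.2 - q ^ B i s.1 * z)) (remove_at s X) =
  - remove_at s (remove i (fun z => f z * (z - q ^ B i s.1 * s.2)) X).
Proof.
move=> si; apply/funext => p; rewrite funN /remove_at /remove.
case: (boolP (generic p)) => gp /=; last by rewrite oppr0.
case: (boolP (s \in p)) => sp; last first.
  rewrite oppr0 big1 // => t _; rewrite mem_drop_point (negPf sp) andbF.
  by rewrite andbF scaler0.
rewrite generic_drop_point // scaler_sumr -sumrN big_filter_cond.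
rewrite big_seq_cond [RHS]big_seq_cond.
rewrite [RHS](eq_bigl (fun t => (t \in p) && (t.1 == i))); last first.
  move=> t; congr (_ && _); apply/andb_idl => /eqP ti.
  by apply: contraNneq si => <-; rewrite ti.
apply: eq_bigr => t /andP[tp /eqP ti].
have st : s != t by apply: contraNneq si => ->; rewrite ti.
have sp' : s \in drop_point t p by rewrite mem_drop_point st.
have tp' : t \in drop_point s p by rewrite mem_drop_point eq_sym st.
have /and3P[s_t _ _] := generic_separated gp sp tp st.
rewrite generic_drop_point // sp' /= (prod_drop_point _ _ sp') ?generic_uniq ?generic_drop_point //.
rewrite (prod_drop_point (zeta s) _ tp') ?generic_uniq ?generic_drop_point //.
rewrite !(drop_pointC s t) !scalerA -scaleNr; congr (_ *: _).
rewrite /zeta ti (BC s.1 i); field.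
by rewrite !subr_eq0 s_t eq_sym s_t.
Qed.

(** Fix the point s of colour j that is removed, with w = s.2. Moving its removal outermost turns
    each i-weight h(z)(w - P z) that it passes into -h(z)(z - P w). All weights then belong to the
    quantum plane of h(z) and h(z) z, where [qplane_serre] applies. *)
Lemma remove_serre i j (v : K) d (f g : K -> K) X : i != j -> v != 0 ->
  (forall n, qint v n.+1 != 0) -> (0 < d)%N ->
  q ^ B i i = v ^+ 2 -> q ^ B i j = v^-1 ^+ d.-1 ->
  \sum_(l < d.+1) ((-1) ^+ l * qbinom v d l) *:
    iter (d - l) (remove i f) (remove j g (iter l (remove i f) X)) = 0.
Proof.
move=> ij v0 vn d0 Bii Bij; set P := v^-1 ^+ d.-1 in Bij.
apply/funext => p; rewrite fct_sumE.
case: (boolP (generic p)) => gp; last first.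
  rewrite big1 // => l _; rewrite funZ (_ : iter _ _ _ p = 0) ?scaler0 //.
  by case: (d - l)%N => [|e] /=; rewrite /remove (negPf gp).
rewrite (eq_bigr (fun l : 'I_d.+1 => \sum_(s <- p | s.1 == j) g s.2 *:
    (((-1) ^+ l * qbinom v d l) *: iter (d - l) (remove i f)
        (remove_at s (iter l (remove i f) X)) p))); last first.
  move=> l _; rewrite funZ.
  rewrite (@iter_remove_local i f f _ (\sum_(s <- p | s.1 == j)
      g s.2 *: remove_at s (iter l (remove i f) X))) //; last first.
    move=> p' p'p gp'; rewrite (remove_sum_at _ _ _ gp) // fct_sumE.
    by [].
  have iter_sum e : iter e (remove i f) (\sum_(s <- p | s.1 == j)
        g s.2 *: remove_at s (iter l (remove i f) X)) =
      \sum_(s <- p | s.1 == j)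
        g s.2 *: iter e (remove i f) (remove_at s (iter l (remove i f) X)).
    elim: e => //= e ->; rewrite linear_sum; apply: eq_bigr => s _.
    by rewrite linearZ.
  rewrite iter_sum fct_sumE scaler_sumr; apply: eq_bigr => s _.
  by rewrite funZ !scalerA mulrC.
rewrite exchange_big big_seq_cond big1 //= => s /andP[sp /eqP sj].
rewrite -scaler_sumr; set S := (X in _ *: X); suff -> : S = 0 by rewrite scaler0.
have si : s.1 != i by rewrite sj eq_sym.
(* Dividing by w - P z creates the factor that [remove_remove_at] requires; at the points of p of
   colour i it is nonzero because they are separated from s. *)
pose w := s.2; pose h z := f z / (w - P * z).
pose a := remove i h : {linear (seq point -> W) -> (seq point -> W)}.
pose b := remove i (fun z => h z * z) : {linear (seq point -> W) -> (seq point -> W)}.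
have abE Y : a (b Y) = v ^+ 2 *: b (a Y) by rewrite -Bii; apply: remove_same.
have removeB c1 c2 Y :
    remove i (fun z => h z * (c1 * z - c2)) Y = c1 *: b Y - c2 *: a Y.
  apply/funext => p'; rewrite funD funN !funZ /b /a /= /remove; case: ifP => _; last first.
    by rewrite !scaler0 subr0.
  rewrite !scaler_sumr -sumrB; apply: eq_bigr => t _.
  by rewrite !scalerA -scalerBl; congr (_ *: _); ring.
pose f1 z := h z * (w - P * z); pose f2 z := h z * (z - P * w).
have f1E Y : remove i f1 Y = - (P *: b Y - w *: a Y).
  rewrite -removeB -[RHS]scaleN1r; apply/funext => p'; rewrite funZ /remove.
  case: ifP => _; rewrite ?scaler0 // scaler_sumr; apply: eq_bigr => t _.
  by rewrite scalerA; congr (_ *: _); rewrite /f1; ring.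
have f2E Y : remove i f2 Y = b Y - (P * w) *: a Y.
  rewrite -[b Y]scale1r -removeB; congr (remove i _ _).
  by apply/funext => z; rewrite mul1r.
have iterf1 l Y : iter l (remove i f1) Y =
    (-1) ^+ l *: iter l (fun y => P *: b y - w *: a y) Y.
  elim: l => [|l IHl] /=; first by rewrite scale1r.
  by rewrite IHl linearZ /= f1E exprSr -scalerA scaleN1r.
have iterf2 e Y : iter e (remove i f1) (remove_at s Y) =
    (-1) ^+ e *: remove_at s (iter e (fun y => b y - (P * w) *: a y) Y).
  elim: e => [|e IHe] /=; first by rewrite scale1r.
  rewrite IHe linearZ /= exprSr -scalerA scaleN1r -f2E; congr (_ *: _).
  have := @remove_remove_at i s h (iter e (fun y => b y - (P * w) *: a y) Y) si.
  by rewrite sj Bij.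
have ff1 t : t \in p -> t.1 = i -> f t.2 = f1 t.2.
  move=> tp ti; rewrite /f1 /h divfK // subr_eq0.
  have st : s != t by apply: contraNneq si => ->; rewrite ti.
  by have /and3P[_ + _] := generic_separated gp sp tp st; rewrite sj ti BC Bij.
have SE l : iter (d - l) (remove i f) (remove_at s (iter l (remove i f) X)) p =
    iter (d - l) (remove i f1) (remove_at s (iter l (remove i f1) X)) p.
  apply: iter_remove_local => // p' p'p gp'; rewrite /remove_at.
  case: ifP => // /andP[_ sp']; congr (_ *: _).
  apply: iter_remove_local => // [|t]; first exact: generic_drop_point.
  by rewrite mem_drop_point => /andP[_ tp']; apply: ff1; apply: (mem_subseq p'p).
rewrite /S (eq_bigr (fun l : 'I_d.+1 => ((-1) ^+ d *: remove_at s
   (((-1) ^+ l * qbinom v d l) *: iter (d - l) (fun y => b y - (P * w) *: a y)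
      (iter l (fun y => P *: b y - w *: a y) X))) p)); last first.
  move=> l _; rewrite SE (iterf1 l X) [remove_at s (_ *: _)]linearZ /=.
  have iterZ e k Y : iter e (remove i f1) (k *: Y) = k *: iter e (remove i f1) Y.
    by elim: e => //= e ->; rewrite linearZ.
  rewrite iterZ iterf2 [remove_at s (_ *: _)]linearZ /= !funZ !scalerA.
  by rewrite -exprD subnKC ?leq_ord //; congr (_ *: _); rewrite mulrC.
transitivity (((-1) ^+ d *: remove_at s (\sum_(l < d.+1)
   ((-1) ^+ l * qbinom v d l) *: iter (d - l) (fun y => b y - (P * w) *: a y)
      (iter l (fun y => P *: b y - w *: a y) X))) p).
  by rewrite linear_sum scaler_sumr fun_sum.
by rewrite (qplane_serre w v0 vn d0 abE) linear0 scaler0.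
Qed.

End Removal.

End ColouredPoints.

(** * Actions of the free algebra *)

Section FreeAction.
Variables (K : comNzRingType) (G : choiceType).
Local Notation FA := (free_alg K G).
Local Notation MA := {malg K[{fmonom G}]}.
Local Notation gen := (@free_gen K G).

Lemma free_monomE (c : K) (s : seq G) :
  (<< c *g FMonom s >> : FA) = c *: \prod_(y <- s) gen y.
Proof.
have malgUZ (k : {fmonom G}) : (<< c *g k >> : FA) = c *: (<< k >> : FA).
  rewrite /GRing.scale /= free_scaleE; apply/malgP => m.
  by rewrite mcoeffZ !mcoeffU; case: eqP => _; rewrite ?mulr1 ?mulr0.
rewrite malgUZ; congr (_ *: _); elim: s => [|y s IHs].
  by rewrite big_nil -fmoneE.
rewrite big_cons -IHs /GRing.mul /= free_mulE unlock malgM_def fgmulUU mulr1.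
by congr (mkmalgU _ _); rewrite /mmul /= fmmulE fmuE.
Qed.

Lemma free_ind (P : FA -> Prop) :
  P 0 -> P 1 -> (forall a x y, P x -> P y -> P (a *: x + y)) ->
  (forall y x, P x -> P (gen y * x)) -> forall x, P x.
Proof.
move=> P0 P1 PD PM x.
have Pw s : P (\prod_(y <- s) gen y).
  by elim: s => [|y s IHs]; rewrite ?big_nil // big_cons; apply: PM.
rewrite (monalgE x); elim: (msupp x : seq _) => [|m s IHs]; first by rewrite big_nil.
rewrite big_cons -(fmK m) free_monomE; exact: PD.
Qed.

Variables (W : lmodType K) (rho : G -> W -> W).
Hypothesis rho_lin : forall y, linear (rho y).

Definition act (x : FA) (v : W) : W :=
  \sum_(m <- msupp (x : MA)) (x : MA)@_m *: foldr rho v (m : seq G).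

Lemma act_wide (d : {fset {fmonom G}}) (x : FA) v :
  fsubset (msupp (x : MA)) d ->
  act x v = \sum_(m <- d) (x : MA)@_m *: foldr rho v (m : seq G).
Proof.
move=> le; rewrite [LHS](big_fset_incl _ le) => //= m _ /mcoeff_outdom ->.
by rewrite scale0r.
Qed.

Lemma act_linl a (x y : FA) v : act (a *: x + y) v = a *: act x v + act y v.
Proof.
pose d := (msupp (x : MA) `|` msupp (y : MA))%fset.
rewrite (@act_wide d x) ?fsubsetUl // (@act_wide d y) ?fsubsetUr //.
rewrite (@act_wide d (a *: x + y)); last first.
  apply: fsubset_trans (msuppD_le _ _) _; apply: fsetUSS => //.
  rewrite /GRing.scale /= free_scaleE; exact: msuppZ_le.
rewrite scaler_sumr -big_split; apply: eq_bigr => m _.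
have -> : (a *: x + y : MA)@_m = a * (x : MA)@_m + (y : MA)@_m.
  by rewrite mcoeffD {1}/GRing.scale /= free_scaleE mcoeffZ.
by rewrite scalerDl scalerA.
Qed.

Lemma act0l v : act 0 v = 0.
Proof. by have := act_linl (-1) 0 0 v; rewrite scaler0 addr0 scaleN1r addNr. Qed.

Lemma actDl (x y : FA) v : act (x + y) v = act x v + act y v.
Proof. by rewrite -[x in LHS]scale1r act_linl scale1r. Qed.

Lemma actZl a (x : FA) v : act (a *: x) v = a *: act x v.
Proof. by rewrite -[a *: x]addr0 act_linl act0l addr0. Qed.

Lemma actNl (x : FA) v : act (- x) v = - act x v.
Proof. by rewrite -!scaleN1r actZl. Qed.

Lemma actBl (x y : FA) v : act (x - y) v = act x v - act y v.
Proof. by rewrite actDl actNl. Qed.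

Lemma act_suml (J : Type) (s : seq J) (P : pred J) (F : J -> FA) v :
  act (\sum_(k <- s | P k) F k) v = \sum_(k <- s | P k) act (F k) v.
Proof.
elim: s => [|k s IHs]; first by rewrite !big_nil act0l.
by rewrite !big_cons; case: ifP => _; rewrite ?actDl IHs.
Qed.

Lemma act_monom c (m : {fmonom G}) v :
  act << c *g m >> v = c *: foldr rho v (m : seq G).
Proof. by rewrite (act_wide _ msuppU_le) big_seq_fset1 mcoeffUU. Qed.

Lemma act1 v : act 1 v = v.
Proof.
have -> : 1 = << 1 *g FMonom [::] >> :> FA by rewrite free_monomE big_nil scale1r.
by rewrite act_monom scale1r.
Qed.

Lemma act_genM y (x : FA) v : act (gen y * x) v = rho y (act x v).
Proof.
pose rl := GRing.isLinear.Build K W W _ (rho y) (rho_lin y).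
pose f : {linear W -> W} := HB.pack (rho y) rl.
have fE : rho y = f by [].
rewrite [in LHS](monalgE x) mulr_sumr act_suml [act x v]/act fE linear_sum.
apply: eq_bigr => m _; rewrite linearZ -fE.
have -> : gen y * (<< (x : MA)@_m *g m >> : FA) = << (x : MA)@_m *g FMonom (y :: m) >>.
  rewrite -[X in << _ *g X >>]fmK !free_monomE big_cons.
  by rewrite scalerAr.
by rewrite act_monom.
Qed.

Lemma act_gen y v : act (gen y) v = rho y v.
Proof. by rewrite -[gen y]mulr1 act_genM act1. Qed.

Lemma actM (x y : FA) v : act (x * y) v = act x (act y v).
Proof.
elim/free_ind: x => [||a x1 x2 IH1 IH2|z x IHx].
- by rewrite mul0r !act0l.
- by rewrite mul1r act1.
- by rewrite mulrDl -scalerAl !act_linl IH1 IH2.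
- by rewrite -mulrA !act_genM IHx.
Qed.

Lemma act_linr (x : FA) : linear (act x).
Proof.
move=> a u v; elim/free_ind: x => [||b x1 x2 IH1 IH2|z x IHx].
- by rewrite !act0l scaler0 addr0.
- by rewrite !act1.
- rewrite !act_linl IH1 IH2 !scalerDr !scalerA [a * b]mulrC.
  by rewrite -!addrA; congr (_ + _); rewrite addrCA.
- by rewrite !act_genM IHx rho_lin.
Qed.

HB.instance Definition _ x := GRing.isLinear.Build K W W _ (act x) (act_linr x).

Lemma act_exp (x : FA) n v : act (x ^+ n) v = iter n (act x) v.
Proof. by elim: n => [|n IHn]; rewrite ?act1 // exprS actM IHn. Qed.

End FreeAction.

(** * The elements phi as polynomials in k and h *)

Section CartanPart.
Variables (R : realType) (N : nat) (q : R[i]).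
Local Notation K := R[i].
Local Notation FA := (free_alg K (drinfeld_gen N)).
Local Notation fh := (@fh R N).
Local Notation fk := (@fk R N).
Local Notation fphi := (@fphi R N q).

Definition sign_factor (s : bool) : K := (sgi s)%:~R * (q - q^-1).

Lemma coef_fh_series s i n j : (fh_series q s i n)`_j =
  if (0 < j <= n)%N then sign_factor s *: fh i (sgi s * j%:Z) else 0.
Proof.
rewrite /fh_series coef_sum.
under eq_bigr do rewrite mul_polyC coefZ coefXn.
case: ifP => [|/negbT] jn.
  rewrite (bigD1_seq j) ?mem_index_iota ?iota_uniq //= eqxx mulr1.
  by rewrite big1 ?addr0 // => m /negPf mj; rewrite eq_sym mj mulr0.
rewrite big_nat big1 // => m m_n; case: eqP => [jm|_]; last by rewrite mulr0.
by rewrite jm -ltnS m_n in jn.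
Qed.

(** As phi is polynomial in k_i and the h_{i,m}, a property stable under the algebra operations
    passes to it without any computation with the exponential. *)
Lemma fphi_ind (P : FA -> Prop) s i :
  P 0 -> P 1 -> (forall a x y, P x -> P y -> P (a *: x + y)) ->
  (forall x y, P x -> P y -> P (x * y)) ->
  (forall n, n != 0 -> P (fh i n)) -> P (fk s i) -> forall n, P (fphi s i n).
Proof.
move=> P0 P1 PD PM Ph Pk n.
have PZ a x : P x -> P (a *: x) by move=> Px; rewrite -[_ *: _]addr0; apply: PD.
have Pser j : P (fh_series q s i n)`_j.
  rewrite coef_fh_series; case: ifP => // /andP[j0 _]; apply/PZ/Ph.
  by case: s {Pk} => /=; lia.
have Pexp l m : P (fh_series q s i n ^+ l)`_m.
  elim: l m => [|l IHl] m; first by rewrite expr0 coef1; case: (m == 0%N).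
  rewrite exprS coefM; elim/big_ind: _ => // [x y Px Py|j _]; last exact: PM.
  by rewrite -[x]scale1r; apply: PD.
apply: PM => //; elim/big_ind: _ => // [x y Px Py|l _]; last exact: PZ.
by rewrite -[x]scale1r; apply: PD.
Qed.

Lemma fphiz_ind (P : FA -> Prop) s i :
  P 0 -> P 1 -> (forall a x y, P x -> P y -> P (a *: x + y)) ->
  (forall x y, P x -> P y -> P (x * y)) ->
  (forall n, n != 0 -> P (fh i n)) -> P (fk s i) -> forall n, P (fphiz q s i n).
Proof. by move=> *; rewrite /fphiz; case: ifP => // _; apply: fphi_ind. Qed.

Section Eigenvalues.
(* E x c is meant to say that x acts on a fixed vector by the scalar c. *)
Variables (E : FA -> K -> Prop) (s : bool) (i : 'I_N) (e : nat -> K) (k : K).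
Hypotheses (E0 : E 0 0) (E1 : E 1 1).
Hypothesis ED : forall a x y c d, E x c -> E y d -> E (a *: x + y) (a * c + d).
Hypothesis EM : forall x y c d, E x c -> E y d -> E (x * y) (c * d).

Let EZ a x c : E x c -> E (a *: x) (a * c).
Proof. by move=> Ex; rewrite -[_ *: _]addr0 -[_ * _]addr0; apply: ED. Qed.

Let EDD x y c d : E x c -> E y d -> E (x + y) (c + d).
Proof. by move=> Ex Ey; rewrite -[x]scale1r -[c]mul1r; apply: ED. Qed.

Let Esum (J : Type) (t : seq J) (F : J -> FA) (c : J -> K) :
  (forall j, E (F j) (c j)) -> E (\sum_(j <- t) F j) (\sum_(j <- t) c j).
Proof.
by move=> EF; elim: t => [|j t IHt]; rewrite ?big_nil // !big_cons; apply: EDD.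
Qed.

Lemma fh_series_exp_eigen n l m :
  (forall m', (0 < m' <= n)%N -> E (sign_factor s *: fh i (sgi s * m'%:Z)) (e m')) ->
  E (fh_series q s i n ^+ l)`_m (log_series e n ^+ l)`_m.
Proof.
move=> Eh; elim: l m => [|l IHl] m; first by rewrite !expr0 !coef1; case: (m == 0%N).
rewrite !exprS !coefM.
apply: Esum => j; apply: EM => //; rewrite coef_fh_series coef_log_series.
by case: ifP => // jn; apply: Eh.
Qed.

Lemma fphi_eigen n : E (fk s i) k ->
  (forall m, (0 < m <= n)%N -> E (sign_factor s *: fh i (sgi s * m%:Z)) (e m)) ->
  E (fphi s i n) (k * exp_coef e n).
Proof.
move=> Ek Eh; apply: EM => //; rewrite /exp_coef.
by apply: Esum => l; apply/EZ/fh_series_exp_eigen.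
Qed.

End Eigenvalues.

(** The mode h_{i,n+1} enters linearly and the remaining sum involves lower modes only; this is what
    allows eigenvalues of the h to be recovered from those of the phi. *)
Lemma fphiS_split s i n : fphi s i n.+1 = fk s i *
  (sign_factor s *: fh i (sgi s * n.+1%:Z) +
   \sum_(l < n.+2) (l`!%:R^-1 : K) *: (fh_series q s i n ^+ l)`_n.+1).
Proof.
rewrite /Defs.fphi; congr (_ * _).
rewrite (eq_bigr (fun l : 'I_n.+2 => (l`!%:R^-1 : K) *: (fh_series q s i n ^+ l)`_n.+1 +
   (l`!%:R^-1 : K) *: ((fh_series q s i n.+1)`_n.+1 *+ (l == 1 :> nat)))); last first.
  move=> l _; rewrite -scalerDr -coef_exp_top // ?coef_fh_series ?ltnn ?andbF //.
  by move=> j jn; rewrite !coef_fh_series jn leqW.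
rewrite big_split addrC; congr (_ + _).
rewrite (bigD1 (Ordinal (isT : (1 < n.+2)%N))) //= big1 ?addr0; last first.
  by move=> l /negPf; rewrite -val_eqE /= => ->; rewrite mulr0n scaler0.
rewrite mulr1n coef_fh_series ltnSn -[RHS]scale1r; congr (_ *: _).
exact: invr1.
Qed.

End CartanPart.

(** * The operators on the full dual of the Verma module *)

Section DualVerma.
Variables (R : realType) (N : nat) (C : 'M[int]_N) (r : 'I_N -> nat) (q : R[i]).
Local Notation K := R[i].
Local Notation B := (symmetrized_cartan C r).
Local Notation qi := (qi r q).
Local Notation fx := (@fx R N).
Local Notation fh := (@fh R N).
Local Notation fk := (@fk R N).
Local Notation fphiz := (@fphiz R N q).

Variables (kappa : 'I_N -> K) (eta : 'I_N -> int -> K).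
Hypotheses (q0 : q != 0) (kappa0 : forall i, kappa i != 0).
Hypothesis BC : forall i j, B i j = B j i.

(* (i, n) stands for the generator x^-_{i, n} of the Verma module. *)
Definition letter := ('I_N * int)%type.
Definition word := seq letter.

(* The full dual of the Verma module, with the contragredient action given by
   the anti-automorphism exchanging x^+_{i, n} and x^-_{i, n}. *)
Definition dual : lmodType K := (word -> K^o).
Implicit Types (w : word) (xi : dual) (x : letter).

Definition raise x xi : dual := fun w => xi (x :: w).

Definition weight_factor s i w : K :=
  (kappa i * q ^ (- \sum_(x <- w) B i x.1)) ^ sgi s.

Definition kop s i xi : dual := fun w => weight_factor s i w * xi w.

Definition hcoef i j (n : int) : K := n%:~R^-1 * qint q (n * B i j).

Definition shift_letter x (n : int) : letter := (x.1, x.2 + n).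

(** The value at x :: w is that of x^+_x h xi at w, rewritten by the commutator of h with x^+; on
    the empty word h acts by its vacuum eigenvalue [eta]. *)
Fixpoint hop_at i n w xi : K :=
  if w is x :: w' then
    hop_at i n w' (raise x xi) - hcoef i x.1 n * xi (shift_letter x n :: w')
  else eta i n * xi [::].

Definition hop i n xi : dual := fun w => hop_at i n w xi.

(** The definition of x^- involves phi, so phi is first evaluated through this partial action.
    Sending the x to 0 is harmless, since none occurs in phi. *)
Definition cartan_action (y : drinfeld_gen N) : dual -> dual :=
  match y with
  | GenX _ _ _ => fun=> 0
  | GenK s i => kop s i
  | GenH s i m => hop i (sgi s * m.+1%:Z)
  | GenC _ => id
  end.

Definition qdiff i : K := qi i - (qi i)^-1.

(* Sealed, since unification must not unfold phi_{i, n}. *)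
Fact phi_op_key : {f : bool -> 'I_N -> int -> dual -> dual |
  forall s i n xi, f s i n xi = act cartan_action (fphiz s i n) xi}.
Proof. by exists (fun s i n xi => act cartan_action (fphiz s i n) xi). Qed.

Definition phi_op := sval phi_op_key.

Lemma phi_opE s i n xi : phi_op s i n xi = act cartan_action (fphiz s i n) xi.
Proof. exact: (svalP phi_op_key). Qed.

Definition phi_diff i n xi : dual :=
  (qdiff i)^-1 *: (phi_op true i n xi - phi_op false i n xi).

(** The recursion is the relation between x^+_y and x^-_x. The value on the empty word is 0 because,
    under the contragredient action, it pairs xi with x^+_x applied to the highest weight vector. *)
Fixpoint lower_at x w xi : K :=
  if w is y :: w' then
    lower_at x w' (raise y xi) +
      (if y.1 == x.1 then phi_diff y.1 (y.2 + x.2) xi w' else 0)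
  else 0.

Definition lower x xi : dual := fun w => lower_at x w xi.

Definition dual_action (y : drinfeld_gen N) : dual -> dual :=
  match y with
  | GenX true i n => raise (i, n)
  | GenX false i n => lower (i, n)
  | _ => cartan_action y
  end.

Local Notation act0 := (act cartan_action).
Local Notation actv := (act dual_action).

Lemma dualD (u v : dual) w : (u + v) w = u w + v w. Proof. by []. Qed.
Lemma dualB (u v : dual) w : (u - v) w = u w - v w. Proof. by []. Qed.
Lemma dualN (u : dual) w : (- u) w = - u w. Proof. by []. Qed.
Lemma dualZ a (u : dual) w : (a *: u) w = a * u w. Proof. by []. Qed.
Lemma dual0 w : (0 : dual) w = 0. Proof. by []. Qed.
Lemma raise_linear x : linear (raise x). Proof. by []. Qed.
Lemma raiseZ x a xi : raise x (a *: xi) = a *: raise x xi. Proof. by []. Qed.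
Lemma raiseB x u v : raise x (u - v) = raise x u - raise x v. Proof. by []. Qed.
Lemma raiseD x u v : raise x (u + v) = raise x u + raise x v. Proof. by []. Qed.

Lemma kop_linear s i : linear (kop s i).
Proof.
move=> a u v; apply/funext => w; rewrite dualD dualZ /kop dualD dualZ.
by rewrite mulrDr mulrCA.
Qed.

Lemma hop_linear i n : linear (hop i n).
Proof.
move=> a u v; apply/funext => w; rewrite dualD dualZ /hop.
elim: w u v => [|x w IHw] u v /=; first by rewrite dualD dualZ mulrDr mulrCA.
rewrite raiseD raiseZ IHw dualD dualZ; ring.
Qed.

Lemma cartan_action_linear y : linear (cartan_action y).
Proof.
case: y => [s i n|s i|s i n|s] //=; first by move=> a u v; rewrite scaler0 addr0.
  exact: kop_linear.
exact: hop_linear.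
Qed.

Lemma phi_op_linear s i n : linear (phi_op s i n).
Proof. by move=> a u v; rewrite !phi_opE; apply: act_linr cartan_action_linear _ a u v. Qed.

Lemma phi_diff_linear i n : linear (phi_diff i n).
Proof.
move=> a u v; rewrite /phi_diff.
rewrite (phi_op_linear true i n a u v) (phi_op_linear false i n a u v).
by rewrite opprD addrACA -scalerBr scalerDr !scalerA [_^-1 * a]mulrC.
Qed.

Lemma lower_linear x : linear (lower x).
Proof.
move=> a u v; apply/funext => w; rewrite dualD dualZ /lower.
elim: w u v => [|y w IHw] u v /=; first by rewrite mulr0 addr0.
rewrite raiseD raiseZ IHw; case: ifP => _; last by rewrite !addr0.
rewrite (phi_diff_linear _ _ a u v) dualD dualZ; ring.
Qed.

Lemma dual_action_linear y : linear (dual_action y).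
Proof.
case: y => [[] i n|s i|s i n|s] //=; first exact: lower_linear.
  exact: kop_linear.
exact: hop_linear.
Qed.

Lemma linear_combs (f : dual -> dual) : linear f ->
  [/\ forall a u, f (a *: u) = a *: f u, forall u v, f (u + v) = f u + f v,
      forall u v, f (u - v) = f u - f v & f 0 = 0].
Proof.
move=> fl; pose ml := GRing.isLinear.Build K dual dual _ f fl.
pose g : {linear dual -> dual} := HB.pack f ml.
split=> [a u|u v|u v|]; [exact: (linearZ_LR g)|exact: (linearD g)|
  exact: (linearB g)|exact: (linear0 g)].
Qed.

Lemma actv_fx s i n xi :
  actv (fx s i n) xi = if s then raise (i, n) xi else lower (i, n) xi.
Proof. by rewrite /Defs.fx (act_gen dual_action_linear); case: s. Qed.

Lemma actv_fk s i xi : actv (fk s i) xi = kop s i xi.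
Proof. by rewrite /Defs.fk (act_gen dual_action_linear). Qed.

Lemma actv_fh i n xi : n != 0 -> actv (fh i n) xi = hop i n xi.
Proof.
case: n => [[|m]|m] //= _; rewrite (act_gen dual_action_linear) /=.
  by rewrite mul1r.
by rewrite NegzE mulN1r.
Qed.

Lemma act0_fk s i xi : act0 (fk s i) xi = kop s i xi.
Proof. by rewrite /Defs.fk (act_gen cartan_action_linear). Qed.

Lemma act0_fh i n xi : n != 0 -> act0 (fh i n) xi = hop i n xi.
Proof.
case: n => [[|m]|m] //= _; rewrite (act_gen cartan_action_linear) /=.
  by rewrite mul1r.
by rewrite NegzE mulN1r.
Qed.

Lemma actv_fc m xi : actv (fc R N m) xi = xi.
Proof.
have idE s n (v : dual) : iter n (actv (free_gen K (GenC N s))) v = v.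
  by elim: n => //= n ->; rewrite (act_gen dual_action_linear).
by case: m => n; rewrite /fc (act_exp dual_action_linear) idE.
Qed.

Lemma actv_fphiz s i n xi : actv (fphiz s i n) xi = phi_op s i n xi.
Proof.
rewrite phi_opE.
elim/fphiz_ind: (fphiz s i n) xi => [xi|xi|a x y IHx IHy xi|x y IHx IHy xi|m m0 xi|xi].
- by rewrite !act0l.
- by rewrite !act1.
- by rewrite !act_linl IHx IHy.
- by rewrite (actM cartan_action_linear) (actM dual_action_linear) IHy IHx.
- by rewrite actv_fh // act0_fh.
- by rewrite actv_fk act0_fk.
Qed.

Lemma commute_phi_op (f : dual -> dual) i : linear f ->
  (forall s xi, f (kop s i xi) = kop s i (f xi)) ->
  (forall n xi, n != 0 -> f (hop i n xi) = hop i n (f xi)) ->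
  forall s n xi, f (phi_op s i n xi) = phi_op s i n (f xi).
Proof.
move=> fl fk' fh' s n xi; have [fZ fD _ f0] := linear_combs fl.
rewrite !phi_opE.
elim/fphiz_ind: (fphiz s i n) xi => [xi|xi|a x y IHx IHy xi|x y IHx IHy xi|m m0 xi|xi].
- by rewrite !act0l f0.
- by rewrite !act1.
- by rewrite !act_linl fD fZ IHx IHy.
- by rewrite !(actM cartan_action_linear) IHx IHy.
- by rewrite !act0_fh // fh'.
- by rewrite !act0_fk fk'.
Qed.

Lemma commute_phi_diff (f : dual -> dual) i : linear f ->
  (forall s xi, f (kop s i xi) = kop s i (f xi)) ->
  (forall n xi, n != 0 -> f (hop i n xi) = hop i n (f xi)) ->
  forall n xi, f (phi_diff i n xi) = phi_diff i n (f xi).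
Proof.
move=> fl fk' fh' n xi; have [fZ _ fB _] := linear_combs fl.
by rewrite /phi_diff fZ fB !(commute_phi_op fl fk' fh').
Qed.

Lemma weight_factor_cons s i x w :
  weight_factor s i (x :: w) = q ^ (- (sgi s * B i x.1)) * weight_factor s i w.
Proof.
rewrite /weight_factor big_cons opprD expfzDr // mulrCA.
by case: s; rewrite /= ?expr1z ?mul1r ?mulN1r ?opprK ?exprN1 // invfM invr_expz opprK.
Qed.

Lemma raise_kop s i x xi :
  raise x (kop s i xi) = q ^ (- (sgi s * B i x.1)) *: kop s i (raise x xi).
Proof.
apply/funext => w; rewrite dualZ /raise /kop weight_factor_cons.
by rewrite mulrA.
Qed.

Lemma raise_hop i n x xi :
  raise x (hop i n xi) =
  hop i n (raise x xi) - hcoef i x.1 n *: raise (shift_letter x n) xi.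
Proof. by []. Qed.

Lemma raise_lower x y xi : raise y (lower x xi) =
  lower x (raise y xi) + (if y.1 == x.1 then phi_diff y.1 (y.2 + x.2) xi else 0).
Proof. by apply/funext => w; rewrite dualD /raise /lower /=; case: ifP. Qed.

(** The induction is on the word, for all xi at once: after [raise] has been commuted inwards, the
    identity is needed for other vectors but at a shorter word. *)
Lemma dual_ext (f g : dual -> dual) :
  (forall xi, f xi [::] = g xi [::]) ->
  (forall w x, (forall xi, f xi w = g xi w) ->
    forall xi, raise x (f xi) w = raise x (g xi) w) ->
  forall xi, f xi = g xi.
Proof.
move=> fg0 fgS xi; apply/funext => w; elim: w xi => [|x w IHw] xi; first exact: fg0.
exact: fgS.
Qed.

Lemma kopC s i s' j xi : kop s i (kop s' j xi) = kop s' j (kop s i xi).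
Proof. by apply/funext => w; rewrite /kop mulrCA. Qed.

Lemma kopK s i xi : kop s i (kop (~~ s) i xi) = xi.
Proof.
apply/funext => w; rewrite /kop mulrA /weight_factor.
set z := kappa i * _; have z0 : z != 0 by rewrite mulf_neq0 ?expfz_neq0.
by case: s => /=; rewrite ?expr1z ?exprN1 ?mulfV ?mulVf ?mul1r.
Qed.

Lemma kop_hop s i j n xi : kop s i (hop j n xi) = hop j n (kop s i xi).
Proof.
have [kZ _ kB _] := linear_combs (kop_linear s i).
have [hZ _ _ _] := linear_combs (hop_linear j n).
apply: (dual_ext (f := fun xi => kop s i (hop j n xi)) (g := fun xi => hop j n (kop s i xi))).
  by move=> u; rewrite /kop /hop /= mulrCA.
move=> w x IHw u; rewrite raise_kop !raise_hop !raise_kop kB kZ hZ.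
rewrite !(dualD, dualN, dualZ, dual0) IHw; ring.
Qed.

Lemma hopC i n j m xi : hop i n (hop j m xi) = hop j m (hop i n xi).
Proof.
have [hZ _ hB _] := linear_combs (hop_linear i n).
have [hZ' _ hB' _] := linear_combs (hop_linear j m).
apply: (dual_ext (f := fun xi => hop i n (hop j m xi)) (g := fun xi => hop j m (hop i n xi))).
  by move=> u; rewrite /hop /= mulrCA.
move=> w x IHw u; rewrite !raise_hop hB hB' hZ hZ'.
have -> : shift_letter (shift_letter x n) m = shift_letter (shift_letter x m) n.
  by rewrite /shift_letter /= addrAC.
rewrite !(dualD, dualN, dualZ, dual0) IHw; ring.
Qed.

Lemma kop_phi_diff s i j n xi : kop s i (phi_diff j n xi) = phi_diff j n (kop s i xi).
Proof.
apply: commute_phi_diff => [|s' u|m u _]; [exact: kop_linear|exact: kopC|exact: kop_hop].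
Qed.

Lemma hop_phi_diff i m j n xi : hop i m (phi_diff j n xi) = phi_diff j n (hop i m xi).
Proof.
apply: commute_phi_diff => [|s' u|k u _]; [exact: hop_linear|by rewrite kop_hop|exact: hopC].
Qed.

Lemma kop_lower s i x xi :
  kop s i (lower x xi) = q ^ (- (sgi s * B i x.1)) *: lower x (kop s i xi).
Proof.
have [kZ kD _ k0] := linear_combs (kop_linear s i).
have [lZ _ _ _] := linear_combs (lower_linear x).
apply: (dual_ext (f := fun xi => kop s i (lower x xi))
   (g := fun xi => q ^ (- (sgi s * B i x.1)) *: lower x (kop s i xi))).
  by move=> u; rewrite dualZ /kop /lower /= !mulr0.
move=> w y IHw u; rewrite raise_kop raiseZ !raise_lower raise_kop kD lZ.
rewrite !(dualD, dualZ) IHw dualZ !mulrDr mulrCA; congr (_ + _).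
case: eqP => [->|_]; last by rewrite k0 !dual0 !mulr0.
by rewrite kop_phi_diff.
Qed.

Lemma hop_lower i n x xi :
  hop i n (lower x xi) - lower x (hop i n xi) =
  - hcoef i x.1 n *: lower (shift_letter x n) xi.
Proof.
have [hZ hD hB h0] := linear_combs (hop_linear i n).
have [lZ _ lB _] := linear_combs (lower_linear x).
apply: (dual_ext (f := fun xi => hop i n (lower x xi) - lower x (hop i n xi))
   (g := fun xi => - hcoef i x.1 n *: lower (shift_letter x n) xi)).
  by move=> u; rewrite !(dualD, dualN, dualZ, dual0) /hop /lower /= !mulr0 subr0.
move=> w y IHw u; rewrite raiseB raiseZ raise_hop !raise_lower raise_hop hD lB lZ /=.
have := IHw (raise y u); rewrite !(dualD, dualN, dualZ, dual0) => /eqP; rewrite subr_eq => /eqP ->.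
case: eqP => [yx|_]; last first.
  rewrite h0 !(dualD, dualN, dualZ, dual0); ring.
rewrite hop_phi_diff yx (_ : y.2 + n + x.2 = y.2 + (x.2 + n)); last by lia.
ring.
Qed.

End DualVerma.

(** * Polynomials acting on two-sided sequences *)

Section ShiftedSequences.
Variable K : numFieldType.
Implicit Types (p : {poly K}) (a b : int -> K).

(* The action of polynomials on two-sided sequences for which X is the shift. *)
Definition star p a (n : int) : K := \sum_(j < size p) p`_j * a (n + j%:Z).

Lemma star_wide p a n d : (size p <= d)%N ->
  star p a n = \sum_(j < d) p`_j * a (n + j%:Z).
Proof.
move=> pd; rewrite /star (big_ord_widen _ (fun j => p`_j * a (n + j%:Z)) pd).
rewrite big_mkcond; apply: eq_bigr => j _.
by case: ltnP => // jp; rewrite nth_default ?mul0r.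
Qed.

Lemma star_linl c p1 p2 a n : star (c *: p1 + p2) a n = c * star p1 a n + star p2 a n.
Proof.
pose d := maxn (size p1) (size p2).
rewrite (@star_wide p1 _ _ d) ?leq_maxl // (@star_wide p2 _ _ d) ?leq_maxr //.
rewrite (@star_wide _ _ _ d).
  rewrite mulr_sumr -big_split; apply: eq_bigr => j _.
  by rewrite coefD coefZ mulrDl mulrA.
apply: leq_trans (size_polyD _ _) _; rewrite geq_max leq_maxr andbT.
by apply: leq_trans (size_scale_leq _ _) _; rewrite leq_maxl.
Qed.

Lemma star0 a n : star 0 a n = 0.
Proof. by rewrite /star size_poly0 big_ord0. Qed.

Lemma starZ c p a n : star (c *: p) a n = c * star p a n.
Proof. by rewrite -[_ *: _]addr0 star_linl star0 addr0. Qed.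

Lemma starD p1 p2 a n : star (p1 + p2) a n = star p1 a n + star p2 a n.
Proof. by rewrite -[p1]scale1r star_linl mul1r scale1r. Qed.

Lemma star_sum (J : Type) (s : seq J) (Q : pred J) (F : J -> {poly K}) a n :
  star (\sum_(j <- s | Q j) F j) a n = \sum_(j <- s | Q j) star (F j) a n.
Proof.
elim: s => [|j s IHs]; first by rewrite !big_nil star0.
by rewrite !big_cons; case: ifP => _; rewrite ?starD IHs.
Qed.

Lemma starX p a n : star ('X * p) a n = star p a (n + 1).
Proof.
rewrite (@star_wide _ _ _ (size p).+1); last first.
  by apply: leq_trans (size_polyMleq _ _) _; rewrite size_polyX.
rewrite big_ord_recl coefXM /= mul0r add0r; apply: eq_bigr => j _.
by rewrite coefXM /= /bump leq0n add1n /=; congr (_ * a _); lia.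
Qed.

Lemma star1 a n : star 1 a n = a n.
Proof. by rewrite /star size_poly1 big_ord1 coef1 mul1r addr0. Qed.

Lemma starM p1 p2 a n : star (p1 * p2) a n = star p1 (star p2 a) n.
Proof.
elim/poly_ind: p1 n => [|p1 c IHp] n; first by rewrite mul0r !star0.
rewrite mulrDl !starD mul_polyC starZ -[c%:P]mulr1 mul_polyC starZ star1.
by congr (_ + _); rewrite [p1 * 'X]mulrC -mulrA !starX.
Qed.

Lemma starXn m p a n : star ('X^m * p) a n = star p a (n + m%:Z).
Proof.
elim: m n => [|m IHm] n; first by rewrite mul1r addr0.
by rewrite exprS -mulrA starX IHm; congr (star p a _); lia.
Qed.

Lemma star_lin c u p a n :
  star ((c *: 'X - u%:P) * p) a n = c * star p a (n + 1) - u * star p a n.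
Proof.
rewrite mulrBl -scalerAl mul_polyC -scaleNr -[X in star X]addrC star_linl.
by rewrite starZ starX mulNr addrC.
Qed.

Lemma star_comb (J : Type) (s : seq J) (Q : pred J) (c : J -> K)
    (F : J -> int -> K) p n :
  star p (fun m => \sum_(j <- s | Q j) c j * F j m) n =
  \sum_(j <- s | Q j) c j * star p (F j) n.
Proof.
rewrite /star; under eq_bigr do rewrite mulr_sumr.
rewrite exchange_big; apply: eq_bigr => j _ /=.
by rewrite mulr_sumr; apply: eq_bigr => k _; rewrite mulrCA.
Qed.

Lemma star_add p a b n : star p (fun m => a m + b m) n = star p a n + star p b n.
Proof. by rewrite /star -big_split; apply: eq_bigr => j _ /=; rewrite mulrDr. Qed.

Lemma star_scaler p a c n : star p (fun m => c * a m) n = c * star p a n.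
Proof. by rewrite /star mulr_sumr; apply: eq_bigr => j _ /=; rewrite mulrCA. Qed.

Lemma star_shift p a m n : star p (fun k => a (m + k)) n = star p a (m + n).
Proof. by apply: eq_bigr => j _; rewrite addrA. Qed.

Lemma star_ext p a b n : (forall m, a m = b m) -> star p a n = star p b n.
Proof. by move=> ab; apply: eq_bigr => j _; rewrite ab. Qed.

Definition vanishes_at (s : bool) a : Prop :=
  exists n0 : int, forall n : int, sgi s * n < n0 -> a n = 0.

Lemma star_vanishes s p a : vanishes_at s a -> vanishes_at s (star p a).
Proof.
case=> n0 a0; exists (n0 - (size p)%:Z) => n nn; rewrite /star big1 // => j _.
rewrite a0 ?mulr0 //; move: (nat_of_ord j) (ltn_ord j) => k kp.
case: s nn {a0}; rewrite /sgi ?mul1r ?mulN1r; lia.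
Qed.

Lemma geometric_eq0 c u a : c != 0 -> u != 0 ->
  (forall n, c * a (n + 1) = u * a n) -> (exists n0, a n0 = 0) -> forall n, a n = 0.
Proof.
move=> c0 u0 rec [n0 an0] n; rewrite -[n](subrK n0) addrC.
elim/int_rec: (n - n0) => [|m IHm|m IHm]; first by rewrite addr0.
  apply: (mulfI c0); have := rec (n0 + m%:Z); rewrite IHm !mulr0 => <-.
  by congr (_ * a _); lia.
apply: (mulfI u0); have := rec (n0 - m.+1%:Z).
have -> : n0 - m.+1%:Z + 1 = n0 - m%:Z by lia.
by rewrite IHm !mulr0.
Qed.

(** The kernel of c X - u consists of geometric sequences, and such a sequence with a single zero
    value is zero. Vanishing far out on one side is inherited by the intermediate sequences and
    provides that value. *)
Lemma star_prod_inj s (J : Type) (t : seq J) (c u : J -> K) a :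
  (forall j, c j != 0) -> all (fun j => u j != 0) t ->
  vanishes_at s a ->
  (forall n, star (\prod_(j <- t) (c j *: 'X - (u j)%:P)) a n = 0) ->
  forall n, a n = 0.
Proof.
move=> c0; elim: t a => [|j t IHt] a /= => [_ _ h n|/andP[uj ut] van h].
  by rewrite -[RHS](h n) big_nil star1.
apply: IHt => //; apply: (@geometric_eq0 (c j) (u j)) => // [n|].
  by have /eqP := h n; rewrite big_cons star_lin subr_eq0 => /eqP.
have [n0 h0] := star_vanishes (\prod_(j <- t) (c j *: 'X - (u j)%:P)) van.
by exists (sgi s * (n0 - 1)); apply: h0; case: s {van} => /=; lia.
Qed.

Lemma poly_eq0_horner p : (forall z, p.[z] = 0) -> p = 0.
Proof.
move=> p0; apply: contraTeq isT => pn0.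
pose rs : seq K := [seq i%:R | i <- iota 0 (size p)].
have rootp : all (root p) rs by apply/allP => z _; rewrite /root p0.
have uniq_rs : uniq rs.
  by rewrite map_inj_in_uniq ?iota_uniq // => i j _ _ /eqP; rewrite eqr_nat => /eqP.
by have := max_poly_roots pn0 rootp uniq_rs; rewrite size_map size_iota ltnn.
Qed.

End ShiftedSequences.

(** * The functionals psi as eigenvectors of the Cartan generators *)

Section PointFunctionals.
Variables (R : realType) (N : nat) (C : 'M[int]_N) (r : 'I_N -> nat) (q : R[i]).
Local Notation K := R[i].
Local Notation FA := (free_alg K (drinfeld_gen N)).
Local Notation B := (symmetrized_cartan C r).

Variables (kappa : 'I_N -> K) (eta : 'I_N -> int -> K).
Hypotheses (q0 : q != 0) (kappa0 : forall i, kappa i != 0).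
Hypothesis qq0 : q - q^-1 != 0.
Hypothesis BC : forall i j, B i j = B j i.

Local Notation word := (word N).
Local Notation dual := (dual R N).
Local Notation kop := (kop C r q kappa).
Local Notation hop := (hop C r q eta).
Local Notation hcoef := (hcoef C r q).
Local Notation phi_op := (phi_op C r q kappa eta).
Local Notation cartan_action := (cartan_action C r q kappa eta).
Local Notation point := ('I_N * K)%type.
Local Notation generic := (generic (fun_of_matrix B) q).
Local Notation remove := (remove (fun_of_matrix B) q).
Implicit Types (p : seq point) (w : word) (xi : dual).

(* The matrix coefficient at generic points of the product of currents
   x^-_{i_1}(u_1) x^-_{i_2}(u_2) ...; it satisfies the relations among the
   x^-_{i, n} because the rational functions it is built from do. *)
Fixpoint psi_at w : seq point -> K^o :=
  if w is x :: w' then remove x.1 (fun z => z ^ x.2) (psi_at w')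
  else fun p => (p == [::])%:R.

Definition psi p : dual := fun w => psi_at w p.

Lemma remove_dual i f (X : seq point -> dual) p w :
  (remove i f X p : dual) w = remove i f (fun p' => X p' w : K^o) p.
Proof. by rewrite /remove; case: ifP => // _; rewrite fun_sum. Qed.

Lemma raise_psi x p : raise x (psi p) = remove x.1 (fun z => z ^ x.2) psi p.
Proof. by apply/funext => w; rewrite remove_dual. Qed.

Lemma sum_drop_point (F : point -> K) s p : generic p -> s \in p ->
  \sum_(t <- p) F t = F s + \sum_(t <- drop_point s p) F t :> K.
Proof. by move=> /generic_uniq up sp; rewrite (bigD1_seq s) //= big_filter. Qed.

(** Removing a point s drops its term from the eigenvalue, and this difference is exactly the
    commutator of h with x^+. *)
Lemma hop_psi i n p : generic p ->
  hop i n (psi p) = (eta i n - \sum_(s <- p) hcoef i s.1 n * s.2 ^ n) *: psi p.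
Proof.
move=> gp; apply/funext => w; rewrite dualZ.
elim: w p gp => [|x w IHw] p gp.
  rewrite /hop /psi /=; case: eqP => [->|_]; last by rewrite !mulr0.
  by rewrite big_nil subr0.
have -> : hop i n (psi p) (x :: w) =
    hop i n (raise x (psi p)) w - hcoef i x.1 n * psi p (shift_letter x n :: w) by [].
have [hZ hD _ h0] := linear_combs (hop_linear C r q eta i n).
have hsum (J : eqType) (s : seq J) (Q : pred J) (c : J -> K) (F : J -> dual) :
    hop i n (\sum_(j <- s | Q j) c j *: F j) = \sum_(j <- s | Q j) c j *: hop i n (F j).
  elim: s => [|j s IHs]; first by rewrite !big_nil h0.
  by rewrite !big_cons; case: ifP => _; rewrite ?hD ?hZ IHs.
rewrite raise_psi /remove gp hsum fun_sum.
rewrite /psi /= /remove gp /shift_letter /=.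
rewrite !mulr_sumr -sumrB; rewrite big_seq_cond [RHS]big_seq_cond.
apply: eq_bigr => s /andP[sp /eqP sx].
rewrite dualZ IHw ?generic_drop_point // (sum_drop_point _ gp sp) sx.
rewrite expfzDr ?(generic_neq0 gp) // /GRing.scale /= /psi.
move: (\prod_(_ <- _) _) (psi_at _ _) (\sum_(_ <- _) _) => a b c; ring.
Qed.

Lemma sign_exp_split s (k : K) (b c : int) :
  (k * q ^ (- (b + c))) ^ sgi s = q ^ (- (sgi s * b)) * (k * q ^ (- c)) ^ sgi s.
Proof.
rewrite opprD expfzDr // mulrCA.
by case: s; rewrite /= ?expr1z ?mul1r ?mulN1r ?opprK ?exprN1 // invfM invr_expz opprK.
Qed.

Lemma kop_psi s i p : generic p ->
  kop s i (psi p) =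
  ((kappa i * q ^ (- \sum_(t <- p) B i t.1)) ^ sgi s) *: psi p.
Proof.
move=> gp; apply/funext => w; rewrite dualZ.
elim: w p gp => [|x w IHw] p gp.
  rewrite /kop /psi /= /weight_factor; case: eqP => [->|_]; last by rewrite !mulr0.
  by rewrite !big_nil.
have -> : kop s i (psi p) (x :: w) = raise x (kop s i (psi p)) w by [].
rewrite raise_kop // dualZ raise_psi /remove gp.
have [kZ kD _ k0] := linear_combs (kop_linear C r q kappa s i).
have ksum (J : eqType) (t : seq J) (Q : pred J) (c : J -> K) (F : J -> dual) :
    kop s i (\sum_(j <- t | Q j) c j *: F j) = \sum_(j <- t | Q j) c j *: kop s i (F j).
  elim: t => [|j t IHt]; first by rewrite !big_nil k0.
  by rewrite !big_cons; case: ifP => _; rewrite ?kD ?kZ IHt.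
rewrite ksum fun_sum /psi /= /remove gp !mulr_sumr.
rewrite big_seq_cond [RHS]big_seq_cond; apply: eq_bigr => t /andP[tp /eqP tx].
rewrite dualZ IHw ?generic_drop_point //.
have -> : \sum_(t <- p) B i t.1 = B i x.1 + \sum_(t <- drop_point t p) B i t.1.
  by rewrite (bigD1_seq t) ?(generic_uniq gp) //= big_filter tx.
rewrite sign_exp_split /GRing.scale /= /psi.
move: (\prod_(_ <- _) _) (psi_at _ _) (_ ^ sgi s) => a b c; ring.
Qed.

Definition phi_eigen s i p (n : int) : K :=
  if 0 <= sgi s * n then
    (kappa i * q ^ (- \sum_(t <- p) B i t.1)) ^ sgi s *
    exp_coef (fun m => sign_factor q s * (eta i (sgi s * m%:Z)
       - \sum_(t <- p) hcoef i t.1 (sgi s * m%:Z) * t.2 ^ (sgi s * m%:Z))) `|n|%N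
  else 0.

Lemma phi_op_psi s i n p : generic p ->
  phi_op s i n (psi p) = phi_eigen s i p n *: psi p.
Proof.
move=> gp; rewrite phi_opE /phi_eigen /Defs.fphiz.
case: ifP => _; last by rewrite act0l scale0r.
have lin := cartan_action_linear C r q kappa eta.
pose E (x : FA) (c : K) := act cartan_action x (psi p) = c *: psi p.
apply: (@fphi_eigen _ _ q E) => [|||||m mn]; rewrite /E.
- by rewrite act0l scale0r.
- by rewrite act1 scale1r.
- by move=> a x y c d Ex Ey; rewrite act_linl Ex Ey scalerDl scalerA.
- move=> x y c d Ex Ey; rewrite (actM lin) Ey.
  have [aZ _ _ _] := linear_combs (act_linr lin x).
  by rewrite aZ Ex scalerA mulrC.
- by rewrite act0_fk kop_psi.
- rewrite actZl act0_fh; last by case: (s) => /=; lia.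
  by rewrite hop_psi // scalerA.
Qed.

Lemma star_binomial c u (a : int -> K) n :
  star (c *: 'X - u%:P) a n = c * a (n + 1) - u * a n.
Proof. by rewrite -[X in star X]mulr1 star_lin !star1. Qed.

(** The contribution of a point to h is thereby a difference of two logarithms of linear factors,
    the form in which [exp_coef_log1] applies. *)
Lemma hcoef_current s i j (u : K) m :
  sign_factor q s * (hcoef i j (sgi s * m.+1%:Z) * u ^ (sgi s * m.+1%:Z)) =
  ((q ^ (sgi s * B i j) * u ^ sgi s) ^+ m.+1
    - (q ^ (- (sgi s * B i j)) * u ^ sgi s) ^+ m.+1) / m.+1%:R.
Proof.
have m0 : m.+1%:R != 0 :> K by rewrite pnatr_eq0.
have powE (b : int) : (q ^ b * u ^ sgi s) ^+ m.+1 = q ^ (m.+1%:Z * b) * u ^ (sgi s * m.+1%:Z).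
  by rewrite exprMn !exprnP !exprz_exp [b * _]mulrC.
rewrite !powE -mulrBl /hcoef /qint /sign_factor.
have -> : - (sgi s * m.+1%:Z * B i j) = m.+1%:Z * - (sgi s * B i j) by ring.
have -> : sgi s * m.+1%:Z * B i j = m.+1%:Z * (sgi s * B i j) by ring.
have -> : (sgi s * m.+1%:Z)%:~R^-1 = (sgi s)%:~R / m.+1%:R :> K.
  by case: (s) => /=; rewrite ?mul1r // mulN1r mulrNz invrN mulN1r.
have ss : (sgi s)%:~R * (sgi s)%:~R = 1 :> K.
  by case: (s) => /=; rewrite ?mulr1 // mulrNz mulrNN mulr1.
move: (q ^ _) (q ^ _) (u ^ _) => a b c; move: ss; set e := (sgi s)%:~R => ss.
rewrite (_ : e * (q - q^-1) * (e / m.+1%:R * ((b - a) / (q - q^-1)) * c) =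
   e * e * ((b - a) * c / m.+1%:R)); last first.
  by move: (m.+1%:R) m0 (q - q^-1) qq0 => M M0 d d0; field; rewrite ?M0 ?d0.
by rewrite ss mul1r.
Qed.

(** A further point multiplies phi^+ and phi^- by the two expansions of one rational factor, so with
    the denominator cleared the identity takes the same form for both signs. *)
Lemma phi_eigen_cons s i t p n : t.2 != 0 ->
  star (q ^ B i t.1 *: 'X - t.2%:P) (phi_eigen s i (t :: p)) n =
  star ('X - (q ^ B i t.1 * t.2)%:P) (phi_eigen s i p) n.
Proof.
move=> u0; rewrite -['X in RHS]scale1r !star_binomial mul1r /phi_eigen.
rewrite big_cons sign_exp_split; set k := (_ * _) ^ sgi s.
set e := fun m => _; set e' := fun m => _.
pose beta := q ^ (sgi s * B i t.1); pose z := t.2 ^ sgi s.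
have beta0 : beta != 0 by rewrite expfz_neq0.
have betaV : q ^ (- (sgi s * B i t.1)) = beta^-1 by rewrite invr_expz.
have EE m : exp_coef e m.+1 - beta^-1 * z * exp_coef e m =
    exp_coef e' m.+1 - beta * z * exp_coef e' m.
  rewrite -!exp_coef_log1; apply: exp_coef_eq => -[//|l] _.
  rewrite /e /e' big_cons opprD addrCA mulrDr mulrN hcoef_current -/beta -/z betaV.
  rewrite mulrBl; move: (sign_factor q s * _) (_ / _) (_ / _) => a b c; ring.
have step1 (x1 x0 y1 y0 u b : K) : b != 0 -> x1 - b^-1 * u * x0 = y1 - b * u * y0 ->
    b * (b^-1 * k * x1) - u * (b^-1 * k * x0) = k * y1 - b * u * (k * y0).
  move=> b0 E; transitivity (k * (x1 - b^-1 * u * x0)); first by field.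
  by rewrite E; ring.
have step2 (x1 x0 y1 y0 u b : K) : b != 0 -> u != 0 ->
    x1 - b^-1 * u^-1 * x0 = y1 - b * u^-1 * y0 ->
    b^-1 * (b^-1 * k * x0) - u * (b^-1 * k * x1) = k * y0 - b^-1 * u * (k * y1).
  move=> b0 u'0 E; transitivity (- (u * b^-1 * k) * (x1 - b^-1 * u^-1 * x0)).
    by field; rewrite b0 u'0.
  by rewrite E; field; rewrite b0 u'0.
have QE : q ^ B i t.1 = beta ^ sgi s.
  by rewrite /beta exprz_exp; case: (s) => /=; rewrite ?mul1r ?mulr1 ?mulN1r ?mulrN1 ?opprK.
have zE : z = t.2 ^ sgi s by [].
rewrite betaV QE; clear betaV QE; clearbody k e e' beta z.
(* Besides the generic modes there is a boundary mode, n = -1 for phi^+ and n = 0 for phi^-, where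
   only the constant coefficient of the exponential is left. *)
case: s zE => /= zE.
  rewrite !mul1r expr1z; case: n => [m|[|m]].
  - have -> : 0 <= m%:Z + 1 by lia.
    have -> : 0 <= m%:Z by lia.
    have -> : absz (m%:Z + 1) = m.+1 by lia.
    change (absz m%:Z) with m; move: (EE m); rewrite zE expr1z.
    exact: step1 beta0.
  - have -> : Negz 0 + 1 = 0 by [].
    have -> : 0 <= Negz 0 = false by [].
    rewrite lexx absz0 !exp_coef0 !mulr0 !subr0 !mulr1 mulrA (divff beta0).
    exact: mul1r.
  - have -> : 0 <= Negz m.+1 + 1 = false by lia.
    have -> : 0 <= Negz m.+1 = false by [].
    by rewrite !mulr0.
rewrite exprN1; case: n => [[|m]|m].
- have -> : 0 <= -1 * (0%:Z + 1) = false by [].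
  have -> : 0 <= -1 * 0%:Z by [].
  have -> : absz 0%:Z = 0%N by [].
  rewrite !exp_coef0 !mulr0 !sub0r; congr (- _); ring.
- have -> : 0 <= -1 * (m.+1%:Z + 1) = false by lia.
  have -> : 0 <= -1 * m.+1%:Z = false by lia.
  by rewrite !mulr0.
have -> : 0 <= -1 * (Negz m + 1) by lia.
have -> : 0 <= -1 * Negz m by lia.
have -> : absz (Negz m + 1) = m by lia.
have -> : absz (Negz m) = m.+1 by lia.
move: (EE m); rewrite zE exprN1; exact: step2 beta0 u0.
Qed.

End PointFunctionals.

(** * Lowering operators on psi through polynomials in one additional point *)

Section Lowering.
Variables (R : realType) (N : nat) (C : 'M[int]_N) (r : 'I_N -> nat) (q : R[i]).
Local Notation K := R[i].
Local Notation B := (symmetrized_cartan C r).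

Variables (kappa : 'I_N -> K) (eta : 'I_N -> int -> K).
Hypotheses (q0 : q != 0) (kappa0 : forall i, kappa i != 0).
Hypothesis qq0 : q - q^-1 != 0.
Hypothesis BC : forall i j, B i j = B j i.

Local Notation letter := (letter N).
Local Notation word := (word N).
Local Notation dual := (dual R N).
Local Notation phi_op := (phi_op C r q kappa eta).
Local Notation point := ('I_N * K)%type.
Local Notation zeta := (zeta (fun_of_matrix B) q).
Local Notation generic := (generic (fun_of_matrix B) q).
Local Notation remove := (remove (fun_of_matrix B) q).
Implicit Types (p : seq point) (w : word) (xi : dual).

Local Notation psi_at := (psi_at C r q).
Local Notation psi := (psi C r q).
Local Notation phi_eigen := (phi_eigen C r q kappa eta).

(* The part of x^-_{i, n} coming from phi^s. *)
Fixpoint lower_half_at s i (n : int) w xi : K :=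
  if w is y :: w' then
    lower_half_at s i n w' (raise y xi) +
      (if y.1 == i then phi_op s i (y.2 + n) xi w' else 0)
  else 0.

Lemma lower_at_half i n w xi : lower_at C r q kappa eta (i, n) w xi =
  (qdiff r q i)^-1 * (lower_half_at true i n w xi - lower_half_at false i n w xi).
Proof.
elim: w xi => [|y w IHw] xi /=; first by rewrite subrr mulr0.
rewrite IHw; case: eqP => [->|_]; last by rewrite !addr0.
rewrite /phi_diff dualZ dualB.
move: (lower_half_at _ _ _ _ _) (lower_half_at _ _ _ _ _) (phi_op _ _ _ _ _) (phi_op _ _ _ _ _) => a b c d.
ring.
Qed.

Lemma lower_half_linear s i n w a u v :
  lower_half_at s i n w (a *: u + v) =
  a * lower_half_at s i n w u + lower_half_at s i n w v.
Proof.
elim: w u v => [|y w IHw] u v /=; first by rewrite mulr0 addr0.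
rewrite raiseD raiseZ IHw; case: ifP => _; last by rewrite !addr0.
rewrite (phi_op_linear C r q kappa eta s i (y.2 + n) a u v) dualD dualZ; ring.
Qed.

Lemma lower_half_comb s i n w (J : Type) (t : seq J) (Q : pred J) (c : J -> K)
    (F : J -> dual) :
  lower_half_at s i n w (\sum_(j <- t | Q j) c j *: F j) =
  \sum_(j <- t | Q j) c j * lower_half_at s i n w (F j).
Proof.
have lh0 : lower_half_at s i n w 0 = 0.
  have := lower_half_linear s i n w (-1) 0 0.
  by rewrite scaler0 addr0 mulN1r addNr.
elim: t => [|j t IHt]; first by rewrite !big_nil.
by rewrite !big_cons; case: ifP => _; rewrite ?lower_half_linear IHt.
Qed.

Definition point_poly i p : {poly K} :=
  \prod_(t <- p) (q ^ B i t.1 *: 'X - t.2%:P).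

Lemma star_point_poly s i p n : generic p ->
  star (point_poly i p) (phi_eigen s i p) n =
  star (\prod_(t <- p) ('X - (q ^ B i t.1 * t.2)%:P)) (phi_eigen s i [::]) n.
Proof.
rewrite /point_poly; elim: p n => [|t p IHp] n; first by rewrite !big_nil.
move=> /andP[/= /andP[t0 p0] /andP[_ pp]]; rewrite !big_cons.
have consE m : star (q ^ B i t.1 *: 'X - t.2%:P) (phi_eigen s i (t :: p)) m =
    star ('X - (q ^ B i t.1 * t.2)%:P) (phi_eigen s i p) m by exact: phi_eigen_cons.
rewrite mulrC starM (star_ext _ _ consE) -!starM.
by rewrite mulrC starM [RHS]starM; apply: star_ext => m; apply: IHp; apply/andP.
Qed.

(* z^-L times the numerator of psi ((i, z) :: p) w, as a function of z. *)
Fixpoint psi_poly (l : nat) i w p : {poly K} :=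
  if w is x :: w' then
    (if x.1 == i then psi_at w' p *: ('X^`|x.2 + l%:Z| *
        \prod_(t <- p) ('X - (q ^ B i t.1 * t.2)%:P)) else 0) +
    \sum_(s <- p | s.1 == x.1)
      (s.2 ^ x.2 * \prod_(t <- drop_point s p) zeta s t) *:
        ((q ^ B i s.1 *: 'X - s.2%:P) * psi_poly l i w' (drop_point s p))
  else 0.

Lemma point_poly_drop i p s : generic p -> s \in p ->
  point_poly i p = (q ^ B i s.1 *: 'X - s.2%:P) * point_poly i (drop_point s p).
Proof.
by move=> gp sp; rewrite /point_poly (bigD1_seq s) ?(generic_uniq gp) //= big_filter.
Qed.

(** Induction on the word: the phi-term of the first letter x gives the power of exponent x.2 + l,
    nonnegative by the bound on the modes, while a point removed by x takes one factor out of
    [point_poly]. The right side depends on w and p only through [psi_poly]. *)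
Lemma psi_poly_lower s (l : nat) i w p n : generic p ->
  all (fun x : letter => - l%:Z <= x.2) w ->
  star (point_poly i p) (fun m => lower_half_at s i m w (psi p)) n =
  star (psi_poly l i w p) (phi_eigen s i [::]) (n - l%:Z).
Proof.
elim: w p n => [|x w IHw] p n gp.
  by move=> _ /=; rewrite star0 /star big1 // => j _; rewrite mulr0.
move=> /= /andP[xl wl]; rewrite star_add starD addrC; congr (_ + _).
  case: eqP => [xi|_]; last by rewrite star0 /star big1 // => j _; rewrite mulr0.
  rewrite (@star_ext _ _ _ (fun m => psi_at w p * phi_eigen s i p (x.2 + m))); last first.
    by move=> m; rewrite phi_op_psi // dualZ mulrC.
  rewrite star_scaler star_shift star_point_poly // starZ starXn.
  by congr (_ * star _ _ _); rewrite gez0_abs; lia.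
rewrite raise_psi /remove gp.
rewrite (star_ext _ _ (fun m => lower_half_comb _ _ _ _ _ _ _ _)) star_comb star_sum.
rewrite big_seq_cond [RHS]big_seq_cond; apply: eq_bigr => t /andP[tp _].
rewrite starZ (point_poly_drop i gp tp); congr (_ * _); rewrite !starM.
have gd := generic_drop_point t gp.
rewrite !star_binomial (IHw _ (n + 1) gd wl) (IHw _ n gd wl).
have -> : n + 1 - l%:Z = n - l%:Z + 1 by lia.
by [].
Qed.

(** The first letter removes either the new point (i, z) or a point s of p; in the second case
    [zeta s (i, z)] brings the pole at z = s.2 that the product cancels. *)
Lemma psi_polyE (l : nat) i w p z : generic ((i, z) :: p) ->
  all (fun x : letter => - l%:Z <= x.2) w ->
  (psi_poly l i w p).[z] =
  z ^+ l * \prod_(t <- p) (z - t.2) * psi_at w ((i, z) :: p).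
Proof.
elim: w p => [|x w IHw] p gp /=; first by rewrite horner0 mulr0.
move=> /andP[xl wl].
have z0 : z != 0 := generic_neq0 gp (mem_head _ _).
have gp' : generic p.
  have := generic_drop_point (i, z) gp; rewrite /drop_point /= eqxx.
  suff -> : [seq t <- p | t != (i, z)] = p by [].
  apply/all_filterP/allP => t tp; apply: contraTneq tp => ->.
  by have := generic_uniq gp => /= /andP[].
have dropz : drop_point (i, z) ((i, z) :: p) = p.
  rewrite /drop_point /= eqxx; apply/all_filterP/allP => t tp.
  by apply: contraTneq tp => ->; have := generic_uniq gp => /= /andP[].
have sep t : t \in p -> z != t.2.
  move=> tp; have : (i, z) != t.
    by apply: contraTneq tp => <-; have := generic_uniq gp => /= /andP[].
  by move=> /(generic_separated BC gp (mem_head _ _)); rewrite inE tp orbT => /(_ isT)/and3P[].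
have drops s : s \in p -> drop_point s ((i, z) :: p) = (i, z) :: drop_point s p.
  move=> sp; rewrite /drop_point /=; case: eqP => // e; move: sp; rewrite -e => sp.
  by have := generic_uniq gp => /= /andP[]; rewrite sp.
rewrite hornerD /remove gp big_cons dropz horner_sum /=.
have -> : (if i == x.1 then (z ^ x.2 * \prod_(t <- p) zeta (i, z) t) *: psi_at w p +
     \sum_(j <- p | j.1 == x.1) (j.2 ^ x.2 * \prod_(t <- drop_point j ((i, z) :: p)) zeta j t) *:
       psi_at w (drop_point j ((i, z) :: p))
   else \sum_(j <- p | j.1 == x.1) (j.2 ^ x.2 * \prod_(t <- drop_point j ((i, z) :: p)) zeta j t) *:
       psi_at w (drop_point j ((i, z) :: p))) =
  (if x.1 == i then z ^ x.2 * \prod_(t <- p) zeta (i, z) t * psi_at w p else 0) +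
     \sum_(j <- p | j.1 == x.1) (j.2 ^ x.2 * \prod_(t <- drop_point j ((i, z) :: p)) zeta j t) *
       psi_at w (drop_point j ((i, z) :: p)).
  by rewrite eq_sym; case: ifP => _; rewrite ?add0r.
rewrite mulrDr; congr (_ + _).
  case: eqP => [xi|_]; last by rewrite horner0 mulr0.
  rewrite hornerZ hornerM hornerXn horner_prod.
  have -> : z ^+ `|x.2 + l%:Z| = z ^+ l * z ^ x.2.
    by rewrite !exprnP -expfzDr // gez0_abs; [congr (_ ^ _)|]; lia.
  have -> : \prod_(t <- p) ('X - (q ^ B i t.1 * t.2)%:P).[z] =
      \prod_(t <- p) (z - t.2) * \prod_(t <- p) zeta (i, z) t.
    rewrite -big_split /= big_seq [RHS]big_seq; apply: eq_bigr => t tp.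
    by rewrite hornerXsubC /zeta /= [RHS]mulrC divfK // subr_eq0 sep.
  move: (\prod_(_ <- _) _) (\prod_(_ <- _) _) (psi_at _ _) => a b c; ring.
rewrite mulr_sumr big_seq_cond [RHS]big_seq_cond; apply: eq_bigr => s /andP[sp _].
have gs : generic ((i, z) :: drop_point s p) by rewrite -drops // generic_drop_point.
rewrite hornerZ hornerM drops // IHw // !hornerE big_cons /=.
have -> : \prod_(t <- p) (z - t.2) = (z - s.2) * \prod_(t <- drop_point s p) (z - t.2).
  by rewrite (bigD1_seq s) ?(generic_uniq gp') //= big_filter.
have -> : zeta s (i, z) = (q ^ B i s.1 * z - s.2) / (z - s.2).
  rewrite /zeta /= (BC s.1 i) -[LHS]mulrNN -invrN !opprB; congr (_ * _).
have zs : z - s.2 != 0 by rewrite subr_eq0 sep.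
have aux (a b c d e g h y : K) : y - h != 0 ->
    e * a * (d * y - h) * g * b * c =
    g * ((y - h) * b) * e * ((d * y - h) / (y - h) * a) * c by move=> ?; field.
exact: aux.
Qed.

End Lowering.

(** * The closure of the functionals psi and its stability *)

Section Closure.
Variables (R : realType) (N : nat) (C : 'M[int]_N) (r : 'I_N -> nat) (q : R[i]).
Local Notation K := R[i].
Local Notation B := (symmetrized_cartan C r).
Local Notation fphiz := (@fphiz R N q).

Variables (kappa : 'I_N -> K) (eta : 'I_N -> int -> K).
Hypotheses (q0 : q != 0) (kappa0 : forall i, kappa i != 0).
Hypothesis qq0 : q - q^-1 != 0.
Hypothesis BC : forall i j, B i j = B j i.

Local Notation letter := (letter N).
Local Notation word := (word N).
Local Notation dual := (dual R N).
Local Notation kop := (kop C r q kappa).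
Local Notation hop := (hop C r q eta).
Local Notation hcoef := (hcoef C r q).
Local Notation phi_op := (phi_op C r q kappa eta).
Local Notation lower := (lower C r q kappa eta).
Local Notation cartan_action := (cartan_action C r q kappa eta).
Local Notation point := ('I_N * K)%type.
Local Notation generic := (generic (fun_of_matrix B) q).
Local Notation remove := (remove (fun_of_matrix B) q).
Implicit Types (p : seq point) (w : word) (xi : dual).

Local Notation psi := (psi C r q).
Local Notation phi_eigen := (phi_eigen C r q kappa eta).

Local Notation lower_half_at := (lower_half_at C r q kappa eta).
Local Notation psi_poly := (psi_poly C r q).
Local Notation point_poly := (point_poly C r q).
Local Notation dual_action := (dual_action C r q kappa eta).
Local Notation actv := (act dual_action).

(* A finite combination of words, seen as a functional on the dual. *)
Definition ev (m : seq (K * word)) xi : K := \sum_(x <- m) x.1 * xi x.2.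

Definition null (m : seq (K * word)) : Prop :=
  forall p, generic p -> ev m (psi p) = 0.

(** The double annihilator of the psi, that is, the closure of their span in the topology of
    pointwise agreement on finitely many words. *)
Definition psi_closure xi : Prop := forall m, null m -> ev m xi = 0.

(** Continuity in that topology; it is what carries identities and stability from the psi to their
    closure. *)
Definition finite_type (f : dual -> dual) : Prop :=
  forall w, exists m, forall xi, f xi w = ev m xi.

Lemma ev_cat m1 m2 xi : ev (m1 ++ m2) xi = ev m1 xi + ev m2 xi.
Proof. exact: big_cat. Qed.

Lemma ev_linear m a u v : ev m (a *: u + v) = a * ev m u + ev m v.
Proof.
rewrite /ev mulr_sumr -big_split; apply: eq_bigr => x _.
by rewrite dualD dualZ mulrDr mulrCA.
Qed.

Lemma ev0 m : ev m 0 = 0.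
Proof. by rewrite /ev big1 // => x _; rewrite dual0 mulr0. Qed.

Lemma evZ a m xi : ev [seq (a * x.1, x.2) | x <- m] xi = a * ev m xi.
Proof. by rewrite /ev big_map mulr_sumr; apply: eq_bigr => x _; rewrite mulrA. Qed.

Lemma ev_finite_type f : finite_type f ->
  forall m, exists m', forall xi, ev m (f xi) = ev m' xi.
Proof.
move=> ff; elim=> [|x m [m' IHm]]; first by exists [::] => xi; rewrite /ev !big_nil.
have [mx mxE] := ff x.2; exists ([seq (x.1 * y.1, y.2) | y <- mx] ++ m') => xi.
by rewrite ev_cat evZ -mxE -IHm /ev big_cons.
Qed.

Lemma psi_closure_linear a u v :
  psi_closure u -> psi_closure v -> psi_closure (a *: u + v).
Proof. by move=> cu cv m nm; rewrite ev_linear cu // cv // mulr0 addr0. Qed.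

Lemma psi_closure0 : psi_closure 0.
Proof. by move=> m _; rewrite ev0. Qed.

Lemma psi_closure_psi p : generic p -> psi_closure (psi p).
Proof. by move=> gp m; apply. Qed.

Lemma psi_closure_stable f xi : finite_type f ->
  (forall p, generic p -> psi_closure (f (psi p))) ->
  psi_closure xi -> psi_closure (f xi).
Proof.
move=> ff fpsi cxi m nm; have [m' m'E] := ev_finite_type ff m.
by rewrite m'E; apply: cxi => p gp; rewrite -m'E; apply: fpsi.
Qed.

Lemma psi_closure_kill f xi : finite_type f ->
  (forall p, generic p -> f (psi p) = 0) -> psi_closure xi -> f xi = 0.
Proof.
move=> ff fpsi cxi; apply/funext => w; have [m mE] := ff w.
by rewrite mE; apply: cxi => p gp; rewrite -mE fpsi.
Qed.

Lemma finite_type_comp f g : finite_type f -> finite_type g ->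
  finite_type (fun xi => f (g xi)).
Proof.
move=> ff fg w; have [m mE] := ff w; have [m' m'E] := ev_finite_type fg m.
by exists m' => xi; rewrite mE m'E.
Qed.

Lemma finite_type_lin a f g : finite_type f -> finite_type g ->
  finite_type (fun xi => a *: f xi + g xi).
Proof.
move=> ff fg w; have [m1 E1] := ff w; have [m2 E2] := fg w.
exists ([seq (a * x.1, x.2) | x <- m1] ++ m2) => xi.
by rewrite ev_cat evZ dualD dualZ E1 E2.
Qed.

Lemma finite_type_id : finite_type id.
Proof. by move=> w; exists [:: (1, w)] => xi; rewrite /ev big_seq1 mul1r. Qed.

Lemma finite_type0 : finite_type (fun=> 0).
Proof. by move=> w; exists [::] => xi; rewrite /ev big_nil. Qed.

Lemma finite_type_act (rho : drinfeld_gen N -> dual -> dual) :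
  (forall y, linear (rho y)) -> (forall y, finite_type (rho y)) ->
  forall x, finite_type (act rho x).
Proof.
move=> rl rf; elim/free_ind => [||a x y IHx IHy|y x IHx] w.
- by exists [::] => xi; rewrite act0l /ev big_nil.
- by have [m mE] := finite_type_id w; exists m => xi; rewrite act1 mE.
- have [m mE] := finite_type_lin a IHx IHy w.
  by exists m => xi; rewrite act_linl mE.
- have [m mE] := finite_type_comp (rf y) IHx w.
  by exists m => xi; rewrite (act_genM rl) mE.
Qed.

Lemma finite_type_raise x : finite_type (raise x).
Proof. by move=> w; exists [:: (1, x :: w)] => xi; rewrite /ev big_seq1 mul1r. Qed.

Lemma finite_type_kop s i : finite_type (kop s i).
Proof.
by move=> w; exists [:: (weight_factor C r q kappa s i w, w)] => xi; rewrite /ev big_seq1.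
Qed.

Lemma ev_raise x m xi : ev m (raise x xi) = ev [seq (y.1, x :: y.2) | y <- m] xi.
Proof. by rewrite /ev big_map. Qed.

Lemma finite_type_hop i n : finite_type (hop i n).
Proof.
elim=> [|x w [m mE]].
  by exists [:: (eta i n, [::])] => xi; rewrite /ev big_seq1.
exists ((- hcoef i x.1 n, shift_letter x n :: w) :: [seq (y.1, x :: y.2) | y <- m]) => xi.
by rewrite /ev big_cons -/(ev _ _) -ev_raise -mE addrC mulNr.
Qed.

Lemma finite_type_cartan y : finite_type (cartan_action y).
Proof.
case: y => [s i n|s i|s i n|s] /=.
- exact: finite_type0.
- exact: finite_type_kop.
- exact: finite_type_hop.
- exact: finite_type_id.
Qed.

Lemma finite_type_phi_op s i n : finite_type (phi_op s i n).
Proof.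
move=> w.
have [m mE] := finite_type_act (cartan_action_linear C r q kappa eta)
   finite_type_cartan (fphiz s i n) w.
by exists m => xi; rewrite phi_opE mE.
Qed.

Lemma finite_type_phi_diff i n : finite_type (phi_diff C r q kappa eta i n).
Proof.
move=> w; have [m1 E1] := finite_type_phi_op true i n w.
have [m2 E2] := finite_type_phi_op false i n w.
exists ([seq ((qdiff r q i)^-1 * x.1, x.2) | x <- m1] ++
        [seq (- (qdiff r q i)^-1 * x.1, x.2) | x <- m2]) => xi.
by rewrite ev_cat !evZ -E1 -E2 /phi_diff dualZ dualB mulrBr mulNr.
Qed.

Lemma finite_type_lower x : finite_type (lower x).
Proof.
elim=> [|y w [m mE]]; first by exists [::] => xi; rewrite /ev big_nil.
have [m' m'E] : exists m', forall xi,
    (if y.1 == x.1 then phi_diff C r q kappa eta y.1 (y.2 + x.2) xi w else 0) = ev m' xi.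
  case: eqP => _; first exact: finite_type_phi_diff.
  by exists [::] => xi; rewrite /ev big_nil.
exists ([seq (z.1, y :: z.2) | z <- m] ++ m') => xi.
by rewrite ev_cat -ev_raise -mE -m'E.
Qed.

Lemma finite_type_dual y : finite_type (dual_action y).
Proof.
case: y => [[] i n|s i|s i n|s] /=.
- exact: finite_type_raise.
- exact: finite_type_lower.
- exact: finite_type_kop.
- exact: finite_type_hop.
- exact: finite_type_id.
Qed.

(** The lower bound on the modes makes [psi_poly] usable for all the words at once. One-sided
    vanishing of the sequences uses the upper bound for phi^+ and the lower one for phi^-. *)
Lemma modes_bounded (m : seq (K * word)) : exists l : nat,
  forall x, x \in m -> all (fun y : letter => - l%:Z <= y.2 <= l%:Z) x.2.
Proof.
elim: m => [|x m [l lP]]; first by exists 0%N.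
have [k kP] : exists k : nat, all (fun y : letter => - k%:Z <= y.2 <= k%:Z) x.2.
  elim: x.2 => [|y w [k kP]]; first by exists 0%N.
  exists (maxn k `|y.2|%N); rewrite /= {1 2}/maxn; apply/andP; split.
    by case: ltnP; lia.
  by apply: sub_all kP => z; rewrite /maxn; case: ltnP; lia.
exists (maxn k l) => z; rewrite inE => /predU1P[->|/lP]; last first.
  by apply: sub_all => y; rewrite /maxn; case: ltnP; lia.
by apply: sub_all kP => y; rewrite /maxn; case: ltnP; lia.
Qed.

Lemma phi_eigen_eq0 s i p n : sgi s * n < 0 -> phi_eigen s i p n = 0.
Proof. by rewrite /phi_eigen ltNge => /negPf ->. Qed.

Lemma lower_half_eq0 s i n w p : generic p ->
  all (fun y : letter => sgi s * (y.2 + n) < 0) w ->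
  lower_half_at s i n w (psi p) = 0.
Proof.
elim: w p => [//|y w IHw] p gp /= /andP[yn wn].
rewrite phi_op_psi // phi_eigen_eq0 // scale0r dual0 if_same addr0 raise_psi /remove gp.
rewrite lower_half_comb big1 // => t _.
by rewrite IHw ?mulr0 // generic_drop_point.
Qed.

Lemma generic_cons i z p : generic p -> z != 0 ->
  all (fun t => separated (fun_of_matrix B) q (i, z) t) p -> generic ((i, z) :: p).
Proof. by move=> /andP[p0 pp] z0 sep; rewrite /generic /= z0 p0 sep. Qed.

(** The combination m yields a polynomial P in the coordinate z of an additional point. Since m is
    null, P vanishes at every z that keeps the configuration generic, hence P = 0. By
    [psi_poly_lower] the sequence in question is then killed by [point_poly], which is injective on
    it. *)
Lemma lower_half_null s i n m p : generic p -> null m ->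
  \sum_(x <- m) x.1 * lower_half_at s i n x.2 (psi p) = 0.
Proof.
move=> gp nm; have [l lP] := modes_bounded m.
pose P := \sum_(x <- m) x.1 *: psi_poly l i x.2 p.
(* The roots of [bad] are the z for which (i, z) :: p fails to be generic. *)
pose bad : {poly K} := 'X * \prod_(t <- p) (('X - t.2%:P) *
   (('X - (q ^ B i t.1 * t.2)%:P) * ('X - (t.2 / q ^ B i t.1)%:P))).
have bad0 : bad != 0.
  rewrite mulf_neq0 ?polyX_eq0 // prodf_seq_neq0; apply/allP => t _ /=.
  by rewrite !mulf_neq0 ?polyXsubC_eq0.
have P0 : P = 0.
  suff: P * bad = 0 by move/eqP; rewrite mulf_eq0 (negPf bad0) orbF => /eqP.
  apply: poly_eq0_horner => z; rewrite hornerM.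
  case: (eqVneq bad.[z] 0) => [->|bz]; first by rewrite mulr0.
  have gz : generic ((i, z) :: p).
    move: bz; rewrite /bad hornerM hornerX mulf_eq0 negb_or => /andP[z0].
    rewrite horner_prod prodf_seq_neq0 => /allP bz; apply: generic_cons => //.
    apply/allP => t tp; have := bz t tp; rewrite /= !hornerE !mulf_eq0 !negb_or.
    rewrite !subr_eq0 => /andP[/andP[h1 h2] h3]; rewrite /separated h1 h2 /=.
    apply: contraNneq h3 => ->.
    by rewrite (mulrC (q ^ _)) mulfK // expfz_neq0.
  rewrite /P horner_sum.
  have -> : \sum_(x <- m) (x.1 *: psi_poly l i x.2 p).[z] =
      z ^+ l * \prod_(t <- p) (z - t.2) * ev m (psi ((i, z) :: p)).
    rewrite /ev mulr_sumr big_seq [RHS]big_seq; apply: eq_bigr => x xm.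
    rewrite hornerZ psi_polyE //; first by rewrite mulrCA.
    by apply: sub_all (lP x xm) => y /andP[].
  by rewrite (nm _ gz) mulr0 mul0r.
pose a n := \sum_(x <- m) x.1 * lower_half_at s i n x.2 (psi p).
apply: (@star_prod_inj _ s _ p (fun t => q ^ B i t.1) (fun t => t.2) a) => {n}.
- by move=> t; rewrite expfz_neq0.
- by case/andP: gp.
- exists (- l%:Z) => n nl; rewrite /a big_seq big1 // => x xm.
  rewrite lower_half_eq0 ?mulr0 //; apply: sub_all (lP x xm) => y.
  by case: (s) nl => /=; lia.
move=> n; rewrite -/(point_poly i p) /a star_comb.
transitivity (star P (phi_eigen s i [::]) (n - l%:Z)); last by rewrite P0 star0.
rewrite star_sum big_seq [RHS]big_seq; apply: eq_bigr => x xm.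
rewrite starZ; congr (_ * _); apply: psi_poly_lower => //.
by apply: sub_all (lP x xm) => y /andP[].
Qed.

Lemma lower_psi_closure x p : generic p -> psi_closure (lower x (psi p)).
Proof.
case: x => i n gp m nm; rewrite /ev.
under eq_bigr do rewrite /lower lower_at_half mulrCA.
rewrite -mulr_sumr; under eq_bigr do rewrite mulrBr.
by rewrite sumrB !lower_half_null // subrr mulr0.
Qed.

Lemma actv_psi_closure x xi : psi_closure xi -> psi_closure (actv x xi).
Proof.
have sumc (J : Type) (t : seq J) (Q : pred J) (c : J -> K) (F : J -> dual) :
    (forall j, Q j -> psi_closure (F j)) -> psi_closure (\sum_(j <- t | Q j) c j *: F j).
  move=> cF; elim: t => [|j t IHt]; first by rewrite big_nil; apply: psi_closure0.
  by rewrite big_cons; case: ifP => // Qj; apply: psi_closure_linear => //; apply: cF.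
have scal a u : psi_closure u -> psi_closure (a *: u).
  by move=> cu; rewrite -[_ *: _]addr0; apply: psi_closure_linear => //; apply: psi_closure0.
have gens y u : psi_closure u -> psi_closure (dual_action y u).
  apply: psi_closure_stable; first exact: finite_type_dual.
  move=> p gp; case: y => [[] i n|s i|s i n|s] /=.
  - rewrite raise_psi /remove gp; apply: sumc => t _; apply: psi_closure_psi.
    exact: generic_drop_point.
  - exact: lower_psi_closure.
  - by rewrite kop_psi //; apply/scal/psi_closure_psi.
  - by rewrite hop_psi //; apply/scal/psi_closure_psi.
  - exact: psi_closure_psi.
elim/free_ind: x xi => [xi _|xi|a x y IHx IHy xi cxi|y x IHx xi cxi].
- by rewrite act0l; apply: psi_closure0.
- by rewrite act1.
- by rewrite act_linl; apply: psi_closure_linear; [apply: IHx|apply: IHy].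
- by rewrite (act_genM (dual_action_linear C r q kappa eta)); apply/gens/IHx.
Qed.

Definition vac : dual := fun w => (w == [::])%:R.

Lemma vacE : vac = psi [::].
Proof.
apply/funext => -[|x w]; first by [].
by rewrite /psi /= /remove /= big_nil.
Qed.

Lemma vac_closure : psi_closure vac.
Proof. by rewrite vacE; apply: psi_closure_psi. Qed.

End Closure.

(** * Polarization of a symmetrized noncommutative product *)

Section Polarization.
Variables (A : nzRingType) (d l : nat) (x : 'I_d -> A) (m : A).
Hypothesis ld : (l <= d)%N.

Let marked (f : 'I_d -> 'I_d) : A :=
  \prod_(a < d | (a < l)%N) x (f a) * m * \prod_(a < d | (l <= a)%N) x (f a).

(** Toggling an element outside T is a sign-reversing involution on the supersets of T. *)
Lemma alternating_supersets (T : {set 'I_d}) :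
  \sum_(S : {set 'I_d} | T \subset S) (-1) ^+ #|~: S| = (T == [set: 'I_d]%SET)%:R :> int.
Proof.
case: eqP => [->|/eqP nT].
  rewrite (big_pred1 [set: 'I_d]%SET) => [|S]; first by rewrite finset.setCT cards0 expr0.
  by rewrite finset.subTset.
have [a aT] : exists a, a \notin T.
  apply/existsP; rewrite -negb_forall; apply: contra nT => /forallP h.
  by apply/eqP/setP => b; rewrite inE h.
pose flip (S : {set 'I_d}) := if a \in S then S :\ a else a |: S.
have flipK : involutive flip.
  move=> S; rewrite /flip; case: (boolP (a \in S)) => aS.
    by rewrite finset.setD11 finset.setD1K.
  by rewrite finset.setU11 finset.setU1K.
have : forall z : int, z = - z -> z = 0 by move=> z; lia.
apply; rewrite -sumrN [LHS](reindex_inj (inv_inj flipK)) /=; apply: eq_big => S.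
  rewrite /flip; case: ifP => aS; first by rewrite subsetD1 aT andbT.
  by rewrite -finset.subDset (finset.setDidPl _) // disjoint_sym disjoints1.
move=> _; rewrite /flip; case: (boolP (a \in S)) => aS.
  by rewrite finset.setCD finset.setUC cardsU1 inE aS exprS mulN1r.
by rewrite [in RHS](cardsD1 a) inE aS add1n exprS mulN1r opprK finset.setCU finset.setIC -finset.setDE.
Qed.

Let widenl k (g : nat -> A) :
  \prod_(0 <= n < d | (k <= n)%N) g n = \prod_(k <= n < d) g n.
Proof. by rewrite [RHS](big_nat_widenl k 0). Qed.

(* Absorbing m into the factor preceding it makes the product amenable to
   distributivity. *)
Lemma marked_prod (h : 'I_d -> A) :
  \prod_(a < d | (a < l)%N) h a * m * \prod_(a < d | (l <= a)%N) h a =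
  (if l == 0%N then m else 1) *
    \prod_(a < d) (h a * (if a.+1 == l then m else 1)).
Proof.
pose g n := if insub n is Some a then h a else 1.
have gE (a : 'I_d) : h a = g a by rewrite /g valK.
under eq_bigr do rewrite gE; under [X in _ * X]eq_bigr do rewrite gE.
under [in RHS]eq_bigr do rewrite gE.
rewrite -(big_mkord (fun n => n < l)%N g) -(big_mkord (fun n => l <= n)%N g).
rewrite -(big_mkord xpredT (fun n => g n * (if n.+1 == l then m else 1))).
rewrite -(big_nat_widen 0 _ _ xpredT) // widenl //.
case: l ld => [|k] kd.
  rewrite big_geq // mul1r; congr (_ * _).
  by apply: eq_bigr => n _; rewrite mulr1.
rewrite mul1r [RHS](big_cat_nat (n := k.+1)) // [in LHS]big_nat_recr //.
rewrite [in RHS]big_nat_recr //= eqxx mulrA; congr (_ * _ * _).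
  congr (_ * _); rewrite big_nat [RHS]big_nat.
  by apply: eq_bigr => n nk; rewrite eqSS (ltn_eqF nk) mulr1.
rewrite big_nat [RHS]big_nat; apply: eq_bigr => n /andP[kn _].
by rewrite eqSS gtn_eqF ?mulr1.
Qed.

Lemma marked_sum (S : {set 'I_d}) :
  (\sum_(b in S) x b) ^+ l * m * (\sum_(b in S) x b) ^+ (d - l) =
  \sum_(f : {ffun 'I_d -> 'I_d} | f \in ffun_on (mem S)) marked f.
Proof.
rewrite (eq_bigr (fun f : {ffun 'I_d -> 'I_d} => (if l == 0%N then m else 1) *
  \prod_(a < d) (x (f a) * (if a.+1 == l then m else 1)))); last first.
  by move=> f _; rewrite -(marked_prod (fun a => x (f a))).
rewrite -mulr_sumr -(bigA_distr_big (mem S) (fun (a : 'I_d) j => x j * (if a.+1 == l then m else 1))) /=.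
rewrite [X in _ = _ * X](eq_bigr (fun a : 'I_d =>
  (\sum_(b in S) x b) * (if a.+1 == l then m else 1))); last first.
  by move=> a _; rewrite mulr_suml.
rewrite -marked_prod; set y := \sum_(b in S) x b.
rewrite -(big_mkord (fun n => n < l)%N (fun=> y)) -(big_mkord (fun n => l <= n)%N (fun=> y)).
rewrite -(big_nat_widen 0 _ _ xpredT) // widenl //.
by rewrite !prodr_const_nat subn0.
Qed.

(** Expanding the powers gives all maps into S; inclusion-exclusion over S keeps those with full
    image, the permutations. The symmetrized Serre relation is thus reduced to powers of a single
    sum of generators. *)
Lemma polarization :
  \sum_(p : 'S_d) \prod_(a < d | (a < l)%N) x (p a) * m
      * \prod_(a < d | (l <= a)%N) x (p a) =
  \sum_(S : {set 'I_d}) (-1) ^+ #|~: S| *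
     ((\sum_(b in S) x b) ^+ l * m * (\sum_(b in S) x b) ^+ (d - l)).
Proof.
under [RHS]eq_bigr do rewrite marked_sum mulr_sumr.
rewrite (exchange_big_dep xpredT) //=.
rewrite (eq_bigr (fun f : {ffun 'I_d -> 'I_d} =>
   if injectiveb f then marked f else 0)); last first.
  move=> f _; pose T := [set f a | a in 'I_d].
  rewrite (eq_bigl (fun S : {set 'I_d} => T \subset S)); last first.
    move=> S; apply/ffun_onP/fintype.subsetP => [h b /imsetP[a _ ->]|h a]; first exact: h.
    by apply: h; rewrite imset_f.
  have -> : \sum_(S : {set 'I_d} | T \subset S) (-1) ^+ #|~: S| * marked f =
      (\sum_(S : {set 'I_d} | T \subset S) (-1) ^+ #|~: S| : int)%:~R * marked f.
    rewrite rmorph_sum mulr_suml; apply: eq_bigr => S _.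
    by rewrite rmorphXn /= rmorphN1.
  rewrite alternating_supersets.
  have -> : (T == [set: 'I_d]%SET) = injectiveb f.
    apply/eqP/injectiveP => [TT|inj_f].
      have /imset_injP inj_f : #|T| == #|'I_d| by rewrite TT cardsT.
      by move=> a b; apply: inj_f.
    by apply/eqP; rewrite eqEcard finset.subsetT cardsT (card_imset _ inj_f) leqnn.
  by case: (injectiveb f); rewrite ?mul1r ?mul0r.
rewrite -big_mkcond /= (reindex_onto (fun p : 'S_d => pval p) (insubd (1%g : 'S_d))) /=.
  apply: eq_big => [p|p _]; last first.
    by rewrite /marked; congr (_ * _ * _); apply: eq_bigr => a _; rewrite pvalE.
  by rewrite valKd eqxx andbT (valP p).
by move=> f inj_f; rewrite insubdK.
Qed.

End Polarization.

(** * The defining relations on the submodule generated by the vacuum *)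

Section Relations.
Variables (R : realType) (N : nat) (C : 'M[int]_N) (r : 'I_N -> nat) (q : R[i]).
Local Notation K := R[i].
Local Notation FA := (free_alg K (drinfeld_gen N)).
Local Notation B := (symmetrized_cartan C r).
Local Notation qi := (qi r q).
Local Notation fx := (@fx R N).
Local Notation fc := (@fc R N).
Local Notation fphiz := (@fphiz R N q).

Variables (kappa : 'I_N -> K) (eta : 'I_N -> int -> K).
Hypotheses (q0 : q != 0) (kappa0 : forall i, kappa i != 0).
Hypothesis qq0 : q - q^-1 != 0.
Hypothesis BC : forall i j, B i j = B j i.
Hypothesis qint0 : forall i n, qint (qi i) n.+1 != 0.
Hypotheses (Cdiag : forall i, C i i = 2) (Coff : forall i j, i != j -> C i j <= 0).

Local Notation word := (word N).
Local Notation dual := (dual R N).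
Local Notation kop := (kop C r q kappa).
Local Notation hop := (hop C r q eta).
Local Notation hcoef := (hcoef C r q).
Local Notation phi_op := (phi_op C r q kappa eta).
Local Notation phi_diff := (phi_diff C r q kappa eta).
Local Notation lower := (lower C r q kappa eta).
Local Notation cartan_action := (cartan_action C r q kappa eta).
Local Notation point := ('I_N * K)%type.
Local Notation remove := (remove (fun_of_matrix B) q).
Local Notation psi := (psi C r q).
Local Notation dual_action := (dual_action C r q kappa eta).
Local Notation act0 := (act cartan_action).
Local Notation actv := (act dual_action).
Local Notation psi_closure := (psi_closure C r q).
Local Notation vac := (@vac R N).
Implicit Types (p : seq point) (w : word) (xi : dual).

Let lin := dual_action_linear C r q kappa eta.

Definition serre_rel s (i j : 'I_N) d (n : 'I_d -> int) m : FA :=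
  \sum_(p : 'S_d) \sum_(l < d.+1) ((-1) ^+ l * qbinom (qi i) d l) *:
    (\prod_(a < d | (a < l)%N) fx s i (n (p a)) * fx s j m
             * \prod_(a < d | (l <= a)%N) fx s i (n (p a))).

Definition fx_sum s (i : 'I_N) d (n : 'I_d -> int) (S : {set 'I_d}) : FA :=
  \sum_(b in S) fx s i (n b).

Lemma serre_polarized s i j d (n : 'I_d -> int) m :
  serre_rel s i j n m = \sum_(S : {set 'I_d}) (-1) ^+ #|~: S| *
    \sum_(l < d.+1) ((-1) ^+ l * qbinom (qi i) d l) *:
      (fx_sum s i n S ^+ l * fx s j m * fx_sum s i n S ^+ (d - l)).
Proof.
rewrite /serre_rel exchange_big /=; under [RHS]eq_bigr do rewrite mulr_sumr.
rewrite [RHS]exchange_big /=; apply: eq_bigr => l _.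
rewrite -scaler_sumr (polarization (fun a => fx s i (n a)) (fx s j m) (leq_ord l)) scaler_sumr.
by apply: eq_bigr => S _; rewrite -scalerAr.
Qed.

Lemma actv_fc_fphiz k s i n xi : actv (fc k * fphiz s i n) xi = phi_op s i n xi.
Proof.
have fcE := actv_fc C r q kappa eta k; have fE := actv_fphiz C r q kappa eta s i n xi.
by rewrite (actM lin) fcE fE.
Qed.

Lemma actv_cartan_rel x y xi : drinfeld_rel C r q x y ->
  (exists s i j n m, x = fx s i (n + 1) * fx s j m
                    - q ^ (sgi s * B i j) *: (fx s j m * fx s i (n + 1)) /\
     y = q ^ (sgi s * B i j) *: (fx s i n * fx s j (m + 1))
                    - fx s j (m + 1) * fx s i n) \/
  (exists s i j d (n : 'I_d -> int) m,
     [/\ i != j, d%:Z = 1 - C i j, x = serre_rel s i j n m & y = 0]) \/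
  actv x xi = actv y xi.
Proof.
case=> [s|s z|s i|i j|i j n n0|s i j n|s i j n m n0|s i j n m|i j n m n0 m0
       |i j n m|s i j d n m ij dE].
- by right; right; rewrite (actM lin) !(act_gen lin) act1.
- by right; right; rewrite !(actM lin) !(act_gen lin).
- by right; right; rewrite (actM lin) !actv_fk kopK // act1.
- by right; right; rewrite !(actM lin) !actv_fk kopC.
- by right; right; rewrite !(actM lin) !actv_fk !actv_fh // kop_hop.
- right; right; rewrite actZl !(actM lin) !actv_fk !actv_fx.
  case: s.
    rewrite raise_kop // /= mulN1r opprK mul1r.
    have [kZ _ _ _] := linear_combs (kop_linear C r q kappa true i).
    by rewrite kZ (kopK C r q0 kappa0 true) // actv_fx.
  by rewrite kop_lower // /= mul1r mulN1r (kopK C r q0 kappa0 true) ?actv_fx.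
- right; right; rewrite actZl actBl !(actM lin) actv_fc !actv_fx !actv_fh //.
  case: s; rewrite ?actv_fx /=.
    by rewrite raise_hop opprB addrC subrK /shift_letter /= (addrC m) mulr1z mul1r.
  by rewrite hop_lower // /hcoef /shift_letter /= (addrC m) mulrN1z mulN1r.
- by left; exists s, i, j, n, m.
- right; right; rewrite actBl !(actM lin) !actv_fh // hopC subrr.
  by case: ifP => _; rewrite ?act0l // actZl actBl !actv_fc subrr scaler0.
- right; right; rewrite actBl !(actM lin) !actv_fx raise_lower /= addrC addKr.
  case: ifP => _; last by rewrite act0l.
  rewrite actZl.
  rewrite actBl.
  by congr (_ *: (_ - _)); apply/esym; apply: actv_fc_fphiz.
- by right; left; exists s, i, j, d, n, m.
Qed.

Definition raise_sum (i : 'I_N) d (n : 'I_d -> int) (S : {set 'I_d}) xi : dual :=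
  \sum_(b in S) raise (i, n b) xi.

Lemma raise_remove x i f (X : seq point -> dual) p :
  raise x (remove i f X p) = remove i f (fun p' => raise x (X p')) p.
Proof.
rewrite /remove; case: ifP => // _.
have h (J : Type) (t : seq J) (Q : pred J) (F : J -> dual) :
    raise x (\sum_(k <- t | Q k) F k) = \sum_(k <- t | Q k) raise x (F k).
  by elim: t => [|k t IHt]; rewrite ?big_nil // !big_cons; case: ifP => _; rewrite ?raiseD ?IHt.
by rewrite h; apply: eq_bigr => t _; rewrite raiseZ.
Qed.

Lemma raise_sum_remove i' d (n : 'I_d -> int) S i f (X : seq point -> dual) p :
  raise_sum i' n S (remove i f X p) = remove i f (fun p' => raise_sum i' n S (X p')) p.
Proof.
rewrite /raise_sum; under eq_bigr do rewrite raise_remove.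
rewrite /remove; case: ifP => [_|_]; last by rewrite big1.
rewrite exchange_big /=; apply: eq_bigr => t _.
by rewrite scaler_sumr.
Qed.

Lemma raise_sum_psi i d (n : 'I_d -> int) S p :
  raise_sum i n S (psi p) = remove i (fun z => \sum_(b in S) z ^ n b) psi p.
Proof.
rewrite /raise_sum; under eq_bigr do rewrite raise_psi.
have := remove_comb (fun_of_matrix B) q (index_enum 'I_d) (fun b => (b \in S)%:R)
  (fun b (z : K) => z ^ n b) i psi p.
rewrite (_ : (fun z : K => _) = (fun z => \sum_(b in S) z ^ n b)); last first.
  apply/funext => z; rewrite [RHS]big_mkcond; apply: eq_bigr => b _.
  by case: (b \in S); rewrite ?mul1r ?mul0r.
move=> ->; rewrite [LHS]big_mkcond; apply: eq_bigr => b _.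
by case: (b \in S); rewrite ?scale1r ?scale0r.
Qed.

Lemma iter_raise_sum_remove k i' d (n : 'I_d -> int) S i f (X : seq point -> dual) p :
  iter k (raise_sum i' n S) (remove i f X p) =
  remove i f (fun p' => iter k (raise_sum i' n S) (X p')) p.
Proof. by elim: k X => [|k IHk] X //; rewrite iterSr raise_sum_remove IHk; under [in RHS]eq_fun do rewrite iterSr. Qed.

Lemma iter_raise_sum_iter_remove k i' d (n : 'I_d -> int) S l i f (X : seq point -> dual) p :
  iter k (raise_sum i' n S) (iter l (remove i f) X p) =
  iter l (remove i f) (fun p' => iter k (raise_sum i' n S) (X p')) p.
Proof.
elim: l X p => [|l IHl] X p //; rewrite iterS iter_raise_sum_remove.
by rewrite (_ : (fun p' => _) = iter l (remove i f) (fun p' => iter k (raise_sum i' n S) (X p')));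
  [|apply/funext => p'; rewrite IHl].
Qed.

Lemma iter_raise_sum_psi k i d (n : 'I_d -> int) S p :
  iter k (raise_sum i n S) (psi p) =
  iter k (remove i (fun z => \sum_(b in S) z ^ n b)) psi p.
Proof.
elim: k p => [|k IHk] p //; rewrite iterSr raise_sum_psi iter_raise_sum_remove.
rewrite (_ : (fun p' => _) = iter k (remove i (fun z => \sum_(b in S) z ^ n b)) psi) //.
by apply/funext => p'; rewrite IHk.
Qed.

(** Each raising operator passes inside the removals already produced, so the order is reversed: l
    raisings on the outside become l removals on the inside. *)
Lemma serre_psi i j d (n : 'I_d -> int) S m p : i != j -> d%:Z = 1 - C i j ->
  \sum_(l < d.+1) ((-1) ^+ l * qbinom (qi i) d l) *:
    iter l (raise_sum i n S) (raise (j, m) (iter (d - l) (raise_sum i n S) (psi p))) = 0.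
Proof.
move=> ij dE; set f := fun z : K => \sum_(b in S) z ^ n b.
transitivity ((\sum_(l < d.+1) ((-1) ^+ l * qbinom (qi i) d l) *:
  iter (d - l) (remove i f) (remove j (fun z => z ^ m) (iter l (remove i f) psi))) p).
  rewrite fun_sum; apply: eq_bigr => l _; rewrite funZ; congr (_ *: _).
  rewrite iter_raise_sum_psi -/f.
  have -> : raise (j, m) (iter (d - l) (remove i f) psi p) =
      iter (d - l) (remove i f) (fun p' => raise (j, m) (psi p')) p.
    elim: (d - l)%N p => [|k IHk] p //; rewrite iterS raise_remove.
    rewrite (_ : (fun p' => _) = iter k (remove i f) (fun p' => raise (j, m) (psi p'))) //.
    by apply/funext => p'; rewrite IHk.
  rewrite iter_raise_sum_iter_remove; congr (iter _ _ _ p); apply/funext => p'.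
  rewrite raise_psi iter_raise_sum_remove; congr (remove _ _ _ p').
  by apply/funext => p''; rewrite iter_raise_sum_psi.
rewrite (remove_serre BC f _ psi ij _ (qint0 i)) //.
- exact: expf_neq0.
- by have := Coff ij; lia.
- by rewrite mxE Cdiag /Defs.qi -exprM exprnP PoszM.
- rewrite mxE /Defs.qi -exprVn -exprM exprVn; have := Coff ij => ?.
  have -> : (r i)%:Z * C i j = - (r i * d.-1)%N%:Z by nia.
  by rewrite -exprnN.
Qed.

Lemma finite_type_sum (J : Type) (t : seq J) (Q : pred J) (c : J -> K)
    (F : J -> dual -> dual) : (forall j, finite_type (F j)) ->
  finite_type (fun xi => \sum_(j <- t | Q j) c j *: F j xi).
Proof.
move=> FF; elim: t => [|j t IHt].
  by move=> w; exists [::] => xi; rewrite big_nil /ev big_nil.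
case Qj : (Q j); last first.
  by move=> w; have [m mE] := IHt w; exists m => xi; rewrite big_cons Qj.
by move=> w; have [m mE] := finite_type_lin (c j) (FF j) IHt w; exists m => xi;
  rewrite big_cons Qj.
Qed.

Lemma finite_type_iter k f : finite_type f -> finite_type (iter k f : dual -> dual).
Proof.
move=> ff; elim: k => [|k IHk]; first exact: finite_type_id.
exact: finite_type_comp ff IHk.
Qed.

Lemma finite_type_raise_sum i d (n : 'I_d -> int) S : finite_type (raise_sum i n S).
Proof.
move=> w; have [m mE] := finite_type_sum (index_enum 'I_d) (mem S) (fun=> 1)
   (fun b => @finite_type_raise R N (i, n b)) w.
by exists m => xi; rewrite -mE /raise_sum; under [in RHS]eq_bigr do rewrite scale1r.
Qed.

Lemma serre_closure i j d (n : 'I_d -> int) S m xi : i != j -> d%:Z = 1 - C i j ->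
  psi_closure xi ->
  \sum_(l < d.+1) ((-1) ^+ l * qbinom (qi i) d l) *:
    iter l (raise_sum i n S) (raise (j, m) (iter (d - l) (raise_sum i n S) xi)) = 0.
Proof.
move=> ij dE; apply: (psi_closure_kill (f := fun xi => \sum_(l < d.+1)
   ((-1) ^+ l * qbinom (qi i) d l) *:
    iter l (raise_sum i n S) (raise (j, m) (iter (d - l) (raise_sum i n S) xi)))).
  apply: finite_type_sum => l; apply: finite_type_comp.
    exact/finite_type_iter/finite_type_raise_sum.
  apply: finite_type_comp; first exact: finite_type_raise.
  exact/finite_type_iter/finite_type_raise_sum.
by move=> p _; apply: serre_psi.
Qed.

Lemma exchange_closure i j n m xi : psi_closure xi ->
  raise (i, n + 1) (raise (j, m) xi) - q ^ B i j *: raise (j, m) (raise (i, n + 1) xi) =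
  q ^ B i j *: raise (i, n) (raise (j, m + 1) xi) - raise (j, m + 1) (raise (i, n) xi).
Proof.
move=> cxi; apply/eqP; rewrite -subr_eq0; apply/eqP; move: cxi.
pose f xi := - q ^ B i j *: raise (j, m) (raise (i, n + 1) xi) +
   (1 *: raise (i, n + 1) (raise (j, m) xi) +
   (- q ^ B i j *: raise (i, n) (raise (j, m + 1) xi) +
     raise (j, m + 1) (raise (i, n) xi))).
have fE u : raise (i, n + 1) (raise (j, m) u) - q ^ B i j *: raise (j, m) (raise (i, n + 1) u)
   - (q ^ B i j *: raise (i, n) (raise (j, m + 1) u) - raise (j, m + 1) (raise (i, n) u)) = f u.
  by rewrite /f scale1r !scaleNr opprB [RHS]addrA; congr (_ + _); apply: addrC.
rewrite fE; apply: (@psi_closure_kill _ _ C r q f).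
  have rr x y : finite_type (fun u : dual => raise x (raise y u)).
    by apply: finite_type_comp; apply: finite_type_raise.
  by do 3 (apply: finite_type_lin; first exact: rr).
move=> p gp; rewrite -fE !raise_psi !raise_remove.
rewrite !(_ : forall x, (fun p' => raise x (psi p')) = remove x.1 (fun z => z ^ x.2) psi);
  try by move=> x; apply/funext => p'; rewrite raise_psi.
by rewrite /= (remove_exchange BC) // subrr.
Qed.

Lemma actv_fx_sum s i d (n : 'I_d -> int) S xi : actv (fx_sum s i n S) xi =
  \sum_(b in S) if s then raise (i, n b) xi else lower (i, n b) xi.
Proof. by rewrite act_suml; apply: eq_bigr => b _; rewrite actv_fx. Qed.

Lemma actv_serre s i j d (n : 'I_d -> int) m xi :
  (forall S, \sum_(l < d.+1) ((-1) ^+ l * qbinom (qi i) d l) *: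
    iter l (actv (fx_sum s i n S)) (actv (fx s j m)
       (iter (d - l) (actv (fx_sum s i n S)) xi)) = 0) ->
  actv (serre_rel s i j n m) xi = 0.
Proof.
move=> h; rewrite serre_polarized act_suml big1 // => S _.
rewrite (actM lin); have [_ _ _ a0] := linear_combs (act_linr lin ((-1) ^+ #|~: S|)).
rewrite act_suml (eq_bigr (fun l : 'I_d.+1 => ((-1) ^+ l * qbinom (qi i) d l) *:
    iter l (actv (fx_sum s i n S)) (actv (fx s j m)
       (iter (d - l) (actv (fx_sum s i n S)) xi)))); last first.
  by move=> l _; rewrite actZl !(actM lin) !(act_exp lin).
by rewrite h a0.
Qed.

Lemma actv_serre_raise i j d (n : 'I_d -> int) m xi : i != j -> d%:Z = 1 - C i j ->
  psi_closure xi -> actv (serre_rel true i j n m) xi = 0.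
Proof.
move=> ij dE cxi; apply: actv_serre => S; rewrite -[RHS](serre_closure n S m ij dE cxi).
have E : actv (fx_sum true i n S) = raise_sum i n S.
  by apply/funext => u; rewrite actv_fx_sum.
by apply: eq_bigr => l _; rewrite E actv_fx.
Qed.

Lemma actv_exchange_raise i j n m xi : psi_closure xi ->
  actv (fx true i (n + 1) * fx true j m
           - q ^ (sgi true * B i j) *: (fx true j m * fx true i (n + 1))) xi =
  actv (q ^ (sgi true * B i j) *: (fx true i n * fx true j (m + 1))
            - fx true j (m + 1) * fx true i n) xi.
Proof.
move=> cxi; rewrite !actBl !actZl !(actM lin) !actv_fx /= mul1r.
exact: exchange_closure.
Qed.

Fixpoint lower_word w : dual :=
  if w is x :: w' then lower x (lower_word w') else vac.

(* xi is represented by a linear form l when xi w = l (lower_word w); then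
   x^-_{i, n} xi is represented by the composite of l with x^+_{i, n}, and
   conversely: the relations among the lowering operators on represented
   vectors are the transposes of those among the raising ones. *)
Definition represent (l : dual -> K^o) : dual := fun w => l (lower_word w).

Lemma kop_lower_word s i w :
  kop s i (lower_word w) = weight_factor C r q kappa s i w *: lower_word w.
Proof.
elim: w => [|x w IHw] /=.
  have E := @kop_psi _ _ C r q kappa q0 s i [::] isT.
  by rewrite big_nil in E; rewrite (vacE C r q) E /weight_factor big_nil.
have [lZ _ _ _] := linear_combs (lower_linear C r q kappa eta x).
by rewrite kop_lower // IHw lZ scalerA weight_factor_cons.
Qed.

Lemma linear_formP (l : dual -> K^o) : linear l ->
  [/\ forall a u, l (a *: u) = a * l u, forall u v, l (u + v) = l u + l v,
      forall u v, l (u - v) = l u - l v & l 0 = 0].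
Proof.
move=> fl; pose ml := GRing.isLinear.Build K dual K^o _ l fl.
pose g : {linear dual -> K^o} := HB.pack l ml.
split=> [a u|u v|u v|]; [exact: (linearZ_LR g)|exact: (linearD g)|
  exact: (linearB g)|exact: (linear0 g)].
Qed.

Lemma linear_comp (l : dual -> K^o) f : linear l -> linear f -> linear (fun xi => l (f xi) : K^o).
Proof. by move=> ll fl a u v; rewrite fl ll. Qed.

Lemma represent_raise l x : raise x (represent l) = represent (fun xi => l (lower x xi)).
Proof. by []. Qed.

Lemma represent_kop l s i : linear l ->
  kop s i (represent l) = represent (fun xi => l (kop s i xi)).
Proof.
move=> /linear_formP[lZ _ _ _]; apply/funext => w.
by rewrite /represent /kop -lZ -kop_lower_word.
Qed.

Lemma represent_hop l i n : linear l ->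
  hop i n (represent l) = represent (fun xi => l (hop i n xi)).
Proof.
move=> ll; apply/funext => w; rewrite /represent.
elim: w l ll => [|x w IHw] l ll; have [lZ lD lB _] := linear_formP ll.
  by rewrite {1}/hop /= (vacE C r q) hop_psi // big_nil subr0 lZ.
have lx : linear (fun xi => l (lower x xi) : K^o).
  by apply: linear_comp => //; apply: lower_linear.
have -> : hop i n (represent l) (x :: w) = hop i n (raise x (represent l)) w
   - hcoef i x.1 n * represent l (shift_letter x n :: w) by [].
have := hop_lower C r kappa eta q0 i n x (lower_word w).
move/eqP; rewrite subr_eq => /eqP /= ->.
by rewrite lD lZ addrC mulNr represent_raise IHw.
Qed.

Lemma represent_phi l s i n : linear l ->
  phi_op s i n (represent l) = represent (fun xi => l (phi_op s i n xi)).
Proof.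
move=> ll.
(* Transposition reverses products. The second half of [P], that z commutes with every linear
   operator commuting with all k and h, restores the order. *)
pose P z := (forall l, linear l ->
    act0 z (represent l) = represent (fun xi => l (act0 z xi))) /\
  (forall f, linear f -> (forall s i xi, f (kop s i xi) = kop s i (f xi)) ->
    (forall i n xi, f (hop i n xi) = hop i n (f xi)) ->
    forall xi, f (act0 z xi) = act0 z (f xi)).
have lin0 := cartan_action_linear C r q kappa eta.
have [+ _] : P (fphiz s i n); last first.
  move=> /(_ l ll); rewrite -phi_opE => ->; congr represent.
  by apply/funext => xi; rewrite phi_opE.
apply: fphiz_ind => [||a x y [x1 x2] [y1 y2]|x y [x1 x2] [y1 y2]|m m0|].
- split=> [l' /linear_formP[_ _ _ l0]|f fl _ _ xi].
    by rewrite act0l; apply/funext => w; rewrite /represent act0l l0.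
  by rewrite !act0l; have [_ _ _ ->] := linear_combs fl.
- by split=> [l' _|f _ _ _ xi]; rewrite ?act1 //; apply/funext => w; rewrite /represent act1.
- split=> [l' ll'|f fl fk' fh' xi].
    have [lZ lD _ _] := linear_formP ll'.
    rewrite act_linl x1 // y1 //; apply/funext => w.
    by rewrite dualD dualZ /represent act_linl lD lZ.
  rewrite !act_linl; apply: etrans (fl _ _ _) _.
  by congr (_ *: _ + _); [apply: x2|apply: y2].
- split=> [l' ll'|f fl fk' fh' xi]; last first.
    by rewrite !(actM lin0); apply: etrans (x2 f fl fk' fh' _) _; congr (act0 x _); apply: y2.
  have ly : linear (fun xi => l' (act0 y xi) : K^o).
    by apply: linear_comp => //; apply: act_linr.
  rewrite (actM lin0); apply: etrans (congr1 (act0 x) (y1 l' ll')) _.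
  apply: etrans (x1 _ ly) _; apply/funext => w; rewrite /represent (actM lin0).
  apply: (congr1 l'); apply: esym; apply: (y2 (act0 x)).
  - exact: act_linr.
  - move=> s' j u; apply: esym; apply: (x2 (kop s' j)); first exact: kop_linear.
      by move=> *; apply: kopC.
    by move=> *; apply: kop_hop.
  - move=> j k u; apply: esym; apply: (x2 (hop j k)); first exact: hop_linear.
      by move=> *; rewrite kop_hop.
    by move=> *; apply: hopC.
- split=> [l' ll'|f fl fk' fh' xi]; last by rewrite !act0_fh.
  by rewrite act0_fh // represent_hop //; apply/funext => w; rewrite /represent act0_fh.
- split=> [l' ll'|f fl fk' fh' xi]; last by rewrite !act0_fk.
  by rewrite act0_fk represent_kop //; apply/funext => w; rewrite /represent act0_fk.
Qed.

Lemma represent_phi_diff l i n : linear l ->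
  phi_diff i n (represent l) = represent (fun xi => l (phi_diff i n xi)).
Proof.
move=> ll; have [lZ _ lB _] := linear_formP ll; apply/funext => w.
rewrite {1}/phi_diff !represent_phi // dualZ dualB.
by rewrite /represent /phi_diff lZ lB.
Qed.

(** The commutator of x^+_y and x^-_x is symmetric in x and y, which makes the recursion defining
    [lower] agree with the transpose of [raise]. *)
Lemma represent_lower l x : linear l ->
  lower x (represent l) = represent (fun xi => l (raise x xi)).
Proof.
move=> ll; apply/funext => w.
elim: w l ll => [|y w IHw] l ll; have [lZ lD lB l0] := linear_formP ll.
  rewrite /represent /lower /= (_ : raise x vac = 0) ?l0 //.
have ly : linear (fun xi => l (lower y xi) : K^o).
  by apply: linear_comp => //; apply: lower_linear.
rewrite -[LHS]/(raise y (lower x (represent l)) w) raise_lower dualD represent_raise IHw //.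
transitivity (l (raise x (lower y (lower_word w)))); last by [].
rewrite raise_lower lD; congr (_ + _).
rewrite eq_sym (addrC y.2); case: eqP => [->|_]; last by rewrite l0.
by rewrite represent_phi_diff.
Qed.

Definition representable xi := exists2 l : dual -> K^o, linear l & xi = represent l.

Lemma vac_representable : representable vac.
Proof.
exists (fun xi => xi [::]) => //; apply/funext => -[|x w] //.
Qed.

Lemma actv_representable u xi : representable xi -> representable (actv u xi).
Proof.
elim/free_ind: u xi => [xi _|xi|a x y IHx IHy xi cxi|y x IHx xi cxi].
- exists (fun=> 0); first by move=> a u v; rewrite scaler0 addr0.
  by rewrite act0l.
- by rewrite act1.
- have [l ll El] := IHx _ cxi; have [m ml Em] := IHy _ cxi.
  exists (fun u => a * l u + m u).
    move=> b u v; rewrite ll ml /= /GRing.scale /=; ring.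
  by rewrite act_linl El Em.
- have [l ll El] := IHx _ cxi; rewrite (act_genM lin) El.
  case: y => [[] i n|s i|s i n|s] /=.
  + rewrite represent_raise; eexists; last reflexivity.
    by apply: linear_comp => //; apply: lower_linear.
  + by rewrite represent_lower //; eexists; last reflexivity; apply: linear_comp.
  + rewrite represent_kop //; eexists; last reflexivity.
    by apply: linear_comp => //; apply: kop_linear.
  + rewrite represent_hop //; eexists; last reflexivity.
    by apply: linear_comp => //; apply: hop_linear.
  + by exists l.
Qed.

Lemma lower_word_closure w : psi_closure (lower_word w).
Proof.
elim: w => [|x w IHw] /=; first exact: vac_closure.
have := actv_psi_closure kappa eta q0 qq0 BC (fx false x.1 x.2) IHw.
by rewrite actv_fx /= -surjective_pairing.
Qed.

(** A representing form is only ever evaluated on the vectors [lower_word w], all in the closure;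
    hence relations valid merely on the closure can be transposed. *)
Lemma represent_eq0 (l : dual -> K^o) :
  (forall xi, psi_closure xi -> l xi = 0) -> represent l = 0.
Proof. by move=> h; apply/funext => w; apply: h; apply: lower_word_closure. Qed.

Lemma exchange_transpose (a b x1 x2 x3 x4 : K) : a * b = 1 ->
  x4 - a * x3 - (a * x2 - x1) = - a * (x3 - b * x4 - (b * x1 - x2)).
Proof.
move=> ab; rewrite [RHS](_ : _ = (a * b) * x4 - a * x3 - (a * x2 - (a * b) * x1)); last by ring.
by rewrite ab !mul1r.
Qed.

Lemma actv_exchange_lower i j n m xi : representable xi ->
  actv (fx false i (n + 1) * fx false j m
           - q ^ (sgi false * B i j) *: (fx false j m * fx false i (n + 1))) xi =
  actv (q ^ (sgi false * B i j) *: (fx false i n * fx false j (m + 1))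
            - fx false j (m + 1) * fx false i n) xi.
Proof.
case=> l ll ->; have [lZ lD lB l0] := linear_formP ll.
rewrite !actBl !actZl !(actM lin) !actv_fx /=.
have rr x y : lower x (lower y (represent l)) = represent (fun u => l (raise y (raise x u))).
  by rewrite represent_lower // represent_lower //; apply: linear_comp.
rewrite !rr; apply/eqP; rewrite -subr_eq0; apply/eqP.
pose f u : dual := - q ^ (-1 * B i j) *:
  (raise (i, n + 1) (raise (j, m) u) - q ^ B i j *: raise (j, m) (raise (i, n + 1) u) -
   (q ^ B i j *: raise (i, n) (raise (j, m + 1) u) - raise (j, m + 1) (raise (i, n) u))).
have qV : q ^ (-1 * B i j) * q ^ B i j = 1.
  by rewrite mulN1r -invr_expz mulVf // expfz_neq0.
transitivity (represent (fun u => l (f u))); last first.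
  apply: represent_eq0 => u cu.
  by rewrite /f exchange_closure // subrr scaler0 l0.
apply/funext => w; rewrite /represent /f !(dualB, dualZ) lZ !(lB, lZ) /represent.
exact: exchange_transpose.
Qed.

Lemma sign_transpose (a b s1 s2 s3 : K) :
  s1 = s2 * s3 -> s1 * a * b = s2 * (s3 * a * b).
Proof. by move=> ->; rewrite !mulrA. Qed.

Lemma actv_serre_lower i j d (n : 'I_d -> int) m xi : i != j -> d%:Z = 1 - C i j ->
  representable xi -> actv (serre_rel false i j n m) xi = 0.
Proof.
move=> ij dE [l ll ->]; apply: actv_serre => S.
set Y := actv (fx_sum false i n S).
have YE l' : linear l' -> Y (represent l') = represent (fun u => l' (raise_sum i n S u)).
  move=> ll'; have [lZ lD lB l0] := linear_formP ll'.
  rewrite /Y actv_fx_sum; apply/funext => w; rewrite /raise_sum.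
  under eq_bigr do rewrite represent_lower //.
  rewrite /represent; elim/big_rec2: _ => [|b y z _ IH]; first by rewrite l0.
  by rewrite lD -IH.
have rl : linear (raise_sum i n S).
  move=> a u v; rewrite /raise_sum scaler_sumr -big_split; apply: eq_bigr => b _.
  by rewrite raiseD raiseZ.
have il k : linear (iter k (raise_sum i n S)).
  by elim: k => [|k IHk] a u v //; rewrite !iterS IHk rl.
have YkE k l' : linear l' ->
    iter k Y (represent l') = represent (fun u => l' (iter k (raise_sum i n S) u)).
  move=> ll'; elim: k => [|k IHk] //; rewrite iterS IHk YE; last exact: linear_comp.
  by congr represent; apply/funext => u; rewrite -iterSr.
have [lZ lD lB l0] := linear_formP ll.
have lsum (J : Type) (t : seq J) (c : J -> K) (F : J -> dual) :
    l (\sum_(k <- t) c k *: F k) = \sum_(k <- t) c k * l (F k).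
  by elim: t => [|k t IHt]; rewrite ?big_nil ?l0 // !big_cons lD lZ IHt.
transitivity (represent (fun u => l ((-1) ^+ d *: \sum_(k < d.+1) ((-1) ^+ k * qbinom (qi i) d k) *:
    iter k (raise_sum i n S) (raise (j, m) (iter (d - k) (raise_sum i n S) u))))); last first.
  by apply: represent_eq0 => u cu; rewrite serre_closure // scaler0 l0.
apply/funext => w; rewrite fun_sum /represent lZ lsum.
(* Transposition matches the l-th term with the (d-l)-th: the binomials agree by symmetry and the
   signs differ by (-1)^d. *)
rewrite mulr_sumr (reindex_inj rev_ord_inj) /=; apply: eq_bigr => k _.
rewrite dualZ subSS YkE // actv_fx represent_lower; last exact: linear_comp.
rewrite YkE; last first.
  by move=> a u v; rewrite !(il, raise_linear) // ll.
rewrite (qbinom_sub (qi i)) ?leq_ord // /represent subKn ?leq_ord //.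
apply: sign_transpose; by rewrite -signr_odd oddB ?leq_ord // signr_addb !signr_odd.
Qed.

Definition carrier xi : Prop := exists u, xi = actv u vac.

Lemma carrier_rel x y xi : drinfeld_rel C r q x y -> carrier xi -> actv x xi = actv y xi.
Proof.
move=> rxy [u ->].
have cu : psi_closure (actv u vac) by apply: actv_psi_closure => //; apply: vac_closure.
have ru : representable (actv u vac) by apply/actv_representable/vac_representable.
case: (actv_cartan_rel (actv u vac) rxy) => [|[|E]]; last exact: E.
  move=> [s [i [j [n [m [-> ->]]]]]].
  by case: s; [apply: actv_exchange_raise|apply: actv_exchange_lower].
move=> [s [i [j [d [n [m [ij dE -> ->]]]]]]]; rewrite act0l.
by case: s; [apply: actv_serre_raise|apply: actv_serre_lower].
Qed.

End Relations.

(** * Spans, and modules seen through the free algebra *)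

Section Span.
Variables (K : pzRingType) (W : lmodType K).
Implicit Types (P Q : W -> Prop) (u v : W).

Inductive spanned P : W -> Prop :=
| spanned0 : spanned P 0
| spannedZD a u v : P u -> spanned P v -> spanned P (a *: u + v).

Lemma spanned_mem P u : P u -> spanned P u.
Proof.
by move=> Pu; rewrite -[u]addr0 -[u]scale1r; apply: spannedZD => //; apply: spanned0.
Qed.

Lemma spannedD P u v : spanned P u -> spanned P v -> spanned P (u + v).
Proof.
elim=> [|a u1 u2 Pu1 _ IH] Pv; first by rewrite add0r.
by rewrite -addrA; apply: spannedZD => //; apply: IH.
Qed.

Lemma spanned_trans P Q v : (forall u, P u -> spanned Q u) -> spanned P v -> spanned Q v.
Proof.
have sZ a u : spanned Q u -> spanned Q (a *: u).
  elim=> [|b u1 u2 Qu1 _ IH]; first by rewrite scaler0; apply: spanned0.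
  by rewrite scalerDr scalerA; apply: spannedZD.
move=> PQ; elim=> [|a u1 u2 Pu1 _ IH]; first exact: spanned0.
by apply: spannedD IH; apply/sZ/PQ.
Qed.

Lemma spannedZ P a v : spanned P v -> spanned P (a *: v).
Proof.
elim=> [|b u1 u2 Qu1 _ IH]; first by rewrite scaler0; apply: spanned0.
by rewrite scalerDr scalerA; apply: spannedZD.
Qed.

Lemma spanned_sub P Q v : (forall u, P u -> Q u) -> spanned P v -> spanned Q v.
Proof. by move=> PQ; apply: spanned_trans => u /PQ; apply: spanned_mem. Qed.

Lemma spanned_sum P (J : Type) (t : seq J) (D : pred J) (F : J -> W) :
  (forall j, D j -> spanned P (F j)) -> spanned P (\sum_(j <- t | D j) F j).
Proof.
move=> PF; elim: t => [|j t IHt]; first by rewrite big_nil; apply: spanned0.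
by rewrite big_cons; case: ifP => // Dj; apply: spannedD => //; apply: PF.
Qed.

Lemma spanned_coef (L : seq W) v : spanned (fun u => u \in L) v ->
  exists a : 'I_(size L) -> K, v = \sum_(k < size L) a k *: L`_k.
Proof.
elim=> [|c u1 u2 u1L _ [a ->]].
  by exists (fun=> 0); rewrite big1 // => k _; rewrite scale0r.
have iu : (index u1 L < size L)%N by rewrite index_mem.
exists (fun k => c *+ (k == Ordinal iu) + a k).
under [RHS]eq_bigr do rewrite scalerDl.
rewrite big_split; congr (_ + _); rewrite (bigD1 (Ordinal iu)) //= eqxx mulr1n nth_index //.
by rewrite big1 ?addr0 // => k /negPf ->; rewrite mulr0n scale0r.
Qed.

End Span.

Lemma spanned_linear (K : pzRingType) (W W' : lmodType K) (f : W -> W')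
    (P : W -> Prop) (Q : W' -> Prop) v :
  linear f -> (forall u, P u -> spanned Q (f u)) -> spanned P v -> spanned Q (f v).
Proof.
move=> fl PQ; elim=> [|a u1 u2 Pu1 _ IH]; last first.
  by rewrite fl; apply: spannedD IH; apply/spannedZ/PQ.
suff -> : f 0 = 0 by apply: spanned0.
by have := fl (-1) 0 0; rewrite scaler0 addr0 scaleN1r addNr.
Qed.

Section Modules.
Variables (R : realType) (N : nat) (C : 'M[int]_N) (r : 'I_N -> nat) (q : R[i]).
Local Notation K := R[i].
Local Notation FA := (free_alg K (drinfeld_gen N)).
Local Notation B := (symmetrized_cartan C r).
Local Notation qi := (qi r q).
Local Notation fx := (@fx R N).
Local Notation fh := (@fh R N).
Local Notation fk := (@fk R N).
Local Notation fc := (@fc R N).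
Local Notation fphi := (@fphi R N q).
Local Notation fphiz := (@fphiz R N q).
Local Notation Uq := (Uq C r q).
Local Notation letter := (letter N).
Local Notation word := (word N).

(** A copy of V, so that the complex scalars can form a second module structure beside that over
    [Uq]. *)
Definition restrict (V : lmodType Uq) : Type := V.
HB.instance Definition _ (V : lmodType Uq) := GRing.Zmodule.on (restrict V).

Definition restrict_scale (V : lmodType Uq) (a : K) (v : restrict V) : restrict V :=
  (a%:A : Uq) *: (v : V).

Lemma restrict_scaleA (V : lmodType Uq) a b (v : restrict V) :
  restrict_scale a (restrict_scale b v) = restrict_scale (a * b) v.
Proof. by rewrite /restrict_scale scalerA -scalerAl mul1r scalerA. Qed.

Lemma restrict_scale1 (V : lmodType Uq) : left_id 1 (@restrict_scale V).
Proof. by move=> v; rewrite /restrict_scale !scale1r. Qed.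

Lemma restrict_scaleDr (V : lmodType Uq) : right_distributive (@restrict_scale V) +%R.
Proof. by move=> a u v; rewrite /restrict_scale scalerDr. Qed.

Lemma restrict_scaleDl (V : lmodType Uq) (v : restrict V) :
  {morph (@restrict_scale V)^~ v : a b / a + b}.
Proof. by move=> a b; rewrite /restrict_scale !scalerDl. Qed.

HB.instance Definition _ (V : lmodType Uq) :=
  GRing.Zmodule_isLmodule.Build K (restrict V)
    (@restrict_scaleA V) (@restrict_scale1 V) (@restrict_scaleDr V) (@restrict_scaleDl V).

Section Operators.
Variable V : lmodType Uq.
Local Notation W := (restrict V).
Implicit Types (u v d : W).

Lemma restrictE a v : a *: v = (a%:A : Uq) *: (v : V). Proof. by []. Qed.

(* Sealed, since unification must not unfold the quotient. *)
Fact op_key : {f : FA -> W -> W | forall x v, f x v = \pi_Uq x *: (v : V)}.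
Proof. by exists (fun x v => \pi_Uq x *: (v : V)). Qed.

Definition op := sval op_key.

Lemma opE x v : op x v = \pi_Uq x *: (v : V).
Proof. exact: (svalP op_key). Qed.

Lemma op_linl a x y v : op (a *: x + y) v = a *: op x v + op y v.
Proof.
rewrite !opE restrictE -[\pi_Uq (_ + _)]/(\pi_Uq (a *: x + y) : Uq) Uq_piD scalerDl.
by congr (_ + _); rewrite Uq_piZ scalerA -scalerAl mul1r.
Qed.

Lemma op0l v : op 0 v = 0.
Proof. by have := op_linl (-1) 0 0 v; rewrite scaler0 addr0 scaleN1r addNr. Qed.

Lemma opZl a x v : op (a *: x) v = a *: op x v.
Proof. by rewrite -[a *: x]addr0 op_linl op0l addr0. Qed.

Lemma opDl x y v : op (x + y) v = op x v + op y v.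
Proof. by rewrite -[x in LHS]scale1r op_linl scale1r. Qed.

Lemma opBl x y v : op (x - y) v = op x v - op y v.
Proof. by rewrite opDl -scaleN1r opZl scaleN1r. Qed.

Lemma opM x y v : op (x * y) v = op x (op y v).
Proof. by rewrite !opE Uq_piM scalerA. Qed.

Lemma op1 v : op 1 v = v.
Proof. by rewrite opE [X in X *: _](_ : _ = 1) ?scale1r. Qed.

Lemma op_linr x : linear (op x).
Proof.
move=> a u v; rewrite !opE restrictE.
have -> : (a *: u + v : V) = (a%:A : Uq) *: (u : V) + (v : V) by [].
rewrite scalerDr !scalerA; apply: (congr2 (fun s t : V => s + t)) => //.
by rewrite restrictE scalerA -scalerAr mulr1 -scalerAl mul1r.
Qed.

Lemma op_rel x y v : drinfeld_rel C r q x y -> op x v = op y v.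
Proof.
move=> rxy; rewrite !opE; suff -> : \pi_Uq x = \pi_Uq y :> Uq by [].
by apply/eqP/Uq_eqP; apply: ideal_gen.
Qed.

Lemma op_comb (x : FA) : [/\ forall a u, op x (a *: u) = a *: op x u,
  forall u v, op x (u + v) = op x u + op x v,
  forall u v, op x (u - v) = op x u - op x v & op x 0 = 0].
Proof.
pose ml := GRing.isLinear.Build K W W _ (op x) (op_linr x).
pose g : {linear W -> W} := HB.pack (op x) ml.
split=> [a u|u v|u v|]; [exact: (linearZ_LR g)|exact: (linearD g)|
  exact: (linearB g)|exact: (linear0 g)].
Qed.

Lemma opZ x a u : op x (a *: u) = a *: op x u. Proof. by have [->] := op_comb x. Qed.
Lemma opD x u v : op x (u + v) = op x u + op x v. Proof. by have [_ ->] := op_comb x. Qed.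
Lemma op0 x : op x 0 = 0. Proof. by have [_ _ _ ->] := op_comb x. Qed.

Lemma op_sum x (J : Type) (t : seq J) (P : pred J) (F : J -> W) :
  op x (\sum_(j <- t | P j) F j) = \sum_(j <- t | P j) op x (F j).
Proof.
elim: t => [|j t IHt]; first by rewrite !big_nil op0.
by rewrite !big_cons; case: ifP => _; rewrite ?opD IHt.
Qed.

Lemma fphi0 s i : fphi s i 0 = fk s i.
Proof.
by rewrite /Defs.fphi big_ord1 expr0 coef1 fact0 invr1 scale1r mulr1.
Qed.

Lemma fk_inv s i v : op (fk s i) (op (fk (~~ s) i) v) = v.
Proof. by rewrite -opM (op_rel v (rel_kk _ _ _ s i)) op1. Qed.

Hypothesis q0 : q != 0.

Lemma fk_fx s i s' j n v : op (fk s i) (op (fx s' j n) v) =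
  q ^ (sgi s * (sgi s' * B i j)) *: op (fx s' j n) (op (fk s i) v).
Proof.
have kT u : op (fk true i) (op (fx s' j n) u) =
    q ^ (sgi s' * B i j) *: op (fx s' j n) (op (fk true i) u).
  rewrite -opZl -(op_rel _ (rel_kx _ _ _ s' i j n)) !opM.
  by rewrite (fk_inv false).
case: s; first by rewrite mul1r kT.
rewrite -{1}[v](fk_inv true i) /=.
have := congr1 (op (fk false i)) (kT (op (fk false i) v)).
rewrite (fk_inv false) opZ => ->.
by rewrite scalerA -expfzDr // mulN1r addNr scale1r.
Qed.

Definition c_trivial := forall v, op (fc 1) v = v.

Hypothesis c1 : c_trivial.

Lemma op_gen_c s v : op (free_gen K (GenC N s)) v = v.
Proof.
have cT u : op (free_gen K (GenC N true)) u = u by have := c1 u; rewrite -[fc 1]/(free_gen K (GenC N true) ^+ 1) expr1.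
case: s => //; rewrite -[in LHS](cT v) -opM.
by rewrite (op_rel v (rel_cc _ _ _ false)) op1.
Qed.

Lemma op_fc m v : op (fc m) v = v.
Proof.
have it s n : op (free_gen K (GenC N s) ^+ n) v = v.
  by elim: n => [|n IHn]; rewrite ?op1 // exprS opM IHn op_gen_c.
by case: m => n; rewrite /Defs.fc it.
Qed.

Lemma op_hx s i j n m v : n != 0 ->
  op (fh i n) (op (fx s j m) v) = op (fx s j m) (op (fh i n) v) +
    ((sgi s)%:~R * (n%:~R^-1 * qint q (n * B i j))) *: op (fx s j (n + m)) v.
Proof.
move=> n0; have := op_rel v (rel_hx C r q s i j m n0).
rewrite opBl !opM opZl opM op_fc => /eqP; rewrite subr_eq => /eqP ->.
exact: addrC.
Qed.

Lemma op_xx i j n m v :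
  op (fx true i n) (op (fx false j m) v) = op (fx false j m) (op (fx true i n) v) +
    if i == j then (qi i - (qi i)^-1)^-1 *:
      (op (fphiz true i (n + m)) v - op (fphiz false i (n + m)) v) else 0.
Proof.
have := op_rel v (rel_x_x C r q i j n m).
rewrite opBl !opM => /eqP; rewrite subr_eq addrC => /eqP ->; congr (_ + _).
case: ifP => _; last exact: op0l.
rewrite opZl opBl; congr (_ *: (_ - _)); rewrite opM.
  exact: (op_fc (n - m)).
exact: (op_fc (- (n - m))).
Qed.

Lemma op_exchange s i j n m v :
  op (fx s i (n + 1)) (op (fx s j m) v) =
  q ^ (sgi s * B i j) *: op (fx s j m) (op (fx s i (n + 1)) v) +
  (q ^ (sgi s * B i j) *: op (fx s i n) (op (fx s j (m + 1)) v) -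
     op (fx s j (m + 1)) (op (fx s i n) v)).
Proof.
have := op_rel v (rel_xx C r q s i j n m).
by rewrite !opBl !opZl !opM => /eqP; rewrite subr_eq => /eqP ->; apply: addrC.
Qed.

Definition lword (d : W) (w : word) : W :=
  foldr (fun (x : letter) v => op (fx false x.1 x.2) v) d w.

(** On a word, h_{i,n} shifts the mode of one letter at a time, so it preserves any class of words
    stable under such shifts. *)
Lemma fh_spanned (P : word -> Prop) d i n w : n != 0 ->
  (exists e, op (fh i n) d = e *: d) ->
  P w -> (forall w1 w2 x, P (w1 ++ x :: w2) -> P (w1 ++ shift_letter x n :: w2)) ->
  spanned (fun v => exists2 w, P w & v = lword d w) (op (fh i n) (lword d w)).
Proof.
move=> n0 [e de]; elim: w P => [|x w IHw] P Pw PS /=.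
  by rewrite de; apply/spannedZ/spanned_mem; exists [::].
rewrite op_hx // [in X in _ + X](addrC n); apply: spannedD; last first.
  apply/spannedZ/spanned_mem; exists (shift_letter x n :: w) => //.
  exact: (PS [::]).
apply: (spanned_linear (op_linr (fx false x.1 x.2)) _ (IHw (fun w => P (x :: w)) Pw _)).
  by move=> _ [w' Pw' ->]; apply: spanned_mem; exists (x :: w').
by move=> w1 w2 y; apply: (PS (x :: w1)).
Qed.

Section HighestVector.
Variables (d : W) (kappa : 'I_N -> K) (eta : 'I_N -> int -> K).
Hypothesis kappa0 : forall i, kappa i != 0.
Hypothesis dx : forall i n, op (fx true i n) d = 0.
Hypothesis dk : forall i, op (fk true i) d = kappa i *: d.
Hypothesis dh : forall i n, n != 0 -> op (fh i n) d = eta i n *: d.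

Lemma dk_sign s i : op (fk s i) d = kappa i ^ sgi s *: d.
Proof.
case: s => /=; first by rewrite dk expr1z.
have := fk_inv false i d; rewrite /= dk opZ => /(congr1 (fun v => (kappa i)^-1 *: v)).
by rewrite scalerA mulVf // scale1r exprN1.
Qed.

Lemma fk_lword s i w : op (fk s i) (lword d w) =
  weight_factor C r q kappa s i w *: lword d w.
Proof.
elim: w => [|x w IHw] /=; first by rewrite dk_sign /weight_factor big_nil oppr0 mulr1.
rewrite fk_fx IHw opZ scalerA weight_factor_cons //; congr (_ * _ *: _).
by rewrite [sgi false * _]mulN1r mulrN.
Qed.

(** The spanning half of a triangular decomposition: the span of the lowering words is stable under
    every generator, an x^+ being moved to the right until it meets d. *)
Lemma lword_spanning (z : FA) : spanned (fun v => exists w, v = lword d w) (op z d).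
Proof.
pose Sp := spanned (fun v => exists w, v = lword d w).
have St x v : (forall w, Sp (op x (lword d w))) -> Sp v -> Sp (op x v).
  by move=> h; apply: (spanned_linear (op_linr x)) => _ [w ->]; apply: h.
have hS i n v : n != 0 -> Sp v -> Sp (op (fh i n) v).
  move=> n0; apply: St => w.
  apply: (spanned_sub (P := fun v => exists2 w, True & v = lword d w)).
    by move=> _ [w' _ ->]; exists w'.
  by apply: fh_spanned => //; exists (eta i n); apply: dh.
have kS s i v : Sp v -> Sp (op (fk s i) v).
  by apply: St => w; rewrite fk_lword; apply/spannedZ/spanned_mem; exists w.
have phiS s i n v : Sp v -> Sp (op (fphiz s i n) v).
  elim/fphiz_ind: (fphiz s i n) v => [v _|v|a x y IHx IHy v Sv|x y IHx IHy v Sv|m m0|] //.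
  - by rewrite op0l; apply: spanned0.
  - by rewrite op1.
  - by rewrite op_linl; apply: spannedD; [apply/spannedZ/IHx|apply: IHy].
  - by rewrite opM; apply/IHx/IHy.
  - by move=> v; apply: hS.
  - exact: kS.
have xmS i n v : Sp v -> Sp (op (fx false i n) v).
  by apply: St => w; apply: spanned_mem; exists ((i, n) :: w).
have xS i n v : Sp v -> Sp (op (fx true i n) v).
  apply: St; elim=> [|x w IHw] /=; first by rewrite dx; apply: spanned0.
  have Sw : Sp (lword d w) by apply: spanned_mem; exists w.
  rewrite op_xx; apply: spannedD; first exact: xmS.
  case: ifP => _; last exact: spanned0.
  apply: spannedZ; rewrite -scaleN1r; apply: spannedD; last apply: spannedZ; exact: phiS.
elim/free_ind: z => [||a x y Sx Sy|y x Sx].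
- by rewrite op0l; apply: spanned0.
- by rewrite op1; apply: spanned_mem; exists [::].
- by rewrite op_linl; apply: spannedD => //; apply: spannedZ.
- rewrite opM; case: y => [[] i n|s i|s i n|s].
  + exact: xS.
  + exact: xmS.
  + exact: kS.
  + have -> : free_gen K (GenH s i n) = fh i (sgi s * n.+1%:Z).
      by case: s; [rewrite mul1r | rewrite (_ : sgi false * n.+1%:Z = Negz n) //= NegzE mulN1r].
    by apply: hS => //; case: (s).
  + by rewrite op_gen_c.
Qed.

End HighestVector.

Section Eigenvalues.
Variables (d : W) (f : lfamily R N).
Hypothesis dphi : forall s i n, op (fphi s i n) d = f s i n *: d.

Hypothesis f0 : forall s i, f s i 0%N * f (~~ s) i 0%N = 1.
Hypothesis qq0 : q - q^-1 != 0.

Lemma fh_of_fphi s i : exists e : nat -> K, forall m, (0 < m)%N ->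
  op (sign_factor q s *: fh i (sgi s * m%:Z)) d = e m *: d.
Proof.
suff h n : exists e : nat -> K, forall m, (0 < m <= n)%N ->
    op (sign_factor q s *: fh i (sgi s * m%:Z)) d = e m *: d.
  have [E EP] := choice (fun n => h n).
  (* The eigenvalues obtained depend on the bound n; the diagonal choice serves all m at once. *)
  by exists (fun m => E m m) => m m0; apply: EP; rewrite m0 leqnn.
elim: n => [|n [e eP]]; first by exists (fun=> 0) => m; lia.
have fnz t : f t i 0%N != 0.
  by apply: contraTneq (oner_neq0 K) => z; rewrite -(f0 t i) z mul0r eqxx.
pose E x c := op x d = c *: d.
pose g := \sum_(l < n.+2) (l`!%:R^-1 : K) * (log_series e n ^+ l)`_n.+1.
have Eg : E (\sum_(l < n.+2) (l`!%:R^-1 : K) *: (fh_series q s i n ^+ l)`_n.+1) g.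
  rewrite /E /g scaler_suml; elim/big_rec2: _ => [|l y x _ IH]; first by rewrite op0l.
  rewrite op_linl IH -scalerA; congr (_ *: _ + _).
  apply: (@fh_series_exp_eigen _ _ q E s i e).
  - by rewrite /E op0l scale0r.
  - by rewrite /E op1 scale1r.
  - by rewrite /E => a x1 x2 c1' c2' E1 E2; rewrite op_linl E1 E2 scalerDl scalerA.
  - by rewrite /E => x1 x2 c1' c2' E1 E2; rewrite opM E2 opZ E1 scalerA mulrC.
  - exact: eP.
have := dphi s i n.+1; rewrite fphiS_split opM opDl Eg.
have kV v : op (fk (~~ s) i) (op (fk s i) v) = v by rewrite -{2}[s]negbK fk_inv.
move/(congr1 (op (fk (~~ s) i))); rewrite kV opZ -fphi0 dphi scalerA => E1.
exists (fun m => if m == n.+1 then f s i n.+1 * f (~~ s) i 0%N - g else e m).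
move=> m /andP[m0 mn]; case: eqP => [->|/eqP mn'].
  by rewrite scalerBl -E1 addrK.
by apply: eP; rewrite m0 -ltnS ltn_neqAle mn mn'.
Qed.

Lemma fh_eigenvalues : exists eta : 'I_N -> int -> K,
  forall i n, n != 0 -> op (fh i n) d = eta i n *: d.
Proof.
have [E EP] := choice (fun t : bool * 'I_N => fh_of_fphi t.1 t.2).
have sf0 s : sign_factor q s != 0.
  by rewrite mulf_neq0 //; case: (s); rewrite ?oner_eq0 // mulrN1z oppr_eq0 oner_eq0.
exists (fun i n => (sign_factor q (0 < n))^-1 * E (0 < n, i) `|n|%N) => i n n0.
rewrite -scalerA -EP /=; last by lia.
rewrite opZl scalerA mulVf // scale1r; congr (op (fh i _) d).
by case: ltP n0 => /=; lia.
Qed.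

End Eigenvalues.

End Operators.
End Modules.

(** * Separation of weights and uniqueness of L(f) *)

Section HighestWeightModules.
Variables (R : realType) (N : nat) (C : 'M[int]_N) (r : 'I_N -> nat) (q : R[i]).
Local Notation K := R[i].
Local Notation FA := (free_alg K (drinfeld_gen N)).
Local Notation B := (symmetrized_cartan C r).
Local Notation fx := (@fx R N).
Local Notation fk := (@fk R N).
Local Notation fphi := (@fphi R N q).
Local Notation Uq := (Uq C r q).
Local Notation word := (word N).
Local Notation op := (@op R N C r q _).
Local Notation lword := (@lword R N C r q _).
Implicit Types V : lmodType Uq.

Hypothesis q0 : q != 0.
Hypothesis q_inf : forall m : int, m != 0 -> q ^ m != 1.
Hypothesis B_nondeg : forall a : 'I_N -> int,
  (forall i, \sum_j a j * B i j = 0) -> forall j, a j = 0.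

Definition weight_vector V (rho : {ffun 'I_N -> K}) (v : restrict V) : Prop :=
  forall i, op (fk true i) v = rho i *: v.

(** Each mu in L contributes a factor k_i - mu_i with i such that rho and mu differ at i. The
    element z is chosen before the module, so it serves several modules simultaneously. *)
Lemma weight_separation (rho : {ffun 'I_N -> K}) (L : seq {ffun 'I_N -> K}) :
  rho \notin L -> exists (z : FA) (a : K), [/\ a != 0,
    forall V (v : restrict V), weight_vector rho v -> op z v = a *: v &
    forall V rho' (v : restrict V), rho' \in L -> weight_vector rho' v -> op z v = 0].
Proof.
elim: L => [_|mu L IHL].
  by exists 1, 1; split=> [|V v _|//]; rewrite ?oner_neq0 // op1 scale1r.
rewrite inE negb_or => /andP[rmu /IHL[z [a [a0 za z0]]]].
have [i ri] : exists i, rho i != mu i.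
  apply/existsP; rewrite -negb_forall; apply: contra rmu => /forallP h.
  by apply/eqP/ffunP => i; apply/eqP.
exists (z * (fk true i - mu i *: 1)), (a * (rho i - mu i)).
have kE V rho' (v : restrict V) : weight_vector rho' v ->
    op (z * (fk true i - mu i *: 1)) v = (rho' i - mu i) *: op z v.
  by move=> hv; rewrite opM opBl opZl op1 hv -scalerBl opZ.
split=> [|V v hv|V rho' v rho'L hv]; first by rewrite mulf_neq0 // subr_eq0.
  by rewrite (kE _ _ _ hv) (za _ _ hv) scalerA mulrC.
rewrite (kE _ _ _ hv); move: rho'L; rewrite inE => /predU1P[->|rho'L].
  by rewrite subrr scale0r.
by rewrite (z0 _ _ _ rho'L hv) scaler0.
Qed.

Definition word_weight (kappa : 'I_N -> K) (w : word) : {ffun 'I_N -> K} :=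
  [ffun i => weight_factor C r q kappa true i w].

Lemma q_inj (m n : int) : q ^ m = q ^ n -> m = n.
Proof.
move=> E; apply/eqP; rewrite -subr_eq0; apply: contraT => /q_inf/eqP[].
by rewrite expfzDr // E -expfzDr // subrr.
Qed.

Definition content (w : word) (j : 'I_N) : nat := count (fun x => x.1 == j) w.

Lemma sum_content (w : word) (F : 'I_N -> int) :
  \sum_(x <- w) F x.1 = \sum_j (content w j)%:Z * F j.
Proof.
elim: w => [|x w IHw]; first by rewrite big_nil big1 // => j _; rewrite mul0r.
rewrite big_cons IHw.
transitivity (\sum_j ((x.1 == j)%:Z * F j + (content w j)%:Z * F j)).
  rewrite [RHS]big_split /=; congr (_ + _); rewrite (bigD1 x.1) //= eqxx mul1r.
  by rewrite big1 ?addr0 // => j /negPf xj; rewrite eq_sym xj mul0r.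
by apply: eq_bigr => j _; rewrite /content /= PoszD mulrDl.
Qed.

(** The powers of q are pairwise distinct and B is nondegenerate, so a weight determines how often
    each colour occurs in a word. *)
Lemma word_weight_content kappa w1 w2 : (forall i, kappa i != 0) ->
  word_weight kappa w1 = word_weight kappa w2 -> forall j, content w1 j = content w2 j.
Proof.
move=> kappa0 E j; apply/eqP; rewrite -eqz_nat -subr_eq0; apply/eqP; move: j.
apply: B_nondeg => i; have /ffunP/(_ i) := E; rewrite !ffunE /weight_factor /= !expr1z.
move/(mulfI (kappa0 i))/q_inj/oppr_inj; rewrite !sum_content => Ei.
by under eq_bigr do rewrite mulrBl; rewrite sumrB Ei subrr.
Qed.

Lemma size_content (w : word) : size w = \sum_j content w j.
Proof.
elim: w => [|x w IHw]; first by rewrite big1.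
transitivity (\sum_j ((x.1 == j) + content w j))%N; last by [].
rewrite [RHS]big_split /= -IHw -add1n; congr (_ + _)%N; rewrite (bigD1 x.1) //= eqxx.
by rewrite big1 // => j /negPf xj; rewrite eq_sym xj.
Qed.

Lemma word_weight_size kappa w1 w2 : (forall i, kappa i != 0) ->
  word_weight kappa w1 = word_weight kappa w2 -> size w1 = size w2.
Proof.
move=> kappa0 E; rewrite !size_content; apply: eq_bigr => j _.
exact: word_weight_content E j.
Qed.

Lemma spanned_words V (d v : restrict V) (P : word -> Prop) :
  spanned (fun v => exists2 w, P w & v = lword d w) v ->
  exists2 m : seq (K * word), (forall x, x \in m -> P x.2) &
    v = \sum_(x <- m) x.1 *: lword d x.2.
Proof.
elim=> [|a _ u [w Pw ->] _ [m mP ->]]; first by exists [::] => //; rewrite big_nil.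
exists ((a, w) :: m); last by rewrite big_cons.
by move=> x; rewrite inE => /predU1P[->|/mP].
Qed.

Lemma lword_weight V (d : restrict V) kappa w : (forall i, kappa i != 0) ->
  (forall i, op (fk true i) d = kappa i *: d) ->
  weight_vector (word_weight kappa w) (lword d w).
Proof. by move=> kappa0 dk i; rewrite (fk_lword q0 kappa0 dk) ffunE. Qed.

(* A highest l-weight vector which need not generate. *)
Definition lweight_vector (f : lfamily R N) V (d : restrict V) : Prop :=
  (forall i n, op (fx true i n) d = 0) /\
  (forall s i n, op (fphi s i n) d = f s i n *: d).

Hypothesis qq0 : q - q^-1 != 0.

Section Spanning.
Variables (f : lfamily R N) (V : lmodType Uq) (d : restrict V).
Hypotheses (f0 : forall s i, f s i 0%N * f (~~ s) i 0%N = 1).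
Hypotheses (c1 : c_trivial V) (dhw : lweight_vector f d).

Lemma lweight_neq0 s i : f s i 0%N != 0.
Proof. by apply: contraTneq (oner_neq0 K) => z; rewrite -(f0 s i) z mul0r eqxx. Qed.

Lemma lweight_fk i : op (fk true i) d = f true i 0%N *: d.
Proof. by have [_ dphi] := dhw; rewrite -(fphi0 q) dphi. Qed.

Lemma words_span z : exists m : seq (K * word), op z d = \sum_(x <- m) x.1 *: lword d x.2.
Proof.
have [dx dphi] := dhw; have [eta dh] := fh_eigenvalues q0 dphi f0 qq0.
have := lword_spanning q0 c1 (fun i => lweight_neq0 true i) dx lweight_fk dh z.
move/(spanned_sub (Q := fun v => exists2 w, True & v = lword d w)) => h.
have [|m _ ->] := @spanned_words V d (op z d) (fun=> True); last by exists m.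
by apply: h => _ [w ->]; exists w.
Qed.

End Spanning.

Lemma nonempty_weight kappa (w : word) : (forall i, kappa i != 0) -> w != [::] ->
  word_weight kappa w != word_weight kappa [::].
Proof. by move=> kappa0; apply: contra => /eqP/(word_weight_size kappa0); case: w. Qed.

(* Applied to a pair of modules, this shows that the scalar b depends on f and
   z only. *)
Lemma vacuum_projection (f : lfamily R N) (z : FA) V (d : restrict V) :
  (forall s i, f s i 0%N * f (~~ s) i 0%N = 1) -> c_trivial V -> lweight_vector f d ->
  exists (p : FA) (a b : K), [/\ a != 0, op (p * z) d = b *: d,
    spanned (fun v => exists2 w, w != [::] & v = lword d w) (op z d - (b / a) *: d) &
    forall V' (v : restrict V'), weight_vector (word_weight (fun i => f true i 0%N) [::]) v ->
      op p v = a *: v].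
Proof.
move=> f0 c1 dhw; have [m mE] := words_span f0 c1 dhw z.
pose kappa i := f true i 0%N.
have kappa0 i : kappa i != 0 := lweight_neq0 f0 true i.
pose L := [seq word_weight kappa x.2 | x <- m & x.2 != [::]].
have [|p [a [a0 pa p0]]] := @weight_separation (word_weight kappa [::]) L.
  apply/negP => /mapP[x]; rewrite mem_filter => /andP[/(nonempty_weight kappa0)/negP h _] E.
  by apply: h; rewrite E.
have dk : forall i, op (fk true i) d = kappa i *: d := lweight_fk dhw.
exists p, a, (\sum_(x <- m | x.2 == [::]) x.1 * a); split=> //; last first.
  rewrite -mulr_suml mulfK // mE scaler_suml (bigID (fun x : K * word => x.2 == [::])) /=.
  rewrite (eq_bigr (fun x : K * word => x.1 *: d)) => [|x /eqP -> //].
  rewrite addrC addrK; apply: spanned_sum => x x0.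
  by apply/spannedZ/spanned_mem; exists x.2.
rewrite opM mE op_sum scaler_suml (bigID (fun x : K * word => x.2 == [::])) /=.
rewrite [X in _ + X]big_seq_cond [X in _ + X]big1 ?addr0 => [|x /andP[xm x0]]; last first.
  rewrite opZ (p0 _ (word_weight kappa x.2)) ?scaler0 //; last exact: lword_weight.
  by apply/mapP; exists x => //; rewrite mem_filter x0.
apply: eq_bigr => x /eqP ->; rewrite opZ (pa _ _ (lword_weight [::] kappa0 dk)).
by rewrite scalerA.
Qed.

Section Uniqueness.
Variable f : lfamily R N.

Lemma highest_lweight_vectorE V (d : V) : highest_lweight_vector f d ->
  lweight_vector f (d : restrict V).
Proof.
case=> _ _ dx dphi; split=> [i n|s i n]; rewrite opE; first exact: dx.
by rewrite restrictE; apply: dphi.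
Qed.

Lemma c_acts_triviallyE V : c_acts_trivially V -> c_trivial V.
Proof. by move=> h v; rewrite opE; apply: h. Qed.

Lemma lweight_inverse V (d : restrict V) : d != 0 -> lweight_vector f d ->
  forall s i, f s i 0%N * f (~~ s) i 0%N = 1.
Proof.
move=> d0 [_ dphi] s i.
have kE t : op (fk t i) d = f t i 0%N *: d by rewrite -dphi fphi0.
have := fk_inv s i d; rewrite kE opZ kE scalerA => E.
have : (f s i 0%N * f (~~ s) i 0%N - 1) *: d == 0.
  by rewrite scalerBl scale1r mulrC E subrr.
by rewrite scaler_eq0 (negPf d0) orbF subr_eq0 => /eqP.
Qed.

Lemma op_pair (V V' : lmodType Uq) (x : FA) (v : V) (v' : V') :
  op x ((v, v') : restrict (V * V')%type) = (op x (v : restrict V), op x (v' : restrict V')).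
Proof. by rewrite !opE. Qed.

(** If u d = 0 while u d' is nonzero, simplicity of V' gives t with t u d' = d'. Then z = t u sends
    the pair (d, d') to (0, d'), and projecting to the vacuum weight yields (0, a d') = b (d, d').
    Hence b = 0, which contradicts that a and d' are nonzero. *)
Lemma annihilator_sub V V' (d : V) (d' : V') :
  c_acts_trivially V -> c_acts_trivially V' -> simple_module V' ->
  highest_lweight_vector f d -> highest_lweight_vector f d' ->
  forall u : Uq, u *: d = 0 -> u *: d' = 0.
Proof.
move=> cV cV' [_ simV'] hd hd' u ud0; apply/eqP; apply: contraT => ud'0.
pose S (v : V') := exists t : Uq, v = t *: (u *: d').
have subS : is_submodule S.
  split; first by exists 0; rewrite scale0r.
  by move=> a v w [t ->] [t' ->]; exists (a * t + t'); rewrite scalerDl scalerA.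
have Sud : S (u *: d') by exists 1; rewrite scale1r.
have [t tE] : S d'.
  case: (simV' S subS) => [S0|-> //].
  by move: Sud; rewrite S0 /= => /eqP; rewrite (negPf ud'0).
pose z : FA := repr (t * u).
have zE V0 (v : restrict V0) : op z v = (t * u) *: (v : V0) by rewrite opE reprK.
have [d0 _ _ _] := hd; have [d'0 _ _ _] := hd'.
have lwd := highest_lweight_vectorE hd; have lwd' := highest_lweight_vectorE hd'.
have f0 := lweight_inverse d0 lwd.
have ctV := c_acts_triviallyE cV; have ctV' := c_acts_triviallyE cV'.
pose dd : restrict (V * V')%type := (d, d').
have lwdd : lweight_vector f dd.
  have [dx dphi] := lwd; have [dx' dphi'] := lwd'.
  by split=> [i n|s i n]; rewrite op_pair; [rewrite dx dx'|rewrite dphi dphi'].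
have ctVV : c_trivial (V * V')%type by case=> v v'; rewrite op_pair ctV ctV'.
have [p [a [b [a0 pz _ pa]]]] := vacuum_projection z f0 ctVV lwdd.
have := pz; rewrite opM [op z dd]op_pair.
have -> : op z (d : restrict V) = 0 by rewrite zE -scalerA ud0 scaler0.
have -> : op z (d' : restrict V') = d' by rewrite zE -scalerA -tE.
rewrite op_pair op0; have -> : op p (d' : restrict V') = a *: (d' : restrict V').
  apply: pa => i; rewrite (lweight_fk lwd') ffunE /weight_factor big_nil oppr0.
  by rewrite mulr1 expr1z.
move=> E; have /(congr1 fst)/= bd : (0, a *: (d' : restrict V')) =
   ((b *: (d : restrict V), b *: (d' : restrict V')) : (V * V')%type) := E.
have /(congr1 snd)/= bd' : (0, a *: (d' : restrict V')) =
   ((b *: (d : restrict V), b *: (d' : restrict V')) : (V * V')%type) := E.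
have b0 : b = 0.
  apply/eqP; move/esym/eqP: bd; rewrite (scaler_eq0 b (d : restrict V)).
  by rewrite (negPf d0) orbF.
move/eqP: bd'; rewrite b0 (scale0r (d' : restrict V')) (scaler_eq0 a (d' : restrict V')).
by rewrite (negPf a0) (negPf d'0).
Qed.

Lemma highest_lweight_iso V V' : L C r q f V -> L C r q f V' -> module_iso V V'.
Proof.
move=> [sV cV [d hd]] [sV' cV' [d' hd']].
have k12 := annihilator_sub cV cV' sV' hd hd'.
have k21 := annihilator_sub cV' cV sV hd' hd.
have transfer (V1 V2 : lmodType Uq) (e1 : V1) (e2 : V2) :
    (forall u : Uq, u *: e1 = 0 -> u *: e2 = 0) ->
    forall u t : Uq, u *: e1 = t *: e1 -> u *: e2 = t *: e2.
  move=> k u t E; apply/eqP; rewrite -subr_eq0 -scalerBl; apply/eqP/k.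
  by rewrite scalerBl E subrr.
have [_ gd _ _] := hd; have [_ gd' _ _] := hd'.
have [F FE] := choice gd; have [G GE] := choice gd'.
pose phi (v : V) : V' := F v *: d'.
have phiE u : phi (u *: d) = u *: d' by apply: (transfer _ _ _ _ k12); rewrite -FE.
have phi_lin : linear phi.
  by move=> a v w; rewrite [v]FE [w]FE scalerA -scalerDl !phiE scalerDl scalerA.
pose ml := GRing.isLinear.Build Uq V V' _ phi phi_lin.
pose g : {linear V -> V'} := HB.pack phi ml.
exists g; exists (fun v' => G v' *: d) => [v|v'] /=.
  by rewrite [RHS]FE; apply: (transfer _ _ _ _ k21); rewrite -GE.
by rewrite phiE -GE.
Qed.

Lemma L_iso V V' : module_iso V V' -> L C r q f V -> L C r q f V'.
Proof.
move=> [F [G FK GK]] [[[v0 v0n0] sV] cV [d [d0 gd dx dphi]]].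
have FE v' : exists v, v' = F v by exists (G v'); rewrite GK.
have F0 v : v != 0 -> F v != 0.
  by apply: contra => /eqP Fv; rewrite -[v]FK Fv -(linear0 F) FK.
split.
- split; first by exists (F v0); apply: F0.
  move=> S [S0 SD]; pose T v := S (F v).
  have subT : is_submodule T.
    by split=> [|a v w Tv Tw]; rewrite /T ?linear0 // linearP; apply: SD.
  case: (sV T subT) => TE; [left|right]; apply/seteqP; split=> v' //.
  + move=> Sv'; have : T (G v') by rewrite /T GK.
    by rewrite TE /= => Gv'; rewrite -[v']GK Gv' linear0.
  + by move=> ->.
  + by move=> _; rewrite -[v']GK -/(T _) TE.
- by move=> v'; have [v ->] := FE v'; rewrite -linearZ cV.
- exists (F d); split; first exact: F0.
  + by move=> v'; have [v ->] := FE v'; have [u ->] := gd v; exists u; rewrite linearZ.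
  + by move=> i n; rewrite -linearZ dx linear0.
  + have FZ (a : Uq) v : F (a *: v) = a *: F v by exact: (linearZ_LR F).
    by move=> s i n; rewrite -!FZ dphi.
Qed.

End Uniqueness.

End HighestWeightModules.

(** * Modules over the quotient algebra from subspaces stable under the free algebra *)

Section Subrepresentation.
Variables (R : realType) (N : nat) (C : 'M[int]_N) (r : 'I_N -> nat) (q : R[i]).
Local Notation K := R[i].
Local Notation FA := (free_alg K (drinfeld_gen N)).
Local Notation Uq := (Uq C r q).
Variables (W : lmodType K) (rho : drinfeld_gen N -> W -> W).

(** The defining relations are asked for on the subspace only: the generators act on all of W, but
    only the subspace becomes a module over [Uq]. *)
Record subrep := Subrep {
  subrep_set :> W -> Prop;
  subrep_linear : forall y, linear (rho y);
  subrep0 : subrep_set 0;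
  subrepD : forall a u v, subrep_set u -> subrep_set v -> subrep_set (a *: u + v);
  subrep_act : forall x v, subrep_set v -> subrep_set (act rho x v);
  subrep_rel : forall x y v, drinfeld_rel C r q x y -> subrep_set v ->
    act rho x v = act rho y v }.

Variable S : subrep.

Definition subrep_pred : {pred W} := [pred v | `[< S v >]].

Lemma subrep_zmod_closed : zmod_closed subrep_pred.
Proof.
split=> [|u v /asboolP Su /asboolP Sv]; apply/asboolP; first exact: subrep0.
by rewrite addrC -scaleN1r; apply: subrepD.
Qed.

HB.instance Definition _ := GRing.isZmodClosed.Build W subrep_pred subrep_zmod_closed.

Definition subrep_type : Type := {v : W | v \in subrep_pred}.
HB.instance Definition _ := Choice.on subrep_type.
HB.instance Definition _ := SubType.on subrep_type.
HB.instance Definition _ := [SubChoice_isSubZmodule of subrep_type by <:].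

Lemma subrep_typeP (v : subrep_type) : S (val v).
Proof. by apply/asboolP; apply: (valP v). Qed.

Lemma subrep_ideal x v : drinfeld_ideal C r q x -> S v -> act rho x v = 0.
Proof.
have lin := subrep_linear S.
move=> Ix; elim: Ix v => [y z ryz v Sv||y z _ IHy _ IHz v Sv|a y b _ IH v Sv].
- by rewrite actBl (subrep_rel ryz Sv) subrr.
- by move=> v _; rewrite act0l.
- by rewrite actDl IHy // IHz // addr0.
- rewrite !(actM lin) IH; last exact: subrep_act.
  by have := act_linr lin a (-1) 0 0; rewrite scaler0 addr0 scaleN1r addNr.
Qed.

Fact subrep_act_mem (u : Uq) (v : subrep_type) : act rho (repr u) (val v) \in subrep_pred.
Proof. by apply/asboolP/subrep_act/subrep_typeP. Qed.

Definition subrep_scale (u : Uq) (v : subrep_type) : subrep_type :=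
  Sub (act rho (repr u) (val v)) (subrep_act_mem u v).

Lemma subrep_scaleE (x : FA) (v : subrep_type) :
  val (subrep_scale (\pi x) v) = act rho x (val v).
Proof.
rewrite SubK; apply/eqP; rewrite -subr_eq0 -actBl; apply/eqP.
by apply: subrep_ideal (subrep_typeP v); apply: Uq_repr_pi.
Qed.

Lemma subrep_scaleA u t (v : subrep_type) :
  subrep_scale u (subrep_scale t v) = subrep_scale (u * t) v.
Proof.
apply: val_inj; rewrite -[u]reprK -[t]reprK.
rewrite -[_ * _](Uq_piM C r q (repr u) (repr t)) !subrep_scaleE.
by rewrite (actM (subrep_linear S)).
Qed.

Lemma subrep_scale1 : left_id 1 subrep_scale.
Proof. by move=> v; apply: val_inj; rewrite subrep_scaleE act1. Qed.

Lemma val_subrepD (v w : subrep_type) : val (v + w) = val v + val w.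
Proof. exact: raddfD. Qed.

Lemma subrep_scaleDr : right_distributive subrep_scale +%R.
Proof.
move=> u v w; apply: val_inj; rewrite val_subrepD.
have vE t (v' : subrep_type) : val (subrep_scale t v') = act rho (repr t) (val v') by [].
rewrite !vE val_subrepD.
by have := act_linr (subrep_linear S) (repr u) 1 (val v) (val w); rewrite !scale1r.
Qed.

Lemma subrep_scaleDl (v : subrep_type) : {morph subrep_scale^~ v : u t / u + t}.
Proof.
move=> u t; apply: val_inj; rewrite val_subrepD -[u]reprK -[t]reprK -Uq_piD.
by rewrite !subrep_scaleE actDl.
Qed.

HB.instance Definition _ := GRing.Zmodule_isLmodule.Build Uq subrep_type
  subrep_scaleA subrep_scale1 subrep_scaleDr subrep_scaleDl.

Lemma val_op (x : FA) (v : restrict (subrep_type : lmodType Uq)) :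
  val (op x v : subrep_type) = act rho x (val (v : subrep_type)).
Proof. by rewrite opE -subrep_scaleE. Qed.

Lemma val_scale (a : K) (v : restrict (subrep_type : lmodType Uq)) :
  val (a *: v : subrep_type) = a *: val (v : subrep_type).
Proof.
rewrite -{1}[v](op1 v) -(opZl a) val_op actZl act1 //.
Qed.

End Subrepresentation.

(** * The model of L(f) and its simplicity *)

Section Model.
Variables (R : realType) (N : nat) (C : 'M[int]_N) (r : 'I_N -> nat) (q : R[i]).
Local Notation K := R[i].
Local Notation B := (symmetrized_cartan C r).
Local Notation qi := (qi r q).
Local Notation fx := (@fx R N).
Local Notation fphi := (@fphi R N q).
Local Notation fphiz := (@fphiz R N q).
Local Notation Uq := (Uq C r q).
Local Notation dual := (dual R N).
Local Notation op := (@op R N C r q _).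

Hypotheses (q0 : q != 0) (qq0 : q - q^-1 != 0).
Hypothesis BC : forall i j, B i j = B j i.
Hypothesis qint0 : forall i n, qint (qi i) n.+1 != 0.
Hypotheses (Cdiag : forall i, C i i = 2) (Coff : forall i j, i != j -> C i j <= 0).
Hypothesis q_inf : forall m : int, m != 0 -> q ^ m != 1.
Hypothesis B_nondeg : forall a : 'I_N -> int,
  (forall i, \sum_j a j * B i j = 0) -> forall j, a j = 0.

Variable f : lfamily R N.
Hypothesis f_lweight : is_lweight f.

Let kappa (i : 'I_N) : K := f true i 0%N.

Lemma lweight_sign s i : f s i 0%N * f (~~ s) i 0%N = 1.
Proof. by case: s; rewrite /= ?f_lweight // mulrC f_lweight. Qed.

Lemma model_kappa0 i : kappa i != 0.
Proof. exact: lweight_neq0 lweight_sign true i. Qed.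

Lemma sign_factor_neq0 s : sign_factor q s != 0.
Proof.
by rewrite mulf_neq0 //; case: s; rewrite ?oner_eq0 // mulrN1z oppr_eq0 oner_eq0.
Qed.

(** The [eta] are the coefficients of the logarithms of the series f divided by their constant
    terms, up to [sign_factor]; positive modes come from f^+, negative ones from f^-. *)
Lemma model_eta_exists : exists eta : 'I_N -> int -> K, forall s i n,
  kappa i ^ sgi s * exp_coef (fun m => sign_factor q s * eta i (sgi s * m%:Z)) n = f s i n.
Proof.
have /choice[e eP] : forall t : bool * 'I_N, exists e, forall n,
    exp_coef e n = f t.1 t.2 n * f (~~ t.1) t.2 0%N.
  by move=> t; apply: exp_coef_surj; apply: lweight_sign.
exists (fun i n => (sign_factor q (0 < n))^-1 * e (0 < n, i) `|n|%N) => s i n.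
rewrite (@exp_coef_eq _ _ (e (s, i))) => [|m mn]; last first.
  rewrite /=.
  case: m mn => [|m _] //.
  have [-> ->] : (0 < sgi s * m.+1%:Z) = s /\ absz (sgi s * m.+1%:Z) = m.+1.
    by case: s => /=; split; lia.
  by rewrite mulrA mulfV ?sign_factor_neq0 // mul1r.
rewrite eP /=; have -> : kappa i ^ sgi s = f s i 0%N.
    case: s => /=; first by rewrite expr1z.
    rewrite exprN1; apply: (mulfI (model_kappa0 i)); rewrite mulfV ?model_kappa0 //.
    by rewrite -(f_lweight i).
by rewrite mulrCA lweight_sign mulr1.
Qed.

Variable eta : 'I_N -> int -> K.
Hypothesis etaP : forall s i n,
  kappa i ^ sgi s * exp_coef (fun m => sign_factor q s * eta i (sgi s * m%:Z)) n = f s i n.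

Local Notation dual_action := (dual_action C r q kappa eta).
Local Notation actv := (act dual_action).
Local Notation carrier := (carrier C r q kappa eta).
Local Notation vac := (@vac R N).

Lemma carrierD a u v : carrier u -> carrier v -> carrier (a *: u + v).
Proof. by move=> [x ->] [y ->]; exists (a *: x + y); rewrite act_linl. Qed.

Lemma carrier0 : carrier 0.
Proof. by exists 0; rewrite act0l. Qed.

Lemma carrier_act x v : carrier v -> carrier (actv x v).
Proof. by move=> [y ->]; exists (x * y); rewrite (actM (dual_action_linear C r q kappa eta)). Qed.

Lemma carrier_vac : carrier vac.
Proof. by exists 1; rewrite act1. Qed.

Definition model_subrep : subrep C r q dual_action :=
  Subrep (dual_action_linear C r q kappa eta) carrier0 carrierD carrier_act
    (fun x y v => @carrier_rel R N C r q kappa eta q0 model_kappa0 qq0 BC qint0 Cdiag Coff x y v).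

Definition model : lmodType Uq := subrep_type model_subrep.

Definition model_vac : model := Sub vac (asboolT carrier_vac).

Local Notation lword := (@lword R N C r q model).
Let lin := dual_action_linear C r q kappa eta.

Lemma val_model_op x (v : restrict model) : val (op x v : model) = actv x (val (v : model)).
Proof. exact: val_op. Qed.

Lemma model_c_trivial : c_trivial model.
Proof. by move=> v; apply: val_inj; rewrite val_model_op actv_fc. Qed.

Lemma actv_fphi_vac s i n : actv (fphi s i n) vac = f s i n *: vac.
Proof.
have -> : fphi s i n = fphiz s i (sgi s * n%:Z).
  have ss : sgi s * (sgi s * n%:Z) = n%:Z by case: (s) => /=; lia.
  have sn : absz (sgi s * n%:Z) = n by case: (s) => /=; lia.
  by rewrite /Defs.fphiz ss sn.
rewrite actv_fphiz (vacE C r q) phi_op_psi // /phi_eigen.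
have ss : 0 <= sgi s * (sgi s * n%:Z) by case: (s) => /=; lia.
have sn : absz (sgi s * n%:Z) = n by case: (s) => /=; lia.
rewrite ss sn -etaP; apply: (congr1 (fun c : K => c *: _)); apply: (congr2 (fun a b : K => a * b)).
  by apply: (congr1 (fun a : K => a ^ sgi s)); rewrite big_nil oppr0 expr0z mulr1.
by apply: exp_coef_eq => m _; rewrite big_nil subr0.
Qed.

Lemma model_lweight : lweight_vector f (model_vac : restrict model).
Proof.
split=> [i n|s i n]; apply: val_inj; rewrite val_model_op.
  by rewrite actv_fx; apply/funext.
by rewrite val_scale; apply: actv_fphi_vac.
Qed.

Lemma model_vac_neq0 : model_vac != 0.
Proof.
apply/eqP => /(congr1 val)/(congr1 (fun xi : dual => xi [::]))/= /eqP.
by rewrite oner_eq0.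
Qed.

Lemma model_generated (v : restrict model) : exists z, v = op z (model_vac : restrict model).
Proof.
have [z zE] := subrep_typeP (v : model); exists z; apply: val_inj.
by rewrite val_model_op.
Qed.

Lemma val_lword w : val (lword (model_vac : restrict model) w : model) = lower_word C r q kappa eta w.
Proof.
elim: w => [//|x w IHw] /=; rewrite val_model_op actv_fx IHw.
by rewrite -surjective_pairing.
Qed.

Lemma model_highest : highest_lweight_vector f model_vac.
Proof.
have [dx dphi] := model_lweight; split.
- exact: model_vac_neq0.
- move=> v; have [z zE] := model_generated v; exists (\pi_Uq z).
  by rewrite [LHS]zE opE.
- by move=> i n; have := dx i n; rewrite opE.
- by move=> s i n; have := dphi s i n; rewrite opE restrictE.
Qed.

Lemma model_c_acts : c_acts_trivially model.
Proof. by move=> v; have := model_c_trivial v; rewrite opE. Qed.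

(** The value of xi at x :: w is that of x^+_x xi at w, so only the value on the empty word
    survives. *)
Lemma model_singular (v : restrict model) :
  (forall i n, op (fx true i n) v = 0) -> exists c, v = c *: (model_vac : restrict model).
Proof.
move=> h; exists (val (v : model) [::]); apply: val_inj; rewrite val_scale.
apply/funext => -[|[i n] w]; first by rewrite dualZ /= mulr1.
have := congr1 (fun u : model => val u w) (h i n).
by rewrite /= val_model_op actv_fx /= /raise => ->; rewrite dualZ mulr0.
Qed.

Lemma raise_word (v : restrict model) w : exists z, forall w',
  val (op z v : model) w' = val (v : model) (w ++ w').
Proof.
elim: w v => [|[i n] w IHw] v; first by exists 1 => w'; rewrite op1.
have [z zE] := IHw (op (fx true i n) v); exists (z * fx true i n) => w'.
by rewrite opM zE val_model_op actv_fx.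
Qed.

(** A nonzero v has a nonzero value on some word w, and raising along w moves this value to the
    empty word. Nonempty lowering words vanish there, so the vacuum component is nonzero and
    [vacuum_projection] extracts it. *)
Lemma model_simple : simple_module model.
Proof.
split=> [|S [S0 SD]]; first by exists model_vac; apply: model_vac_neq0.
have SZ (u : Uq) v : S v -> S (u *: v) by move=> Sv; rewrite -[_ *: _]addr0; apply: SD.
case: (pselect (exists2 v, S v & v != 0)) => [[v Sv v0]|h]; [right|left]; last first.
  apply/seteqP; split=> v /=; last by move=> ->.
  by move=> Sv; apply/eqP; apply: contraT => v0; case: h; exists v.
have [w vw] : exists w, val v w != 0.
  apply: contrapT => h; case/negP: v0; apply/eqP/val_inj/funext => w.
  by apply/eqP; apply: contraT => vw; case: h; exists w.
have [z zE] := raise_word v w.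
have [t tE] := model_generated (op z v).
have [p [a [b [a0 pb rest _]]]] := vacuum_projection q0 q_inf B_nondeg qq0 t
  lweight_sign model_c_trivial model_lweight.
have ev0 (u : restrict model) : spanned (fun v => exists2 w, w != [::] &
    v = lword (model_vac : restrict model) w) u -> val (u : model) [::] = 0.
  elim=> [//|c _ u' [[|x w'] // _ ->] _ IH].
  rewrite val_subrepD val_scale dualD dualZ IH val_lword /=.
  by rewrite mulr0 addr0.
have b0 : b != 0.
  apply: contraNneq vw => b0; have := ev0 _ rest.
  by rewrite b0 mul0r scale0r subr0 -tE zE cats0 => ->.
have Sd : S model_vac.
  have Spz : S (\pi_Uq p *: (\pi_Uq z *: v)).
    exact/SZ/SZ.
  move: Spz.
  have -> : \pi_Uq p *: (\pi_Uq z *: v) = op p (op z v) by rewrite !opE.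
  rewrite tE -opM pb restrictE => /(SZ (b^-1)%:A).
  by rewrite scalerA -scalerAl mul1r scalerA mulVf // !scale1r.
apply/seteqP; split=> // v' _; have [z' ->] := model_generated v'.
by rewrite opE; apply: SZ.
Qed.

Lemma model_L : L C r q f model.
Proof.
by split; [apply: model_simple|apply: model_c_acts|exists model_vac; apply: model_highest].
Qed.

(** The highest vector for g is killed by the x^+, hence a multiple of the vacuum, and so has the
    eigenvalues f. *)
Lemma model_L_inj g : L C r q g model -> g = f.
Proof.
case=> _ _ [v hv]; have [v0 _ _ _] := hv; have [vx vphi] := highest_lweight_vectorE hv.
have [c cE] := model_singular vx; have [_ dphi] := model_lweight.
apply/funext => s; apply/funext => i; apply/funext => n.
have := vphi s i n; rewrite cE opZ dphi => E.
have : (g s i n - f s i n) *: (v : restrict model) == 0.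
  by rewrite scalerBl cE -E !scalerA [c * _]mulrC subrr.
rewrite scaler_eq0 => /orP[|/eqP v00]; first by rewrite subr_eq0 => /eqP.
by case/eqP: v0.
Qed.

End Model.

(** * Weight spaces of a module generated by a highest l-weight vector *)

Section Weights.
Variables (R : realType) (N : nat) (C : 'M[int]_N) (r : 'I_N -> nat) (q : R[i]).
Local Notation K := R[i].
Local Notation B := (symmetrized_cartan C r).
Local Notation fx := (@fx R N).
Local Notation fk := (@fk R N).
Local Notation Uq := (Uq C r q).
Local Notation word := (word N).
Local Notation op := (@op R N C r q _).
Local Notation lword := (@lword R N C r q _).
Implicit Types V : lmodType Uq.

Hypothesis q0 : q != 0.
Hypothesis q_inf : forall m : int, m != 0 -> q ^ m != 1.
Hypothesis B_nondeg : forall a : 'I_N -> int,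
  (forall i, \sum_j a j * B i j = 0) -> forall j, a j = 0.
Hypothesis qq0 : q - q^-1 != 0.

Lemma weight_spaceE V (rho : {ffun 'I_N -> K}) (v : V) :
  weight_space rho v <-> weight_vector rho (v : restrict V).
Proof.
have E i : op (fk true i) (v : restrict V) = uk C r q i *: v by rewrite opE.
split=> [h i|h i]; first by rewrite E; apply: h.
by have := h i; rewrite E.
Qed.

Lemma weight_vectorD V (rho : {ffun 'I_N -> K}) a (u v : restrict V) :
  weight_vector rho u -> weight_vector rho v -> weight_vector rho (a *: u + v).
Proof. by move=> hu hv i; rewrite op_linr hu hv scalerDr !scalerA [a * _]mulrC. Qed.

Lemma weight_vector0 V (rho : {ffun 'I_N -> K}) : weight_vector rho (0 : restrict V).
Proof. by move=> i; rewrite op0 scaler0. Qed.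

Lemma weight_independent V (L : seq {ffun 'I_N -> K}) (w : {ffun 'I_N -> K} -> restrict V) :
  uniq L -> (forall rho, rho \in L -> weight_vector rho (w rho)) ->
  \sum_(rho <- L) w rho = 0 -> forall rho, rho \in L -> w rho = 0.
Proof.
move=> uL hw w0 rho rhoL.
have [|z [a [a0 za z0]]] := @weight_separation R N C r q rho (rem rho L).
  by rewrite mem_rem_uniq // inE eqxx.
have := congr1 (op z) w0; rewrite op_sum op0.
have -> : \sum_(rho <- L) op z (w rho) = op z (w rho) + \sum_(rho <- rem rho L) op z (w rho).
  by rewrite (perm_big _ (perm_to_rem rhoL)) big_cons.
rewrite (za _ _ (hw _ rhoL)) [X in _ + X]big_seq [X in _ + X]big1 ?addr0; last first.
  by move=> rho' rho'L; apply: (z0 _ rho') => //; apply/hw/(mem_rem rho'L).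
by move/eqP; rewrite scaler_eq0 (negPf a0) => /eqP.
Qed.

Section Generated.
Variables (f : lfamily R N) (V : lmodType Uq) (d : restrict V).
Hypotheses (f0 : forall s i, f s i 0%N * f (~~ s) i 0%N = 1).
Hypotheses (c1 : c_trivial V) (dhw : lweight_vector f d).
Hypothesis dgen : forall v : restrict V, exists z, v = op z d.

Let kappa (i : 'I_N) : K := f true i 0%N.
Let kappa0 i : kappa i != 0. Proof. exact: lweight_neq0 f0 true i. Qed.
Local Notation wt := (word_weight C r q kappa).

Let lword_wt w : weight_vector (wt w) (lword d w).
Proof. by apply: lword_weight => // i; apply: lweight_fk dhw i. Qed.

Lemma words_generate (v : restrict V) :
  exists m : seq (K * word), v = \sum_(x <- m) x.1 *: lword d x.2.
Proof. by have [z ->] := dgen v; apply: words_span f0 c1 dhw z. Qed.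

Lemma word_weights w : weights (wt w).
Proof.
by move=> i; rewrite ffunE /weight_factor expr1z mulf_neq0 // expfz_neq0.
Qed.

Lemma weight_component (m : seq (K * word)) (rho : {ffun 'I_N -> K}) v :
  weight_vector rho v -> v = \sum_(x <- m) x.1 *: lword d x.2 ->
  v = \sum_(x <- m | wt x.2 == rho) x.1 *: lword d x.2.
Proof.
move=> hv vE; pose L := [seq wt x.2 | x <- m & wt x.2 != rho].
have [|z [a [a0 za z0]]] := @weight_separation R N C r q rho L.
  by apply/negP => /mapP[x]; rewrite mem_filter => /andP[/eqP h _] E; apply: h.
have sumwt : weight_vector rho (\sum_(x <- m | wt x.2 == rho) x.1 *: lword d x.2).
  elim/big_rec: _ => [|x y /eqP xr hy]; first exact: weight_vector0.
  by apply: weight_vectorD => //; rewrite -xr; apply: lword_wt.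
apply: (scalerI a0); rewrite -(za _ _ hv) -(za _ _ sumwt) {1}vE.
rewrite (bigID (fun x : K * word => wt x.2 == rho)) /= opD !op_sum.
rewrite [X in _ + X]big_seq_cond [X in _ + X]big1 ?addr0 // => x /andP[xm xr].
rewrite opZ (z0 _ (wt x.2)) ?scaler0 //; apply/mapP; exists x => //.
by rewrite mem_filter xr.
Qed.

Lemma generated_weight_decomposition : weight_decomposition V.
Proof.
move=> v; have [m vE] := words_generate v.
pose w (rho : {ffun 'I_N -> K}) : restrict V :=
  \sum_(x <- m | wt x.2 == rho) x.1 *: lword d x.2.
pose L := undup [seq wt x.2 | x <- m].
have w0 rho : rho \notin L -> w rho = 0.
  move=> rL; rewrite /w big_seq_cond big1 // => x /andP[xm /eqP xr].
  by case/negP: rL; rewrite mem_undup; apply/mapP; exists x.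
have wh rho : weight_vector rho (w rho).
  rewrite /w; elim/big_rec: _ => [|x y /eqP xr hy]; first exact: weight_vector0.
  by apply: weight_vectorD => //; rewrite -xr; apply: lword_wt.
have Lw rho : rho \in L -> weights rho.
  by rewrite mem_undup => /mapP[x _ ->]; apply: word_weights.
have sumE (L' : seq {ffun 'I_N -> K}) (u : {ffun 'I_N -> K} -> restrict V) :
    uniq L' -> (forall rho, rho \in L' -> weights rho) ->
    (forall rho, rho \notin L' -> u rho = 0) ->
    \sum_(rho \in weights (R := R) (N := N)) (u rho : V) = \sum_(rho <- L') u rho.
  move=> uL' L'w u0; rewrite (fsbigE L') //; last by move=> rho _; apply: u0.
  rewrite [LHS]big_seq_cond [RHS]big_seq; apply: eq_bigl => rho.
  by case: (boolP (rho \in L')) => //= rL; rewrite (mem_set (L'w _ rL)).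
have wL x : x \in m -> wt x.2 \in L.
  by move=> xm; rewrite mem_undup; apply/mapP; exists x.
have vsum (L' : seq {ffun 'I_N -> K}) : uniq L' -> (forall x, x \in m -> wt x.2 \in L') ->
    v = \sum_(rho <- L') w rho.
  move=> uL' mL'; rewrite vE /w; under [RHS]eq_bigr do rewrite big_mkcond.
  rewrite exchange_big /= big_seq [RHS]big_seq; apply: eq_bigr => x xm.
  rewrite (bigD1_seq (wt x.2)) ?mL' //= eqxx big1 ?addr0 // => rho.
  by rewrite eq_sym => /negPf ->.
exists w; split.
  split.
  - by move=> rho _; apply/weight_spaceE/wh.
  - by move=> rho nw; apply: w0; apply/negP => /Lw.
  - apply: sub_finite_set (finite_seq L) => rho /= wr.
    by apply: contraT => /w0/eqP; rewrite (negPf wr).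
  - by rewrite (sumE L w) ?undup_uniq //; apply: vsum; rewrite ?undup_uniq.
move=> w' [w'h w'0 w'fin vE']; apply/funext => rho0.
move/finite_seqP: (w'fin) => [L' L'E].
pose L2 := undup (L ++ L').
have L2n rho : rho \notin L2 -> w rho = 0 /\ w' rho = 0.
  rewrite mem_undup mem_cat negb_or => /andP[/w0 -> rL']; split=> //.
  apply/eqP; apply: contraNT rL' => wr.
  by have : [set` L']%classic rho by rewrite -L'E.
have L2w rho : rho \in L2 -> weights rho.
  rewrite mem_undup mem_cat => /orP[/Lw//|rL']; apply: contrapT => /w'0 wr.
  by have : [set rho | w' rho != 0]%classic rho by [rewrite L'E|]; rewrite /= wr eqxx.
have vw : v = \sum_(rho <- L2) w rho.
  by apply: vsum => [|x xm]; rewrite ?undup_uniq // mem_undup mem_cat wL.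
have vw' : v = \sum_(rho <- L2) (w' rho : restrict V).
  by rewrite vE' (sumE L2 w') ?undup_uniq //; move=> rho /L2n[].
case: (boolP (rho0 \in L2)) => [rL2|/L2n[-> ->] //].
apply/eqP; rewrite -subr_eq0; apply/eqP; move: rho0 rL2.
apply: (weight_independent (w := fun rho => w rho - (w' rho : restrict V))).
- exact: undup_uniq.
- move=> rho rL2; rewrite addrC -scaleN1r; apply: weight_vectorD => //.
  exact/weight_spaceE/w'h/L2w.
- by rewrite sumrB -vw -vw' subrr.
Qed.

Lemma generated_cone : exists s : seq {ffun 'I_N -> K},
  (forall rho, rho \in s -> weights rho) /\
  forall rho, is_weight V rho -> exists rho0 x, [/\ rho0 \in s, Qplus_bar C r q x &
    forall i, rho i = rho0 i * (x i)^-1].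
Proof.
exists [:: [ffun i => kappa i]]; split=> [rho|rho [_ [v /weight_spaceE hv v0]]].
  by rewrite inE => /eqP -> i; rewrite ffunE.
have [m vE] := words_generate v; have vE' := weight_component hv vE.
have [x /andP[xm /eqP xr]] : exists x, (x \in m) && (wt x.2 == rho).
  apply: contrapT => h; case/eqP: v0; rewrite [v]vE' big_seq_cond big1 //= => x hx.
  by case: h; exists x.
exists [ffun i => kappa i], (bar r q (fun i => \sum_j (content x.2 j)%:Z * C i j)).
split; first by rewrite inE.
  by exists (content x.2).
move=> i; rewrite -xr !ffunE /weight_factor expr1z; congr (_ * _).
rewrite /Defs.qi (exprnP q) exprz_exp invr_expz; congr (q ^ (- _)).
rewrite (sum_content x.2 (B i)) mulr_sumr; apply: eq_bigr => j _.
by rewrite mxE mulrCA.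
Qed.

Definition length_spanned n := exists L : seq word,
  all (fun w => size w == n) L /\
  forall w, size w = n -> spanned (fun v => exists2 w', w' \in L & v = lword d w') (lword d w).

(** A leading mode is pulled towards 0 by the quadratic relation between it and the first letter of
    a word in L. Of the other three terms, one has a leading mode nearer to 0, and the other two
    start with a mode at distance at most 1 from that of the letter. So finitely many leading modes
    suffice. *)
Lemma length_spannedS n : length_spanned n.+1 -> length_spanned n.+2.
Proof.
case=> L [Ln LP]; pose modes : seq int := 0 :: flatten [seq if b is y :: _ then [:: y.2 - 1; y.2; y.2 + 1] else [::] | b <- L].
have modes0 : 0 \in modes by apply: mem_head.
pose F := [seq x :: b | x <- [seq (j, l) | j <- enum 'I_N, l <- modes], b <- L].
pose SF := spanned (fun v => exists2 w', w' \in F & v = lword d w').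
exists F; split.
  by apply/allP => _ /allpairsP[[x b] [_ /= bL ->]] /=; rewrite eqSS; apply: (allP Ln).
have inF i l b : l \in modes -> b \in L -> SF (op (fx false i l) (lword d b)).
  move=> lm bL; apply: spanned_mem; exists ((i, l) :: b) => //.
  apply/allpairsP; exists ((i, l), b); split; [|exact: bL|by []].
  by apply/allpairsP; exists (i, l); rewrite mem_enum.
have modeP i l w : l \in modes -> size w = n.+1 -> SF (op (fx false i l) (lword d w)).
  move=> lm /LP; apply: (spanned_linear (op_linr (fx false i l))) => _ [b bL ->].
  exact: inF.
have mode3 y w : y :: w \in L -> [/\ y.2 - 1 \in modes, y.2 \in modes & y.2 + 1 \in modes].
  move=> yw; have h l : l \in [:: y.2 - 1; y.2; y.2 + 1] -> l \in modes.
    move=> ly; rewrite inE; apply/orP; right; apply/flattenP.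
    exists [:: y.2 - 1; y.2; y.2 + 1] => //; apply/mapP; by exists (y :: w).
  by split; apply: h; rewrite !inE eqxx ?orbT.
have step i m : (forall b, b \in L -> SF (op (fx false i m) (lword d b))) ->
    forall w, size w = n.+1 -> SF (op (fx false i m) (lword d w)).
  move=> h w /LP; apply: (spanned_linear (op_linr (fx false i m))) => _ [b bL ->].
  exact: h.
have up (k : nat) i b : b \in L -> SF (op (fx false i k%:Z) (lword d b)).
  elim: k b => [|k IHk] b bL; first by apply: inF; rewrite ?modes0.
  have /eqP := allP Ln b bL; case: b bL => [//|[j l] w] bL [wn].
  have [l1 l2 l3] := mode3 _ _ bL.
  rewrite /= -addn1 PoszD op_exchange.
  apply: spannedD; first by apply: spannedZ; apply: (modeP j l ((i, k%:Z + 1) :: w)) => //=; rewrite wn.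
  apply: spannedD.
    by apply: spannedZ; apply: (step i k IHk ((j, l + 1) :: w)); rewrite /= wn.
  rewrite -scaleN1r; apply: spannedZ.
  by apply: (modeP j (l + 1) ((i, k%:Z) :: w)) => //=; rewrite wn.
have down (k : nat) i b : b \in L -> SF (op (fx false i (- k%:Z)) (lword d b)).
  elim: k b => [|k IHk] b bL; first by apply: inF; rewrite ?oppr0 ?modes0.
  have /eqP := allP Ln b bL; case: b bL => [//|[j l] w] bL [wn].
  have [l1 l2 l3] := mode3 _ _ bL.
  pose m : int := - k.+1%:Z; have m1 : m + 1 = - k%:Z by rewrite /m; lia.
  have := op_exchange false i j m (l - 1) (lword d w).
  rewrite subrK m1 -/m; set a := q ^ _; set X := op (fx false i m) _.
  have a0 : a != 0 by apply: expfz_neq0.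
  move=> E; rewrite /= -/m -/X.
  have -> : X = a^-1 *: (op (fx false i (- k%:Z)) (op (fx false j (l - 1)) (lword d w))
      - a *: op (fx false j (l - 1)) (op (fx false i (- k%:Z)) (lword d w))
      + op (fx false j l) (op (fx false i m) (lword d w))).
    by rewrite E (addrC (a *: op _ _)) addrK subrK scalerA mulVf // scale1r.
  apply: spannedZ; apply: spannedD; last first.
    by apply: (modeP j l ((i, m) :: w)) => //=; rewrite wn.
  apply: spannedD.
    by apply: (step i _ IHk ((j, l - 1) :: w)); rewrite /= wn.
  rewrite -scaleNr; apply: spannedZ.
  by apply: (modeP j (l - 1) ((i, - k%:Z) :: w)) => //=; rewrite wn.
case=> [//|[i m] w] /= [wn]; apply: step => // b bL.
case: m => m; first exact: up.
by rewrite NegzE; apply: down.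
Qed.

Lemma length_spanned_all : length_spanned 1 -> forall n, length_spanned n.
Proof.
move=> h1 [|n]; last by elim: n => // n; apply: length_spannedS.
by exists [:: [::]]; split=> // -[|//] _; apply: spanned_mem; exists [::].
Qed.

(** A weight determines the length of the words of that weight, so its space lies in the span of the
    words of a single length. *)
Lemma generated_finite_dim rho : length_spanned 1 -> finite_dim (weight_space (V := V) rho).
Proof.
move=> h1; case: (pselect (exists w, wt w = rho)) => [[w wr]|h]; last first.
  exists [::] => v /weight_spaceE hv; exists (fun=> 0); rewrite big_ord0.
  have [m vE] := words_generate v; rewrite [v](weight_component hv vE) big1 // => x /eqP xr.
  by case: h; exists x.2.
have [L [Ln LP]] := length_spanned_all h1 (size w).
exists [seq lword d b | b <- L] => v /weight_spaceE hv.
have [m vE] := words_generate v.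
have : spanned (fun u => u \in [seq lword d b | b <- L]) (v : restrict V).
  rewrite (weight_component hv vE); apply: spanned_sum => x /eqP xr.
  apply: spannedZ; have /LP : size x.2 = size w.
    by apply: (word_weight_size q0 q_inf B_nondeg kappa0); rewrite xr wr.
  apply: spanned_sub => _ [b bL ->]; exact: map_f.
exact: spanned_coef.
Qed.

Lemma generated_in_Ohat : length_spanned 1 -> in_Ohat V.
Proof.
move=> h1; split; last by move=> v; have := c1 v; rewrite opE.
split; [exact: generated_weight_decomposition| |exact: generated_cone].
by move=> rho _; apply: generated_finite_dim.
Qed.

End Generated.

End Weights.

(** * Linear recurrences and rational functions *)

Section Recurrence.
Variables (K : fieldType) (W : lmodType K) (y : int -> W).

(** Once powers of X are divided out, both extreme coefficients of p are nonzero, and a window of as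
    many consecutive vectors as the degree of p extends in both directions. *)
Lemma recurrence_span (p : {poly K}) : p != 0 ->
  (forall m, \sum_(k < size p) p`_k *: y (m - k%:Z) = 0) ->
  exists D : nat, forall m, spanned (fun v => exists2 k, (k < D)%N & v = y k%:Z) (y m).
Proof.
elim: {p}(size p) {-2}p (erefl (size p)) => [|n IHn] p sp p0 rec.
  by move/eqP: sp; rewrite size_poly_eq0 (negPf p0).
case: (eqVneq p`_0 0) => [p00|p00].
  have /factor_theorem[p' pE] : root p 0 by rewrite rootE horner_coef0 p00.
  have p'0 : p' != 0 by apply: contraNneq p0 => p'0; rewrite pE p'0 mul0r.
  rewrite subr0 in pE; apply: (IHn p') => // [|m].
    by move: sp; rewrite pE size_mulX // => -[].
  have := rec (m + 1); rewrite pE size_mulX // big_ord_recl.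
  rewrite coefMX eqxx scale0r add0r => E; rewrite -[RHS]E; apply: eq_bigr => k _.
  by rewrite coefMX /=; congr (_ *: y _); rewrite /bump /=; lia.
exists n => m.
pose Y := spanned (fun v => exists2 k, (k < n)%N & v = y k%:Z).
suff h (l : nat) m' : - l%:Z <= m' < n%:Z + l%:Z -> Y (y m') by apply: (h (absz m).+1); lia.
elim: l m' => [|l IHl] m' /andP[h1 h2].
  by apply: spanned_mem; exists (absz m'); [lia|congr y; lia].
have solve (k0 : 'I_(size p)) m1 : p`_k0 != 0 ->
    (forall k : 'I_(size p), k != k0 -> Y (y (m1 - k%:Z))) -> Y (y (m1 - k0%:Z)).
  move=> pk h; have := rec m1; rewrite (bigD1 k0) //= => /eqP.
  rewrite addr_eq0 => /eqP/(congr1 (fun v => (p`_k0)^-1 *: v)).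
  rewrite scalerA mulVf // scale1r => ->; apply: spannedZ; rewrite -scaleN1r.
  by apply: spannedZ; apply: spanned_sum => k kk0; apply/spannedZ/h.
have s0 : (0 < size p)%N by rewrite sp.
have sn : (n < size p)%N by rewrite sp.
case: (ltrP m' (n%:Z + l%:Z)) => h3; last first.
  have -> : m' = m' - (Ordinal s0)%:Z by rewrite subr0.
  apply: solve => // k kk; apply: IHl; have := ltn_ord k.
  have : (0 < k)%N by rewrite lt0n; apply: contra kk => /eqP k0; apply/eqP/val_inj.
  by move: (nat_of_ord k) => k' ? ?; lia.
case: (lerP (- l%:Z) m') => h4; first by apply: IHl; rewrite h4.
have -> : m' = m' + n%:Z - (Ordinal sn)%:Z by rewrite /=; lia.
apply: solve => [|k kk].
  have -> : p`_(Ordinal sn) = lead_coef p by rewrite lead_coefE /= sp.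
  by rewrite lead_coef_eq0.
apply: IHl; have := ltn_ord k.
have : (k != n :> nat) by apply: contra kk => /eqP kn; apply/eqP/val_inj.
by move: (nat_of_ord k) => k' ? ?; lia.
Qed.

End Recurrence.

Lemma cross_multiply (F : fieldType) (a b c d : F) :
  b != 0 -> d != 0 -> a / b = c / d -> a * d = c * b.
Proof. by move=> b0 d0 /eqP; rewrite eqr_div // => /eqP. Qed.

Section Rationality.
Variable R : realType.
Local Notation K := R[i].
Implicit Types (p P Q : {poly K}) (a b : int -> K) (ap am : nat -> K).

(** The coefficient of u^m in the product of p(u) with the formal two-sided series of a. *)
Definition conv p a (m : int) : K := \sum_(k < size p) p`_k * a (m - k%:Z).

Definition pos_part ap (n : int) : K := if 0 <= n then ap (absz n) else 0.
Definition neg_part am (n : int) : K := if n <= 0 then am (absz n) else 0.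

Lemma conv_star p a m : conv p a m = star p (fun n => a (- n)) (- m).
Proof. by apply: eq_bigr => k _; rewrite opprD opprK. Qed.

Lemma convM p1 p2 a m : conv (p1 * p2) a m = conv p1 (conv p2 a) m.
Proof.
rewrite !conv_star starM; apply: star_ext => n.
by rewrite conv_star opprK.
Qed.

Lemma conv_ext p a b m : (forall n, a n = b n) -> conv p a m = conv p b m.
Proof. by move=> ab; apply: eq_bigr => k _; rewrite ab. Qed.

Lemma convB p a b m : conv p (fun n => a n - b n) m = conv p a m - conv p b m.
Proof. by rewrite /conv -sumrB; apply: eq_bigr => k _; rewrite mulrBr. Qed.

Lemma conv_pos_neg p ap m : m < 0 -> conv p (pos_part ap) m = 0.
Proof.
move=> m0; rewrite /conv big1 // => k _; rewrite /pos_part.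
have -> : 0 <= m - k%:Z = false by lia.
exact: mulr0.
Qed.

Lemma conv_pos p ap (n : nat) :
  conv p (pos_part ap) n%:Z = \sum_(k < n.+1) p`_k * ap (n - k)%N.
Proof.
pose d := maxn (size p) n.+1.
rewrite conv_star (@star_wide _ _ _ _ d) ?leq_maxl //.
rewrite (big_ord_widen d (fun k => p`_k * ap (n - k)%N)) ?leq_maxr // [RHS]big_mkcond.
apply: eq_bigr => k _; rewrite opprD !opprK /pos_part ltnS.
case: leqP => kn; last first.
  have -> : 0 <= n%:Z - k%:Z = false by lia.
  exact: mulr0.
have -> : 0 <= n%:Z - k%:Z by lia.
by congr (_ * ap _); lia.
Qed.

Lemma coefz_pos P m : coefz P m = pos_part (fun k => P`_k) m.
Proof. by case: m. Qed.

Lemma conv_coefz p P m : conv p (coefz P) m = coefz (p * P) m.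
Proof.
rewrite (conv_ext _ _ (coefz_pos P)); case: m => m; last by rewrite conv_pos_neg.
by rewrite conv_pos /= coefM.
Qed.

Lemma conv_neg p am m : conv p (neg_part am) m =
  \sum_(k < size p | m <= k%:Z) p`_k * am `|k%:Z - m|%N.
Proof.
rewrite [RHS]big_mkcond; apply: eq_bigr => k _; rewrite /neg_part subr_le0.
by case: ifP => _; rewrite ?mulr0 // -abszN opprB.
Qed.

Definition two_sided ap am (n : int) : K := pos_part ap n - neg_part am n.

(** Multiplied by both denominators, the expansions at 0 and at infinity become the same
    polynomial. *)
Lemma recurrence_of_rational F ap am :
  expansion_at0 F ap -> expansion_at_infty F am ->
  exists2 p : {poly K}, p != 0 & forall m, conv p (two_sided ap am) m = 0.
Proof.
move=> [P [Q [Q0 FE hap]]] [P' [Q' [Q'0 _ FE' ham]]].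
have Qn0 : Q != 0 by apply: contraNneq Q0 => ->; rewrite horner0.
have PQ : P * Q' = P' * Q.
  apply/eqP; rewrite -tofrac_eq !tofracM; apply/eqP.
  by apply: cross_multiply; rewrite ?tofrac_eq0 // -FE.
exists (Q' * Q); first by rewrite mulf_neq0.
have E1 m : conv Q (pos_part ap) m = coefz P m.
  case: m => m; last by rewrite conv_pos_neg.
  by rewrite conv_pos hap.
have E2 m : conv Q' (neg_part am) m = coefz P' m by rewrite conv_neg ham.
move=> m; rewrite convB convM (conv_ext _ _ E1) mulrC convM (conv_ext _ _ E2).
by rewrite !conv_coefz mulrC PQ mulrC subrr.
Qed.

(** The product of Q with the series at 0 has no negative powers, that with the series at infinity
    none from [size Q] on. Being equal, they are a polynomial P, and both series expand P/Q. *)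
Lemma rational_of_recurrence p ap am : p != 0 ->
  (forall m, conv p (two_sided ap am) m = 0) ->
  exists F, expansion_at0 F ap /\ expansion_at_infty F am.
Proof.
move=> p0 rec.
(* A factor X of p only shifts the recurrence; removing all of them makes the denominator nonzero at
   0. *)
have [Q [Q0 recQ]] : exists Q : {poly K}, Q.[0] != 0 /\
    forall m, conv Q (two_sided ap am) m = 0.
  elim: {p}(size p) {-2}p (erefl (size p)) p0 rec => [|n IHn] p sp p0 rec.
    by move/eqP: sp; rewrite size_poly_eq0 (negPf p0).
  case: (eqVneq p.[0] 0) => [p00|p00]; last by exists p.
  have /factor_theorem[p' pE] : root p 0 by rewrite rootE p00.
  have p'0 : p' != 0 by apply: contraNneq p0 => p'0; rewrite pE p'0 mul0r.
  rewrite subr0 in pE; apply: (IHn p') => // [|m].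
    by move: sp; rewrite pE size_mulX // => -[].
  have := rec (m + 1); rewrite pE mulrC !conv_star starX.
  by rewrite opprD subrK.
have Qn0 : Q != 0 by apply: contraNneq Q0 => ->; rewrite horner0.
have pn m : conv Q (pos_part ap) m = conv Q (neg_part am) m.
  by apply/eqP; rewrite -subr_eq0 -convB recQ.
pose P := \poly_(m < size Q) conv Q (pos_part ap) m%:Z.
have PE m : coefz P m = conv Q (pos_part ap) m.
  case: m => m; last by rewrite conv_pos_neg.
  rewrite /= coef_poly; case: ltnP => // mQ; rewrite pn /conv big1 // => k _.
  have := ltn_ord k; rewrite /neg_part => kQ.
  have -> : m%:Z - k%:Z <= 0 = false by lia.
  exact: mulr0.
exists (tofrac P / tofrac Q); split; exists P, Q; split=> //.
- by move=> n; rewrite -conv_pos -PE.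
- exact: size_poly.
- by move=> m; rewrite -conv_neg -pn PE.
Qed.

End Rationality.

(** * For rational f the model is in the category *)

Section RationalModel.
Variables (R : realType) (N : nat) (C : 'M[int]_N) (r : 'I_N -> nat) (q : R[i]).
Local Notation K := R[i].
Local Notation B := (symmetrized_cartan C r).
Local Notation qi := (qi r q).
Local Notation fx := (@fx R N).
Local Notation fphiz := (@fphiz R N q).
Local Notation Uq := (Uq C r q).
Local Notation op := (@op R N C r q _).

Lemma op_fphiz (f : lfamily R N) (V : lmodType Uq) (d : restrict V) s i n :
  lweight_vector f d ->
  op (fphiz s i n) d =
  (if s then pos_part (f true i) n else neg_part (f false i) n) *: d.
Proof.
case=> _ dphi; rewrite /Defs.fphiz /pos_part /neg_part.
have -> : (0 <= sgi s * n) = if s then 0 <= n else n <= 0 by case: s => /=; lia.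
by case: s; case: ifP => _; rewrite ?dphi // op0l scale0r.
Qed.

Lemma raise_lower_lweight (f : lfamily R N) (V : lmodType Uq) (d : restrict V) i j n m :
  c_trivial V -> lweight_vector f d ->
  op (fx true j n) (op (fx false i m) d) =
  (if j == i then (qi j - (qi j)^-1)^-1 * two_sided (f true j) (f false j) (n + m) else 0) *: d.
Proof.
move=> c1 dhw; have [dx _] := dhw; rewrite op_xx // dx op0 add0r.
case: ifP => _; last by rewrite scale0r.
have E s := op_fphiz s j (n + m) dhw.
transitivity ((qi j - (qi j)^-1)^-1 *: (pos_part (f true j) (n + m) *: d
   - neg_part (f false j) (n + m) *: d)).
  by congr (_ *: (_ - _)); [apply: (E true)|apply: (E false)].
by rewrite -scalerBl scalerA.
Qed.

Hypotheses (q0 : q != 0) (qq0 : q - q^-1 != 0).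
Hypothesis BC : forall i j, B i j = B j i.
Hypothesis qint0 : forall i n, qint (qi i) n.+1 != 0.
Hypotheses (Cdiag : forall i, C i i = 2) (Coff : forall i j, i != j -> C i j <= 0).
Hypothesis q_inf : forall m : int, m != 0 -> q ^ m != 1.
Hypothesis B_nondeg : forall a : 'I_N -> int,
  (forall i, \sum_j a j * B i j = 0) -> forall j, a j = 0.

Variable f : lfamily R N.
Hypothesis f_lweight : is_lweight f.
Variable eta : 'I_N -> int -> K.
Hypothesis etaP : forall s i n,
  f true i 0%N ^ sgi s * exp_coef (fun m => sign_factor q s * eta i (sgi s * m%:Z)) n = f s i n.

Local Notation model := (model q0 qq0 BC qint0 Cdiag Coff f_lweight eta).
Local Notation model_vac := (model_vac q0 qq0 BC qint0 Cdiag Coff f_lweight eta).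

Lemma model_length_spanned :
  (forall i, exists F, expansion_at0 F (f true i) /\ expansion_at_infty F (f false i)) ->
  length_spanned (model_vac : restrict model) 1.
Proof.
move=> rat.
have dhw := model_lweight q0 qq0 BC qint0 Cdiag Coff f_lweight etaP.
have c1 := @model_c_trivial R N C r q q0 qq0 BC qint0 Cdiag Coff f f_lweight eta.
have /choice[D DP] : forall i, exists D : nat, forall m, spanned
    (fun v => exists2 k, (k < D)%N & v = op (fx false i k%:Z) (model_vac : restrict model))
    (op (fx false i m) (model_vac : restrict model)).
  move=> i; have [F [F0 Finf]] := rat i; have [p p0 rec] := recurrence_of_rational F0 Finf.
  apply: (recurrence_span (y := fun m => op (fx false i m) (model_vac : restrict model)) p0) => m.
  (* The recurrence says that all x^+ kill v, so v is a multiple of the vacuum; the multiple is 0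
     because lowered vectors vanish on the empty word. *)
  set v := (X in X = 0).
  have [|c vE] := @model_singular R N C r q q0 qq0 BC qint0 Cdiag Coff f f_lweight eta v.
    move=> j n; rewrite op_sum.
    under eq_bigr do rewrite opZ (raise_lower_lweight _ _ _ _ c1 dhw) scalerA.
    rewrite -scaler_suml; case: eqP => [->|_]; last first.
      by rewrite big1 ?scale0r // => k _; rewrite mulr0.
    under eq_bigr do rewrite mulrCA addrA.
    by rewrite -mulr_sumr -/(conv p _ (n + m)) rec mulr0 scale0r.
  have : val (v : model) [::] = 0.
    rewrite /v; elim/big_rec: _ => [//|k u _ IH].
    by rewrite val_subrepD dualD IH val_scale dualZ val_model_op actv_fx mulr0 addr0.
  by rewrite {1}vE val_scale dualZ /= mulr1 => c0; rewrite vE c0 scale0r.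
exists [seq [:: (i, k%:Z)] | i <- enum 'I_N, k <- iota 0 (\max_i D i)].
split; first by apply/allP => _ /allpairsP[x [_ _ ->]].
case=> [//|[i m] [|//]] _; apply: spanned_sub (DP i m) => _ [k kD ->].
exists [:: (i, k%:Z)] => //; apply/allpairsP; exists (i, k); split=> //=.
  by rewrite mem_enum.
by rewrite mem_iota add0n; apply: leq_trans kD (leq_bigmax i).
Qed.

Lemma model_in_Ohat : rational_lweights f -> in_Ohat model.
Proof.
case=> _ rat.
apply: (generated_in_Ohat q0 q_inf B_nondeg qq0 (lweight_sign f_lweight)).
- exact: model_c_trivial.
- exact: (model_lweight q0 qq0 BC qint0 Cdiag Coff f_lweight etaP).
- exact: model_generated.
- by apply: model_length_spanned => i; have [F [h1 h2 _]] := rat i; exists F.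
Qed.

End RationalModel.

(** * Dimension bounds and common eigenvectors *)

Section Dimension.
Variables (K : fieldType) (W : lmodType K).
Implicit Types (T : W -> Prop) (u v : W).

Definition subspace T : Prop := T 0 /\ forall a u v, T u -> T v -> T (a *: u + v).

(** A bound by linear dependence: it applies to any predicate on W, with no choice of a basis. *)
Definition dim_le T n : Prop := forall u : 'I_n.+1 -> W, (forall k, T (u k)) ->
  exists2 a : 'I_n.+1 -> K, (exists k, a k != 0) & \sum_k a k *: u k = 0.

Lemma dim_le_spanned T (L : seq W) :
  (forall v, T v -> exists a : 'I_(size L) -> K, v = \sum_(k < size L) a k *: L`_k) ->
  dim_le T (size L).
Proof.
move=> TL u Tu; have /choice[A AE] := fun k => TL _ (Tu k).
pose M := \matrix_(k, l) A k l.
have : kermx M != 0.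
  rewrite -mxrank_eq0 mxrank_ker subn_eq0 -ltnNge ltnS; exact: rank_leq_col.
case/rowV0Pn => x /sub_kermxP xM x0.
exists (fun k => x 0 k).
  by apply/existsP; apply: contraNT x0; rewrite negb_exists => /forallP h;
    apply/eqP/rowP => k; rewrite mxE; apply/eqP; rewrite -[_ == 0]negbK h.
under eq_bigr do rewrite AE scaler_sumr.
rewrite exchange_big big1 // => l _ /=; under eq_bigr do rewrite scalerA.
rewrite -scaler_suml; have := congr1 (fun X : 'rV_(size L) => X 0 l) xM.
rewrite !mxE => E; rewrite [X in X *: _](_ : _ = 0) ?scale0r // -[RHS]E.
by apply: eq_bigr => k _; rewrite mxE.
Qed.

Lemma dim_le0 T v : dim_le T 0 -> T v -> v = 0.
Proof.
move=> T0 Tv; have [a [k ak]] := T0 (fun=> v) (fun=> Tv).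
rewrite big_ord1 => /eqP; rewrite scaler_eq0; case/orP=> [|/eqP //].
by have -> : ord0 = k; [apply: val_inj; case: (k) => -[]|rewrite (negPf ak)].
Qed.

Lemma dim_le_proper T T' w n : subspace T' -> (forall v, T' v -> T v) -> T w -> ~ T' w ->
  dim_le T n.+1 -> dim_le T' n.
Proof.
move=> [T0 TD] sub Tw nTw Tn u T'u.
(* Here w is put in front of the n+1 vectors of T'; its coefficient in the dependence must vanish,
   since w is not in T'. *)
have [|a [k ak]] := Tn (fun k => oapp u w (unlift ord0 k)).
  by move=> k; case: unliftP => [j _|_] //=; apply: sub.
rewrite big_ord_recl unlift_none /=.
under eq_bigr do rewrite liftK /=.
move=> E; have Tsum : T' (\sum_i a (lift ord0 i) *: u i).
  by elim/big_rec: _ => // i x _ Tx; apply: TD.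
have a0 : a ord0 = 0.
  apply/eqP; apply: contraT => a0; case: nTw.
  have -> : w = (- (a ord0)^-1) *: (\sum_i a (lift ord0 i) *: u i) + 0.
    move/eqP: E; rewrite addr_eq0 => /eqP/(congr1 (fun v => (a ord0)^-1 *: v)).
    by rewrite scalerA mulVf // scale1r addr0 scalerN scaleNr.
  exact: TD.
exists (fun i => a (lift ord0 i)); last by rewrite a0 scale0r add0r in E.
by case: (unliftP ord0 k) ak => [j ->|->] ak; [exists j|rewrite a0 eqxx in ak].
Qed.

End Dimension.

Section CommonEigenvector.
Variables (K : closedFieldType) (W : lmodType K).
Implicit Types (T : W -> Prop) (u v : W) (p : {poly K}) (A : W -> W).

Definition poly_act A p v : W := \sum_(k < size p) p`_k *: iter k A v.

Lemma poly_act_wide A p v d : (size p <= d)%N ->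
  poly_act A p v = \sum_(k < d) p`_k *: iter k A v.
Proof.
move=> pd; rewrite /poly_act (big_ord_widen _ (fun k => p`_k *: iter k A v) pd).
rewrite big_mkcond; apply: eq_bigr => k _.
by case: ltnP => // kp; rewrite nth_default ?scale0r.
Qed.

Lemma iter_linear A k : linear A -> linear (iter k A).
Proof. by move=> Al; elim: k => [|k IHk] a u v //; rewrite !iterS IHk Al. Qed.

Lemma poly_actM A p z v : linear A ->
  poly_act A (p * ('X - z%:P)) v = poly_act A p (A v - z *: v).
Proof.
move=> Al; case: (eqVneq p 0) => [->|p0].
  by rewrite mul0r /poly_act size_poly0 !big_ord0.
rewrite /poly_act size_Mmonic ?monicXsubC // size_XsubC addn2 /=.
have pE k : (p * ('X - z%:P))`_k = (p * 'X)`_k - z * p`_k.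
  by rewrite mulrBr coefB coefMC (mulrC z).
under eq_bigr do rewrite pE scalerBl.
rewrite sumrB big_ord_recl /= coefMX eqxx scale0r add0r.
rewrite [X in _ - X]big_ord_recr /= nth_default // mulr0 scale0r addr0 -sumrB.
apply: eq_bigr => k _; rewrite coefMX /= add0n [z * _]mulrC -scalerA -scalerBr.
congr (_ *: _); rewrite -iterS iterSr -scaleNr [in RHS]addrC -scaleNr.
by rewrite (iter_linear k Al) addrC.
Qed.

(** A dependence among the iterates of v gives a nonzero p with p(A) v = 0. Induction on its size:
    for a root z, either v is an eigenvector or A v - z v is killed by a smaller polynomial. *)
Lemma eigenvector_exists T A n : subspace T -> linear A -> (forall v, T v -> T (A v)) ->
  dim_le T n -> (exists2 v, T v & v != 0) ->
  exists c, exists2 v, T v /\ v != 0 & A v = c *: v.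
Proof.
move=> [T0 TD] Al TA Tn [v Tv v0].
have Titer k u : T u -> T (iter k A u) by elim: k => // k IHk Tu; apply/TA/IHk.
have [a [k0 ak0] aE] := Tn (fun k => iter k A v) (fun k => Titer k v Tv).
pose p := \poly_(k < n.+1) a (inord k).
have pE : poly_act A p v = 0.
  rewrite (@poly_act_wide _ _ _ n.+1) ?size_poly // -[RHS]aE; apply: eq_bigr => k _.
  by rewrite coef_poly ltn_ord inord_val.
have p0 : p != 0.
  apply/eqP => /(congr1 (fun p : {poly K} => p`_k0)); rewrite coef0 coef_poly ltn_ord inord_val.
  by move/eqP; rewrite (negPf ak0).
elim: {p}(size p) {-2}p (erefl (size p)) p0 v Tv v0 pE {aE} => [|m IHm] p sp p0 v Tv v0 pE.
  by move/eqP: sp; rewrite size_poly_eq0 (negPf p0).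
case: (eqVneq (size p) 1) => [sp1|sp1].
  move: pE; rewrite /poly_act sp1 big_ord1 /= => /eqP; rewrite scaler_eq0 (negPf v0) orbF.
  by rewrite (_ : p`_0 = lead_coef p) ?lead_coef_eq0 ?(negPf p0) // lead_coefE sp1.
have [z /factor_theorem[p' p'E]] := closed_rootP _ sp1.
have p'0 : p' != 0 by apply: contraNneq p0 => p'0; rewrite p'E p'0 mul0r.
case: (eqVneq (A v - z *: v) 0) => [/eqP|Av].
  by rewrite subr_eq0 => /eqP Av; exists z, v.
apply: (IHm p') Av _ => //.
- by move: sp; rewrite p'E size_Mmonic ?monicXsubC // size_XsubC addn2 /= => -[].
- by rewrite addrC -scaleNr; apply: TD => //; apply: TA.
- by rewrite -poly_actM // -p'E.
Qed.

(** If some operator is not scalar on T, one of its eigenspaces is a proper nonzero subspace, stable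
    under the others by commutation, and the dimension bound drops. *)
Lemma common_eigenvector (I : Type) (A : I -> W -> W) n T :
  subspace T -> dim_le T n -> (exists2 v, T v & v != 0) ->
  (forall i, linear (A i)) -> (forall i v, T v -> T (A i v)) ->
  (forall i j v, T v -> A i (A j v) = A j (A i v)) ->
  exists2 v, T v /\ v != 0 & forall i, exists c, A i v = c *: v.
Proof.
elim: n T => [|n IHn] T sT Tn [v Tv v0] Al TA AC.
  by case/eqP: v0; apply: dim_le0 Tn Tv.
case: (pselect (forall i, exists c, forall u, T u -> A i u = c *: u)) => [h|].
  by exists v => // i; have [c cE] := h i; exists c; apply: cE.
move=> /existsNP[i nsc].
have [c [u [Tu u0] uE]] := eigenvector_exists sT (Al i) (TA i) Tn (ex_intro2 _ _ v Tv v0).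
pose T' w := T w /\ A i w = c *: w.
have [w [Tw nw]] : exists w, T w /\ A i w <> c *: w.
  apply: contrapT => h; apply: nsc; exists c => w Tw; apply: contrapT => nw.
  by apply: h; exists w.
have sT' : subspace T'.
  have [T0 TD] := sT; split.
    split=> //; have := Al i (-1) 0 0; rewrite scaler0 addr0 => ->.
    by rewrite scaleN1r addNr scaler0.
  move=> a x y [Tx xE] [Ty yE]; split; first exact: TD.
  by rewrite Al xE yE scalerDr !scalerA mulrC.
have T'n : dim_le T' n.
  by apply: (@dim_le_proper _ _ T T' w) => // [x []|[]].
have T'A j x : T' x -> T' (A j x).
  case=> Tx xE; split; first exact: TA.
  rewrite AC // xE; have := Al j c x 0; rewrite !addr0 => ->.
  by have := Al j (-1) 0 0; rewrite scaler0 addr0 scaleN1r addNr => ->; rewrite addr0.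
have T'C j k x : T' x -> A j (A k x) = A k (A j x) by case=> Tx _; apply: AC.
have [x [[Tx _] x0] h] := IHn T' sT' T'n (ex_intro2 _ _ u (conj Tu uE) u0) Al T'A T'C.
by exists x.
Qed.

End CommonEigenvector.

(** * Simple objects have a highest l-weight, and it is rational *)

Section SimpleObjects.
Variables (R : realType) (N : nat) (C : 'M[int]_N) (r : 'I_N -> nat) (q : R[i]).
Local Notation K := R[i].
Local Notation B := (symmetrized_cartan C r).
Local Notation qi := (qi r q).
Local Notation fx := (@fx R N).
Local Notation fh := (@fh R N).
Local Notation fk := (@fk R N).
Local Notation Uq := (Uq C r q).
Local Notation op := (@op R N C r q _).
Implicit Types V : lmodType Uq.

Hypothesis q0 : q != 0.
Hypothesis q_inf : forall m : int, m != 0 -> q ^ m != 1.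
Hypothesis B_nondeg : forall a : 'I_N -> int,
  (forall i, \sum_j a j * B i j = 0) -> forall j, a j = 0.
Hypothesis qq0 : q - q^-1 != 0.
Hypothesis qi0 : forall i, qi i - (qi i)^-1 != 0.

(** The shift of rho by the element sum a_j alpha_j of the root lattice; it is written with B
    because q_i^(C i j) = q^(B i j). *)
Definition shift_weight (rho : {ffun 'I_N -> K}) (a : 'I_N -> int) : {ffun 'I_N -> K} :=
  [ffun i => rho i * q ^ (\sum_j a j * B i j)].

Lemma shift_weightD rho a b :
  shift_weight (shift_weight rho a) b = shift_weight rho (fun j => a j + b j).
Proof.
apply/ffunP => i; rewrite !ffunE -mulrA -expfzDr //; congr (_ * q ^ _).
by rewrite -big_split; apply: eq_bigr => j _ /=; rewrite mulrDl.
Qed.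

Lemma shift_weight_weights rho a : weights rho -> weights (shift_weight rho a).
Proof. by move=> h i; rewrite ffunE mulf_neq0 ?expfz_neq0. Qed.

Lemma shift_weight_inj rho a b : weights rho ->
  shift_weight rho a = shift_weight rho b -> forall j, a j = b j.
Proof.
move=> h E j; apply/eqP; rewrite -subr_eq0; apply/eqP; move: j.
apply: B_nondeg => i; have /ffunP/(_ i) := E; rewrite !ffunE => /(mulfI (h i)).
move/(q_inj q0 q_inf) => Ei; under eq_bigr do rewrite mulrBl.
by rewrite sumrB Ei subrr.
Qed.

Lemma shift_weight1 rho j : shift_weight rho (fun k => (k == j)%:Z) =
  [ffun i => rho i * q ^ (B i j)].
Proof.
apply/ffunP => i; rewrite !ffunE (bigD1 j) //= eqxx mul1r big1 ?addr0 //.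
by move=> k /negPf ->; rewrite mul0r.
Qed.

Lemma fx_weight V rho s j n (v : restrict V) : weight_vector rho v ->
  weight_vector [ffun i => rho i * q ^ (sgi s * B i j)] (op (fx s j n) v).
Proof.
move=> h i; rewrite (fk_fx q0) h opZ scalerA ffunE mulrC.
by rewrite [sgi true * _]mul1r.
Qed.

Lemma bar_root (a : 'I_N -> nat) i :
  bar r q (fun i => \sum_j (a j)%:Z * C i j) i = q ^ (\sum_j (a j)%:Z * B i j).
Proof.
rewrite ffunE /Defs.qi (exprnP q) exprz_exp; congr (q ^ _).
by rewrite mulr_sumr; apply: eq_bigr => j _; rewrite mxE mulrCA.
Qed.

(** If rho shifted by a lies below rho1 in the sense of the cone condition, then rho1 is rho shifted
    by a + b with b nonnegative. Injectivity of the shifts makes a + b depend on rho1 only, and it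
    bounds a. *)
Lemma weight_height_bounded V rho : in_Ohat V -> weights rho ->
  exists H : nat, forall a : 'I_N -> nat,
    is_weight V (shift_weight rho (fun j => (a j)%:Z)) -> (\sum_j a j <= H)%N.
Proof.
move=> [[_ _ [s [sw sP]]] _] rw.
have [H HP] : exists H : nat, forall (a : 'I_N -> nat) rho0 x, rho0 \in s -> Qplus_bar C r q x ->
    (forall i, shift_weight rho (fun j => (a j)%:Z) i = rho0 i * (x i)^-1) ->
    (\sum_j a j <= H)%N.
  elim: s {sw sP} => [|rho1 s [H HP]]; first by exists 0%N.
  have sumE (a : 'I_N -> nat) x (rho0 : {ffun 'I_N -> K}) : Qplus_bar C r q x ->
      (forall i, shift_weight rho (fun j => (a j)%:Z) i = rho0 i * (x i)^-1) ->
      exists b : 'I_N -> nat, rho0 = shift_weight rho (fun j => (a j + b j)%N%:Z).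
    move=> [b _ xE] h; exists b; apply/ffunP => i; have := h i.
    rewrite -xE bar_root => /(congr1 (fun z => z * q ^ (\sum_j (b j)%:Z * B i j))).
    rewrite mulfVK ?expfz_neq0 // => <-; rewrite !ffunE -mulrA -expfzDr //.
    congr (_ * q ^ _); rewrite -big_split; apply: eq_bigr => j _ /=.
    by rewrite PoszD mulrDl.
  case: (pselect (exists b : 'I_N -> nat, rho1 = shift_weight rho (fun j => (b j)%:Z))).
    move=> [b bE]; exists (maxn H (\sum_j b j)) => a rho0 x; rewrite inE leq_max.
    case/predU1P => [->|rs] hx h; last by rewrite (HP _ _ _ rs hx h).
    have [c cE] := sumE _ _ _ hx h; apply/orP; right; apply: leq_sum => j _.
    rewrite bE in cE; have := shift_weight_inj rw cE j.
    by move=> [->]; apply: leq_addr.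
  move=> nb; exists H => a rho0 x; rewrite inE => /predU1P[->|rs] hx h; last exact: HP h.
  by have [c cE] := sumE _ _ _ hx h; case: nb; eexists; apply: cE.
exists H => a /sP[rho0 [x [rs hx h]]]; exact: HP hx h.
Qed.

Lemma op_hh V i j n m (v : restrict V) : c_trivial V ->
  op (fh i n) (op (fh j m) v) = op (fh j m) (op (fh i n) v).
Proof.
move=> c1; case: (eqVneq n 0) => [->|n0]; first by rewrite /= !op0l op0.
case: (eqVneq m 0) => [->|m0]; first by rewrite /= !op0l op0.
apply/eqP; rewrite -subr_eq0 -!opM -opBl (op_rel _ (rel_hh C r q i j n0 m0)); apply/eqP.
case: ifP => _; last exact: op0l.
by rewrite opZl opBl !(op_fc c1) subrr scaler0.
Qed.

Lemma op_kh V i j n (v : restrict V) :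
  op (fk true i) (op (fh j n) v) = op (fh j n) (op (fk true i) v).
Proof.
case: (eqVneq n 0) => [->|n0]; first by rewrite /= !op0l op0.
by rewrite -!opM (op_rel _ (rel_kh C r q i j n0)).
Qed.

Lemma weight_exists V (v : V) : weight_decomposition V -> v != 0 -> exists rho, is_weight V rho.
Proof.
move=> dec v0; have [w [[wh _ _ vE] _]] := dec v.
apply: contrapT => h; case/eqP: v0; rewrite vE fsbig1 // => rho rw.
apply: contrapT => /eqP wr; case: h; exists rho; split=> //.
by exists (w rho) => //; apply: wh.
Qed.

Lemma finite_dim_le V rho : finite_dim (weight_space (V := V) rho) ->
  exists n, dim_le (weight_vector rho : restrict V -> Prop) n.
Proof.
move=> [b bP]; exists (size b); apply: (dim_le_spanned (W := restrict V)) => v hv.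
by apply: bP; apply/weight_spaceE.
Qed.

Lemma simple_generated V (d : V) : simple_module V -> d != 0 ->
  forall w : V, exists a : Uq, w = a *: d.
Proof.
move=> [_ simV] d0; pose S (v : V) := exists t : Uq, v = t *: d.
have subS : is_submodule S.
  split; first by exists 0; rewrite scale0r.
  by move=> a v w [t ->] [t' ->]; exists (a * t + t'); rewrite scalerDl scalerA.
case: (simV S subS) => SE w; last by have : S w by rewrite SE.
have : S d by exists 1; rewrite scale1r.
by rewrite SE /= => /eqP; rewrite (negPf d0).
Qed.

(** The vectors x^-_{i,-k} d share one finite-dimensional weight space, so finitely many of them are
    dependent; applying x^+_{i,m} for all m turns the dependence into a recurrence. The modes -k
    make its coefficients those of p in [conv]. *)
Lemma lweight_rational f V (d : restrict V) : in_Ohat V -> (d : V) != 0 ->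
  lweight_vector f d -> rational_lweights f.
Proof.
move=> [[dec fd cone] cV] d0 hd; have c1 := c_acts_triviallyE cV.
have f0 := lweight_inverse d0 hd; have [dx dphi] := hd.
split=> [i|i]; first exact: (f0 true i).
pose rho := [ffun i => f true i 0%N].
have rw : weights rho by move=> j; rewrite ffunE; apply: lweight_neq0 f0 true j.
have hrho : weight_vector rho d by move=> j; rewrite ffunE; apply: lweight_fk hd j.
pose rho' := shift_weight rho (fun j => - (j == i)%:Z).
have hrho' m : weight_vector rho' (op (fx false i m) d).
  rewrite (_ : rho' = [ffun j => rho j * q ^ (sgi false * B j i)]); first exact: fx_weight.
  apply/ffunP => j; rewrite !ffunE; congr (_ * q ^ _).
  rewrite (bigD1 i) //= eqxx big1 ?addr0 // => k /negPf ->; by rewrite oppr0 mul0r.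
have [n nP] := finite_dim_le (fd rho' (shift_weight_weights _ rw)).
have [a [k0 ak0] aE] := nP (fun k => op (fx false i (- k%:Z)) d) (fun k => hrho' _).
pose p := \poly_(k < n.+1) a (inord k).
have p0 : p != 0.
  apply/eqP => /(congr1 (fun p : {poly K} => p`_k0)); rewrite coef0 coef_poly ltn_ord inord_val.
  by move/eqP; rewrite (negPf ak0).
have [m|F [F0 Finf]] := @rational_of_recurrence R p (f true i) (f false i) p0; last first.
  by exists F; split=> //; apply: (f0 true i).
have := congr1 (op (fx true i m)) aE; rewrite op_sum op0.
under eq_bigr do rewrite opZ (raise_lower_lweight _ _ _ _ c1 hd) eqxx scalerA mulrCA.
rewrite -scaler_suml -mulr_sumr => /eqP; rewrite scaler_eq0 (negPf d0 : (d == 0) = false) orbF.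
rewrite mulf_eq0 invr_eq0 (negPf (qi0 i)) => /= /eqP sE.
rewrite conv_star (@star_wide _ _ _ _ n.+1) ?size_poly // -[RHS]sE.
by apply: eq_bigr => k _; rewrite coef_poly ltn_ord inord_val opprD !opprK.
Qed.

Lemma simple_highest V : simple_module V -> in_Ohat V ->
  exists2 f, rational_lweights f & L C r q f V.
Proof.
move=> sV oV; have [[dec fd cone] cV] := oV; have c1 := c_acts_triviallyE cV.
have [[v1 v10] _] := sV; have [rho1 rho1w] := weight_exists dec v10.
have [rw1 _] := rho1w; have [H HP] := weight_height_bounded oV rw1.
(* Among the weights obtained from [rho1] by shifts a in Q^+, one of maximal height sum a_j is
   chosen; an x^+ that did not kill its weight space would give a greater height. *)
pose Q n := `[< exists a : 'I_N -> nat,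
   is_weight V (shift_weight rho1 (fun j => (a j)%:Z)) /\ (\sum_j a j)%N = n >].
have exQ : exists n, Q n.
  exists 0%N; apply/asboolP; exists (fun=> 0%N); split; last by rewrite big1.
  rewrite (_ : shift_weight _ _ = rho1) //; apply/ffunP => i; rewrite ffunE.
  by rewrite big1 ?mulr1 // => j _; rewrite mul0r.
have bQ n : Q n -> (n <= H)%N by case/asboolP => a [/HP + <-].
case: (ex_maxnP exQ bQ) => n0 /asboolP[a [[rw [w0 wh0 w00]] aE]] maxQ.
set rho := shift_weight rho1 _ in rw w0 wh0 w00.
have kill j n (v : restrict V) : weight_vector rho v -> op (fx true j n) v = 0.
  move=> hv; apply/eqP; apply: contraT => x0.
  suff /maxQ : Q n0.+1 by rewrite ltnn.
  apply/asboolP; exists (fun k => a k + (k == j))%N; split; last first.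
    rewrite big_split /= aE (bigD1 j) //= eqxx big1 ?addn0 ?addn1 // => k /negPf -> //.
  rewrite (_ : shift_weight _ _ = shift_weight rho (fun k => (k == j)%:Z)); last first.
    by rewrite /rho shift_weightD; apply/ffunP => i; rewrite !ffunE; congr (_ * q ^ _).
  split; first exact: shift_weight_weights.
  exists (op (fx true j n) v) => //; apply/weight_spaceE.
  rewrite shift_weight1.
  by have := fx_weight true j n hv; under eq_ffun do rewrite mul1r.
have [D DP] := finite_dim_le (fd rho rw).
have subT : subspace (weight_vector rho : restrict V -> Prop).
  by split; [apply: weight_vector0|move=> *; apply: weight_vectorD].
pose A (x : 'I_N * int) (v : restrict V) : restrict V := op (fh x.1 x.2) v.
have exT : exists2 v : restrict V, weight_vector rho v & v != 0.
  by exists w0 => //; apply/weight_spaceE.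
have [|||d [hd d0] dh] := @common_eigenvector _ (restrict V) _ A D _ subT DP exT.
- by move=> x; apply: op_linr.
- by move=> x v hv i; rewrite /A op_kh hv opZ.
- by move=> x y v _; rewrite /A op_hh.
have [e eP] := choice dh.
pose f : lfamily R N := fun s i n => rho i ^ sgi s *
  exp_coef (fun m => sign_factor q s * e (i, sgi s * m%:Z)) n.
have hf : lweight_vector f d.
  split=> [i n|s i n]; first exact: kill.
  apply: (@fphi_eigen _ _ q (fun x c => op x d = c *: d)) => [|||||m mn].
  - by rewrite op0l scale0r.
  - by rewrite op1 scale1r.
  - by move=> b x y c c' Ex Ey; rewrite op_linl Ex Ey scalerDl scalerA.
  - by move=> x y c c' Ex Ey; rewrite opM Ey opZ Ex scalerA mulrC.
  - by apply: dk_sign => // i'; apply: hd.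
  - by rewrite opZl -[op _ _]/(A (i, sgi s * m%:Z) d) eP scalerA.
exists f; first exact: lweight_rational hf.
split=> //; exists d; have [dx dphi] := hf; split=> //.
- exact: simple_generated.
- by move=> i n; have := dx i n; rewrite opE.
- by move=> s i n; have := dphi s i n; rewrite opE restrictE.
Qed.

End SimpleObjects.

(** * Consequences of the hypotheses on C and q, and the bijection *)

Lemma positive_definite_nondeg (R : realType) N (B : 'M[int]_N) :
  positive_definite (map_mx intr B : 'M[R]_N) ->
  forall a : 'I_N -> int, (forall i, \sum_j a j * B i j = 0) -> forall j, a j = 0.
Proof.
move=> pd a aB j; apply/eqP; apply: contraT => aj.
pose x : 'cV[R]_N := \col_j (a j)%:~R.
have x0 : x != 0.
  apply: contraNneq aj => /matrixP/(_ j 0); rewrite !mxE => /eqP.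
  by rewrite intr_eq0.
have := pd x x0; rewrite -mulmxA (_ : map_mx intr B *m x = 0) ?mulmx0 ?mxE ?ltxx //.
apply/matrixP => i k; rewrite !mxE -[RHS](mulr0z 1) -(aB i) rmorph_sum.
by apply: eq_bigr => l _; rewrite !mxE rmorphM /= mulrC.
Qed.

Section Nondegeneracy.
Variables (R : realType) (N : nat) (C : 'M[int]_N) (r : 'I_N -> nat) (q : R[i]).

Lemma transcendental_expr (n : nat) : ~ algebraicOver (@ratr R[i]) q -> (0 < n)%N ->
  q ^+ n != 1.
Proof.
move=> hq n0; apply/eqP => qn; apply: hq; exists ('X^n - 1).
  by rewrite monic_neq0 // monicXnsubC.
by rewrite rmorphB /= map_polyXn rmorph1 rootE !hornerE qn subrr.
Qed.

Lemma transcendental_exprz : q != 0 -> ~ algebraicOver (@ratr R[i]) q ->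
  forall m : int, m != 0 -> q ^ m != 1.
Proof.
move=> q0 hq [n|n] n0; first by apply: transcendental_expr; rewrite // lt0n.
by rewrite NegzE -invr_expz invr_eq1; apply: transcendental_expr.
Qed.

Hypothesis q0 : q != 0.
Hypothesis q_inf : forall m : int, m != 0 -> q ^ m != 1.

Lemma exprz_sub_inv (m : int) : m != 0 -> q ^ m - q ^ (- m) != 0.
Proof.
move=> m0; rewrite subr_eq0; apply/eqP => E.
have /q_inf/eqP[] : m + m != 0 by lia.
by rewrite expfzDr // {1}E -expfzDr // addNr.
Qed.

Lemma q_sub_inv : q - q^-1 != 0.
Proof. by have := @exprz_sub_inv 1 isT; rewrite expr1z exprN1. Qed.

Hypothesis r0 : forall i, (0 < r i)%N.

Lemma qi_exprz i (m : int) : (qi r q i) ^ m = q ^ ((r i)%:Z * m).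
Proof. by rewrite /qi (exprnP q) exprz_exp. Qed.

Lemma qi_sub_inv i : qi r q i - (qi r q i)^-1 != 0.
Proof.
have := @exprz_sub_inv (r i)%:Z; rewrite -invr_expz => h.
by apply: h; have := r0 i; lia.
Qed.

Lemma qint_qi_neq0 i n : qint (qi r q i) n.+1 != 0.
Proof.
rewrite /qint mulf_neq0 ?invr_eq0 ?qi_sub_inv // !qi_exprz mulrN exprz_sub_inv //.
by have := r0 i; lia.
Qed.

End Nondegeneracy.

Theorem theorem3p6 (R : realType) (N : nat) (C : 'M[int]_N) (r : 'I_N -> nat)
    (q : R[i]) (hC : simple_cartan_datum R C r) (hq0 : q != 0)
    (hq : ~ algebraicOver (@ratr R[i]) q) :
  bijection_between (@rational_lweights R N) (simple_iso_classes C r q)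
    (fun f => L C r q f).
Proof.
case: hC => _ [[Cdiag Coff _] _] [r0 _] BT pd.
have BC i j : symmetrized_cartan C r i j = symmetrized_cartan C r j i.
  by rewrite -[in LHS]BT mxE.
have B_nondeg := positive_definite_nondeg pd.
have q_inf := transcendental_exprz hq0 hq.
have qq0 := q_sub_inv hq0 q_inf.
have qi0 := qi_sub_inv hq0 q_inf r0.
have qint0 := qint_qi_neq0 hq0 q_inf r0.
(* Classes are predicates, compared extensionally: one inclusion is the uniqueness of L(f), the
   other its invariance under isomorphism. *)
have class_eq f (V : lmodType (Uq C r q)) : L C r q f V -> L C r q f = iso_class V.
  move=> LV; apply/funext => W; apply/propext; split=> [LW|iVW].
    exact: (highest_lweight_iso hq0 q_inf B_nondeg qq0 LV LW).
  exact: L_iso iVW LV.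
split=> [f ratf|f g ratf ratg Lfg|_ [V [sV oV ->]]].
- have lf : is_lweight f by case: ratf.
  have [eta etaP] := model_eta_exists hq0 qq0 lf.
  have Lm := model_L hq0 qq0 BC qint0 Cdiag Coff q_inf B_nondeg lf etaP.
  exists (model hq0 qq0 BC qint0 Cdiag Coff lf eta); split; last exact: class_eq.
    by case: Lm.
  exact: model_in_Ohat.
- have lf : is_lweight f by case: ratf.
  have [eta etaP] := model_eta_exists hq0 qq0 lf.
  have Lm := model_L hq0 qq0 BC qint0 Cdiag Coff q_inf B_nondeg lf etaP.
  move: Lfg Lm => /= -> Lg; exact: esym (model_L_inj etaP Lg).
- have [f ratf LV] := simple_highest hq0 q_inf B_nondeg qi0 sV oV.
  by exists f => //; apply: class_eq.
Qed.
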